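(* There is a function $R:(0,\infty)\to\mathbb{R}$ with $R(p) = O(p^{-1/2})$ as $p\to\infty$ such that the following holds. Let $E$ be a Hermite–Biehler entire function with no real zeros whose phase function satisfies $\varphi' \in L^\infty(\mathbb{R})$. Then for every $0<p<\infty$, $$C(p,E)^p \leq \lVert\varphi'\rVert_\infty \frac{1}{2\sqrt{2\pi}}\left(\sqrt{p} + R(p)\right);$$ in particular the implicit constant in the $O(p^{-1/2})$ term does not depend on $\lVert \varphi'\rVert_\infty$.
   Context: An entire function $E$ is Hermite–Biehler if $\lvert E(\overline{z})\rvert < \lvert E(z)\rvert$ for $z$ in the upper half-plane $\mathbb{C}_+$. Let $E^{\#}(z) = \overline{E(\overline z)}$ and $\Theta_E = E^{\#}/E$, a meromorphic inner function; the phase function $\varphi$ is a smooth real function on $\mathbb{R}$ with $\Theta_E(x) = e^{i\varphi(x)}$ (equivalently $\varphi = -2\arg E$ on $\mathbb{R}$); it is increasing. For $0<p<\infty$, $\mathcal{H}^p(E)$ is the space of entire $f$ such that $f/E$ and $f^{\#}/E$ belong to the Hardy space $H^p(\mathbb{C}_+)$, with $\lVert f/E\rVert_p = (\int_{\mathbb{R}}\lvert f(x)/E(x)\rvert^p dx)^{1/p}$; $\mathcal{H}^\infty(E)$ is defined analogously with bounded analytic functions and $\lVert f/E\rVert_\infty = \sup_{x\in\mathbb{R}}\lvert f(x)/E(x)\rvert$. When $\varphi'\in L^\infty$, $\mathcal{H}^p(E)\subset\mathcal{H}^\infty(E)$, and $C(p,E)$ denotes the norm of the embedding $\mathcal{H}^p(E)\to\mathcal{H}^\infty(E)$,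 i.e. the smallest constant with $\lVert f/E\rVert_\infty\le C(p,E)\lVert f/E\rVert_p$ for all $f\in\mathcal{H}^p(E)$. *)

(* Defs.v *)
(* MathComp + MathComp-Analysis, over Stdlib's concrete reals R
   (which is both a realType and an rcfType, so that the complex numbers
   R[i] of mathcomp-real-closed are available). *)
From Stdlib Require Import Rdefinitions.
From mathcomp Require Import all_boot all_order all_algebra.
From mathcomp Require Import all_classical all_reals all_analysis.
From mathcomp Require Import complex Rstruct Rstruct_topology ess_sup_inf.
Import Order.TTheory GRing.Theory Num.Theory.
Import numFieldNormedType.Exports.

Set Implicit Arguments.
Unset Strict Implicit.
Unset Printing Implicit Defensive.

Local Open Scope classical_set_scope.
Local Open Scope ring_scope.
Local Open Scope complex_scope.

(* complex numbers over the (Stdlib) reals *)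
Notation CC := (R[i]).

(* complex (holomorphic) differentiability of f : C -> C at z:
   C viewed as a normed module over itself *)
Definition cdiff (f : CC -> CC) (z : CC) : Prop :=
  derivable (f : CC^o -> CC^o) z 1.

Definition entire (f : CC -> CC) : Prop := forall z, cdiff f z.

(* modulus |z| as a real number (the norm of R[i] is real-valued
   but lives in R[i]; we take its real part) *)
Definition cabs (z : CC) : R := complex.Re `|z|.

(* the open upper half-plane C_+ *)
Definition upper (z : CC) : Prop := 0 < complex.Im z.

Definition holo_upper (F : CC -> CC) : Prop := forall z, upper z -> cdiff F z.

(* f^#(z) = conj (f (conj z)) *)
Definition sharp (f : CC -> CC) : CC -> CC := fun z => (f (z^*)%C)^*%C.

(* Hermite-Biehler entire function *)
Definition hermite_biehler (E : CC -> CC) : Prop :=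
  entire E /\ forall z, upper z -> `|E (z^*)%C| < `|E z|.

(* Hardy space H^p(C_+), 0 < p < oo:
   holomorphic on C_+ with sup_{y>0} \int_R |F(x+iy)|^p dx < oo *)
Definition hardy (p : R) (F : CC -> CC) : Prop :=
  holo_upper F /\
  exists M : R, forall y : R, 0 < y ->
    (\int[@lebesgue_measure R]_x ((cabs (F (x +i* y)%C)) `^ p)%:E
       <= M%:E)%E.

(* H^oo(C_+): bounded holomorphic functions on C_+ *)
Definition hardy_inf (F : CC -> CC) : Prop :=
  holo_upper F /\ exists M : R, forall z, upper z -> cabs (F z) <= M.

Definition cdivf (f g : CC -> CC) : CC -> CC := fun z => f z / g z.

(* the de Branges-type space H^p(E) *)
Definition HpE (p : R) (E f : CC -> CC) : Prop :=
  entire f /\ hardy p (cdivf f E) /\ hardy p (cdivf (sharp f) E).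

(* ||f/E||_p on the real line *)
Definition normp (p : R) (E f : CC -> CC) : \bar R :=
  ((\int[@lebesgue_measure R]_x ((cabs (f x%:C / E x%:C)) `^ p)%:E)
     `^ (p^-1))%E.

(* ||f/E||_oo = sup_{x in R} |f(x)/E(x)| *)
Definition norminf (E f : CC -> CC) : \bar R :=
  ereal_sup [set (cabs (f x%:C / E x%:C))%:E | x in [set: R]].

(* C(p,E): the smallest constant K with ||f/E||_oo <= K ||f/E||_p
   for all f in H^p(E)  (norm of the embedding H^p(E) -> H^oo(E)) *)
Definition Cpe (p : R) (E : CC -> CC) : \bar R :=
  ereal_inf [set K : \bar R | (0 <= K)%E /\
    forall f, HpE p E f -> (norminf E f <= K * normp p E f)%E].

(* e^{it} *)
Definition expi (t : R) : CC := (cos t +i* sin t)%C.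

(* phi is a phase function of E: a differentiable real function with
   Theta_E(x) = E^#(x)/E(x) = e^{i phi(x)} on R *)
Definition phase_function (E : CC -> CC) (phi : R -> R) : Prop :=
  (forall x : R, derivable (phi : R^o -> R^o) x 1) /\
  forall x : R, sharp E x%:C / E x%:C = expi (phi x).

(* ||phi'||_oo : essential supremum (w.r.t. Lebesgue measure) of |phi'| *)
Definition Linf_norm (g : R -> R) : \bar R :=
  ess_sup (@lebesgue_measure R) (fun x => (`|g x|)%:E).

(* Main.v *)
(** Let Theta = E^#/E and let tau be the supremum of phi'. Phragmen-Lindelof applied to
    difference quotients gives |Theta'| <= tau in the upper half-plane, so |Theta(x+iy)| >=
    1 - tau y and E has no zeros in a strip below the real line. There f/E is controlled by
    f^#/E, and the Hardy bounds on horizontal lines make f/E bounded.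

    After rotation, H = (f/E + f^#/E)/(2T), with T > sup |f/E|, equals u e^(i phi/2) on the
    real line for a real function |u| < 1. The sums of n-th powers of the roots of
    X^2 - 2 H X + Theta are holomorphic, bounded, and at most 2 on the real line, hence at
    most 2 in the upper half-plane. So both roots lie in the unit disk, and the boundary form
    of this fact is the Duffin-Schaeffer inequality 4 u'^2 + u^2 phi'^2 <= phi'^2. It makes
    acos u tau/2-Lipschitz, whence |f/E| >= T cos(w + tau |x - x0| / 2) near a point x0 with
    |f(x0)/E(x0)| = T cos w. Integrating p-th powers with w -> 0 and using the Wallis bound
    for the integral of cos^n over [0, pi/2], n - 1 <= p <= n, gives the theorem with
    R(p) = 1/sqrt p, because sqrt (p + 2) <= sqrt p + 1/sqrt p.

    All the complex analysis rests on the maximum modulus principle, which is proved from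
    Goursat's lemma. *)

Require Import Defs.
From Stdlib Require Import Rdefinitions.
From mathcomp Require Import all_boot all_order all_algebra.
From mathcomp Require Import all_classical all_reals all_analysis.
From mathcomp Require Import complex Rstruct Rstruct_topology ess_sup_inf.
From mathcomp Require Import measurable_realfun ring lra.
Import Order.TTheory GRing.Theory Num.Theory.
Import numFieldNormedType.Exports.
Local Open Scope classical_set_scope.
Local Open Scope ring_scope.
Local Open Scope complex_scope.

Set Implicit Arguments.
Unset Strict Implicit.
Unset Printing Implicit Defensive.
(* Arguments of type R would otherwise be parsed in Stdlib's [R_scope]. *)
Bind Scope ring_scope with R.

(** * Complex differentiability *)

(** The roots of X^2 - 2 H X + Theta need not be holomorphic where the discriminant vanishes; their
    power sums are polynomials in H and Theta, so the maximum principle applies to these. T exceeds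
    sup |f/E| strictly because the supremum may not be attained and acos is differentiable only
    inside (-1, 1); the price is a starting angle w > 0, which has to be removed in the limit. The
    Hardy bounds concern lines above the real axis only, while a local estimate at real points needs
    neighbourhoods crossing it: hence the strip below the axis and the factor 2 lost there.

    The constant arises as follows. With W_n the integral of cos^n over [0, pi/2], the cosine
    minorant has p-th power integral at least T^p (4/tau) W_n in the limit. Since W_n^2 >= pi / (2
    (n + 1)) and n <= p + 1, the quotient tau / (4 W_n) is at most tau sqrt (p + 2) / (2 sqrt (2
    pi)). *)

Lemma ltr0c (x : R) : (0 < x%:C :> CC) = (0 < x).
Proof. exact: ltcR. Qed.

Lemma cabsE (z : CC) : cabs z = Num.sqrt (complex.Re z ^+ 2 + complex.Im z ^+ 2).
Proof. by case: z. Qed.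

Lemma normC_cabs (z : CC) : `|z| = (cabs z)%:C.
Proof. by rewrite /cabs normc_def. Qed.

Lemma cabs_ge0 (z : CC) : 0 <= cabs z.
Proof. by rewrite cabsE sqrtr_ge0. Qed.

Lemma cabsM (z w : CC) : cabs (z * w) = cabs z * cabs w.
Proof.
have := normrM z w; rewrite !normC_cabs -rmorphM /=.
by move/complexI.
Qed.

Lemma cabs0 : cabs 0 = 0. Proof. by rewrite /cabs normr0. Qed.
Lemma cabs1 : cabs 1 = 1. Proof. by rewrite /cabs normr1. Qed.

Lemma cabsV (z : CC) : cabs z^-1 = (cabs z)^-1.
Proof. by have := normfV z; rewrite !normC_cabs -fmorphV => /complexI. Qed.

Lemma cabsX (z : CC) n : cabs (z ^+ n) = cabs z ^+ n.
Proof. by elim: n => [|n IH]; rewrite ?expr0 ?cabs1// !exprS cabsM IH. Qed.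

Lemma cabsN (z : CC) : cabs (- z) = cabs z.
Proof. by rewrite /cabs normrN. Qed.

Lemma cabsB (z w : CC) : cabs (z - w) = cabs (w - z).
Proof. by rewrite -cabsN opprB. Qed.

Lemma cabsD (z w : CC) : cabs (z + w) <= cabs z + cabs w.
Proof. by have := ler_normD z w; rewrite !normC_cabs -rmorphD lecR. Qed.

Lemma cabs_eq0 (z : CC) : (cabs z == 0) = (z == 0).
Proof. by rewrite -(normr_eq0 z) normC_cabs fmorph_eq0. Qed.

Lemma cabs_gt0 (z : CC) : (0 < cabs z) = (z != 0).
Proof. by rewrite lt_neqAle cabs_ge0 andbT eq_sym cabs_eq0. Qed.

Lemma cabsJ (z : CC) : cabs (z^*)%C = cabs z.
Proof. by rewrite /cabs normcJ. Qed.

Lemma conjB (a b : CC) : (a - b)^*%C = (a^*)%C - (b^*)%C.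
Proof. exact: rmorphB. Qed.

Lemma conjD (a b : CC) : (a + b)^*%C = (a^*)%C + (b^*)%C.
Proof. exact: rmorphD. Qed.

Lemma conjM (a b : CC) : (a * b)^*%C = (a^*)%C * (b^*)%C.
Proof. exact: rmorphM. Qed.

Lemma cabs_real (x : R) : cabs x%:C = `|x|.
Proof. by rewrite cabsE /= expr0n addr0 sqrtr_sqr. Qed.

Lemma Re_add (z w : CC) : complex.Re (z + w) = complex.Re z + complex.Re w.
Proof. by case: z w => [a b] [c d]. Qed.
Lemma Im_add (z w : CC) : complex.Im (z + w) = complex.Im z + complex.Im w.
Proof. by case: z w => [a b] [c d]. Qed.
Lemma Re_opp (z : CC) : complex.Re (- z) = - complex.Re z.
Proof. by case: z. Qed.
Lemma Im_opp (z : CC) : complex.Im (- z) = - complex.Im z.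
Proof. by case: z. Qed.
Lemma Re_mul (z w : CC) : complex.Re (z * w) =
  complex.Re z * complex.Re w - complex.Im z * complex.Im w.
Proof. by case: z w => [a b] [c d]. Qed.
Lemma Im_mul (z w : CC) : complex.Im (z * w) =
  complex.Re z * complex.Im w + complex.Im z * complex.Re w.
Proof. by case: z w => [a b] [c d]. Qed.
Lemma Re_inv (z : CC) : complex.Re z^-1 =
  complex.Re z / (complex.Re z ^+ 2 + complex.Im z ^+ 2).
Proof. by case: z. Qed.
Lemma Im_inv (z : CC) : complex.Im z^-1 =
  - (complex.Im z / (complex.Re z ^+ 2 + complex.Im z ^+ 2)).
Proof. by case: z => [a b]; rewrite /=. Qed.
Definition ReImE := (Re_add, Im_add, Re_opp, Im_opp, Re_mul, Im_mul).

Lemma complexEP (z w : CC) :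
  complex.Re z = complex.Re w -> complex.Im z = complex.Im w -> z = w.
Proof. by case: z w => [a b] [c d] /= -> ->. Qed.

Lemma sqr_cabs (z : CC) : cabs z ^+ 2 = complex.Re z ^+ 2 + complex.Im z ^+ 2.
Proof. by rewrite cabsE sqr_sqrtr// addr_ge0 ?sqr_ge0. Qed.

Lemma cabs_ge_Re (z : CC) : `|complex.Re z| <= cabs z.
Proof. by rewrite cabsE -sqrtr_sqr ler_wsqrtr// lerDl sqr_ge0. Qed.

Lemma cabs_ge_Im (z : CC) : `|complex.Im z| <= cabs z.
Proof. by rewrite cabsE -sqrtr_sqr ler_wsqrtr// lerDr sqr_ge0. Qed.

Lemma cabs_le_ReIm (z : CC) : cabs z <= `|complex.Re z| + `|complex.Im z|.
Proof.
have h : 0 <= `|complex.Re z| + `|complex.Im z| by rewrite addr_ge0.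
rewrite -(@ler_pXn2r _ 2)// ?nnegrE ?cabs_ge0// sqr_cabs sqrrD.
rewrite !real_normK ?num_real//.
by rewrite -addrA lerD2l lerDr mulrn_wge0// mulr_ge0.
Qed.

(* Restates [is_derive] with real epsilons, see [is_derive_hasder]: the norm of the
   library's topology on [CC] takes values in [CC]. *)
Definition hasder (f : CC -> CC) (z l : CC) := forall e : R, 0 < e ->
  exists2 d : R, 0 < d & forall w, cabs (w - z) < d ->
    cabs (f w - f z - l * (w - z)) <= e * cabs (w - z).

Lemma is_derive_hasder (f : CC -> CC) (z l : CC) :
  is_derive (z : CC^o) 1 (f : CC^o -> CC^o) l <-> hasder f z l.
Proof.
split=> [[df dl] e e0|H].
- have := df; rewrite /derivable => /cvg_ex[/= l' cl'].
  have ll' : l' = l.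
    by rewrite -dl /derive; apply/esym; apply: cvg_lim cl'; exact: norm_hausdorff.
  have /cvgrPdist_le/(_ e%:C) := cl'; rewrite ltr0c => /(_ e0).
  rewrite near_withinE => /nbhs_ballP[d /= d0 Hd].
  have dE : d = (complex.Re d)%:C by apply/esym/RRe_real; exact: gtr0_real.
  exists (complex.Re d); first by rewrite -ltr0c -dE.
  move=> w wd; have [->|wz] := eqVneq w z.
    by rewrite !subrr mulr0 subrr cabs0 mulr0.
  have h0 : w - z != 0 by rewrite subr_eq0.
  have := Hd (w - z); rewrite /ball/= sub0r normrN normC_cabs dE ltcR => /(_ wd h0).
  rewrite ll' normC_cabs lecR /GRing.scale /= /shift /= mulr1 subrK => Hw.
  have -> : f w - f z - l * (w - z) = - ((l - (w - z)^-1 * (f w - f z)) * (w - z)).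
    by field.
  by rewrite cabsN cabsM ler_wpM2r ?cabs_ge0.
- have : (fun h : CC^o => h^-1 *: (((f : CC^o -> CC^o) \o shift (z : CC^o)) (h *: (1 : CC^o)) - f z)) @ 0^' --> (l : CC^o).
    apply/cvgrPdist_le => e e0.
    have eE : e = (complex.Re e)%:C by apply/esym/RRe_real; exact: gtr0_real.
    have [|d d0 Hd] := H (complex.Re e); first by rewrite -ltr0c -eE.
    rewrite near_withinE; apply/nbhs_ballP; exists d%:C => /=; first by rewrite ltr0c.
    move=> h; rewrite /ball/= sub0r normrN normC_cabs ltcR => hd h0.
    have := Hd (h + z); rewrite addrK => /(_ hd) Hw.
    rewrite /GRing.scale /= /shift /= mulr1 normC_cabs eE lecR.
    have -> : l - h^-1 * (f (h + z) - f z) = - ((f (h + z) - f z - l * h) / h).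
      by field.
    by rewrite cabsN cabsM cabsV ler_pdivrMr ?cabs_gt0.
  move=> cl; split; first by apply/cvg_ex; exists l.
  by apply: cvg_lim cl; exact: norm_hausdorff.
Qed.

Lemma cdiffP (f : CC -> CC) (z : CC) : cdiff f z <-> exists l, hasder f z l.
Proof.
split=> [df|[l /is_derive_hasder[]//]].
by eexists; apply/is_derive_hasder; exact: derivableP.
Qed.

Lemma hasder_cdiff f z l : hasder f z l -> cdiff f z.
Proof. by move=> h; apply/cdiffP; exists l. Qed.

Lemma hasder_cst c z : hasder (fun=> c) z 0.
Proof. by apply/is_derive_hasder; exact: is_derive_cst. Qed.

Lemma hasder_id z : hasder id z 1.
Proof. by apply/is_derive_hasder; exact: is_derive_id. Qed.

Lemma hasderD f g z l m : hasder f z l -> hasder g z m ->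
  hasder (fun w => f w + g w) z (l + m).
Proof.
move=> /is_derive_hasder hf /is_derive_hasder hg.
by apply/is_derive_hasder; exact: is_deriveD.
Qed.

Lemma hasderB f g z l m : hasder f z l -> hasder g z m ->
  hasder (fun w => f w - g w) z (l - m).
Proof.
move=> /is_derive_hasder hf /is_derive_hasder hg.
by apply/is_derive_hasder; exact: is_deriveB.
Qed.

Lemma hasderM f g z l m : hasder f z l -> hasder g z m ->
  hasder (fun w => f w * g w) z (f z * m + g z * l).
Proof.
move=> /is_derive_hasder hf /is_derive_hasder hg.
by apply/is_derive_hasder; exact: is_deriveM.
Qed.

Lemma hasderV f z l : f z != 0 -> hasder f z l ->
  hasder (fun w => (f w)^-1) z (- (f z ^- 2) * l).
Proof.
move=> fz0 /is_derive_hasder hf; apply/is_derive_hasder.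
have df := @ex_derive _ _ _ _ _ _ _ hf.
apply: DeriveDef; first exact: derivableV.
by rewrite deriveV// derive_val.
Qed.

Lemma hasder_sharp f z l : hasder f (z^*)%C l -> hasder (sharp f) z (l^*)%C.
Proof.
move=> H e /H[d d0 Hd]; exists d => // w wd.
have wE : w - z = ((w^*)%C - (z^*)%C)^*%C by rewrite conjB !conjcK.
rewrite /sharp wE -conjM -(conjB (f _)) -(conjB (f _ - f _)) !cabsJ; apply: Hd.
by rewrite -conjB cabsJ.
Qed.

Lemma cdiff_cst c z : cdiff (fun=> c) z.
Proof. exact: hasder_cdiff (hasder_cst c z). Qed.

Lemma cdiff_id z : cdiff id z.
Proof. exact: hasder_cdiff (hasder_id z). Qed.

Lemma cdiffD f g z : cdiff f z -> cdiff g z -> cdiff (fun w => f w + g w) z.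
Proof.
by move=> /cdiffP[l hl] /cdiffP[m hm]; exact: hasder_cdiff (hasderD hl hm).
Qed.

Lemma cdiffB f g z : cdiff f z -> cdiff g z -> cdiff (fun w => f w - g w) z.
Proof.
by move=> /cdiffP[l hl] /cdiffP[m hm]; exact: hasder_cdiff (hasderB hl hm).
Qed.

Lemma cdiffM f g z : cdiff f z -> cdiff g z -> cdiff (fun w => f w * g w) z.
Proof.
by move=> /cdiffP[l hl] /cdiffP[m hm]; exact: hasder_cdiff (hasderM hl hm).
Qed.

Lemma cdiffV f z : f z != 0 -> cdiff f z -> cdiff (fun w => (f w)^-1) z.
Proof. by move=> f0 /cdiffP[l hl]; exact: hasder_cdiff (hasderV f0 hl). Qed.

Lemma cdiff_div f g z : g z != 0 -> cdiff f z -> cdiff g z ->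
  cdiff (fun w => f w / g w) z.
Proof. by move=> g0 df dg; exact: cdiffM df (cdiffV g0 dg). Qed.

Lemma cdiffX f n z : cdiff f z -> cdiff (fun w => f w ^+ n) z.
Proof.
move=> df; elim: n => [|n IH].
  by under eq_fun do rewrite expr0; exact: cdiff_cst.
by under eq_fun do rewrite exprS; exact: cdiffM.
Qed.

Lemma cdiff_sharp f z : cdiff f (z^*)%C -> cdiff (sharp f) z.
Proof. by move=> /cdiffP[l hl]; exact: hasder_cdiff (hasder_sharp hl). Qed.

Lemma hasder_shift f z c l : hasder f (z + c) l -> hasder (fun w => f (w + c)) z l.
Proof.
move=> H e /H[d d0 Hd]; exists d => // w wd.
by have := Hd (w + c); rewrite opprD addrACA subrr addr0; exact.
Qed.

Definition ccont (f : CC -> CC) z := forall e : R, 0 < e ->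
  exists2 d : R, 0 < d & forall w, cabs (w - z) < d -> cabs (f w - f z) <= e.

Lemma hasder_lip f z l : hasder f z l -> exists2 d : R, 0 < d &
  forall w, cabs (w - z) < d -> cabs (f w - f z) <= (cabs l + 1) * cabs (w - z).
Proof.
move=> /(_ _ ltr01)[d d0 Hd]; exists d => // w /Hd; rewrite mul1r => hw.
rewrite -(subrK (l * (w - z)) (f w - f z)) (le_trans (cabsD _ _))//.
by rewrite cabsM mulrDl mul1r addrC lerD2l.
Qed.

Lemma cdiff_ccont f z : cdiff f z -> ccont f z.
Proof.
move=> /cdiffP[l /hasder_lip[d d0 Hd]] e e0.
have l0 : 0 < cabs l + 1 by rewrite ltr_wpDl ?cabs_ge0.
exists (Num.min d (e / (cabs l + 1))); first by rewrite lt_min d0 divr_gt0.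
move=> w; rewrite lt_min => /andP[/Hd hw]; rewrite ltr_pdivlMr// => we.
by rewrite (le_trans hw)// mulrC ltW.
Qed.

Lemma ccont_neq0 f z : ccont f z -> f z != 0 ->
  exists2 d : R, 0 < d & forall w, cabs (w - z) < d -> f w != 0.
Proof.
move=> H f0; have [|d d0 Hd] := H (cabs (f z) / 2).
  by rewrite divr_gt0 ?cabs_gt0.
exists d => // w /Hd; apply: contraTneq => ->.
by rewrite sub0r cabsN -ltNge ltr_pdivrMr// ltr_pMr ?ltr1n ?cabs_gt0.
Qed.

(** * Continuity, integrals over segments and bisection on the real line *)

Section RealAnalysis.
Variable K : realType.
Implicit Types (g h : K -> K) (a b t : K).
Local Notation mu := (@lebesgue_measure K).

Definition econt g t := forall e : K, 0 < e -> exists2 d : K, 0 < d &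
  forall s, `|s - t| < d -> `|g s - g t| <= e.

Lemma econtP g t : econt g t <-> {for t, continuous g}.
Proof.
rewrite /prop_for /continuous_at; split=> [H|/(@cvgrPdist_le K) H e /H].
  apply/(@cvgrPdist_le K) => e /H[d d0 Hd].
  apply/nbhs_ballP; exists d => //= s; rewrite /ball/= => hs.
  by rewrite distrC Hd// distrC.
move/nbhs_ballP => [d /= d0 Hd]; exists d => // s hs.
by rewrite distrC Hd//= /ball/= distrC.
Qed.

Lemma econt_within g a b : (forall t, a <= t <= b -> econt g t) ->
  {within `[a, b], continuous g}.
Proof.
move=> H; apply: continuous_in_subspaceT => t.
by rewrite inE/= in_itv/= => /H/econtP.
Qed.

Definition itg g a b : K := \int[mu]_(t in `[a, b]) g t.

Lemma econt_integrable g a b : (forall t, a <= t <= b -> econt g t) ->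
  mu.-integrable `[a, b] (EFin \o g).
Proof.
move=> H; apply: continuous_compact_integrable; first exact: segment_compact.
exact: econt_within.
Qed.

Lemma itg_split g a m b : a <= m -> m <= b ->
  (forall t, a <= t <= b -> econt g t) ->
  itg g a b = itg g a m + itg g m b.
Proof.
move=> am mb H; rewrite /itg.
have := @Rintegral_itvB _ g (BLeft a) (BRight b) m (econt_integrable H).
rewrite !bnd_simp => /(_ am mb) E.
rewrite -[LHS](subrK (\int[mu]_(t in `[a, m]) g t)) E addrC; congr (_ + _).
apply: Rintegral_itv_obnd_cbnd.
apply: integrableS (econt_integrable H) => //.
by move=> t /=; rewrite !in_itv/= => /andP[/ltW mt ->]; rewrite (le_trans am).
Qed.

Lemma itgB g h a b : (forall t, a <= t <= b -> econt g t) ->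
  (forall t, a <= t <= b -> econt h t) ->
  itg (fun t => g t - h t) a b = itg g a b - itg h a b.
Proof.
by move=> H1 H2; rewrite /itg RintegralB//; exact: econt_integrable.
Qed.

Lemma econt_cst k t : econt (fun=> k) t.
Proof. by move=> e e0; exists 1 => // s _; rewrite subrr normr0 ltW. Qed.

Lemma itg_cst k a b : a <= b -> itg (fun=> k) a b = k * (b - a).
Proof.
move=> ab; rewrite /itg Rintegral_cst//= lebesgue_measure_itv/= lte_fin.
by case: ltP => [//|ba]; rewrite (@le_anti _ _ a b) ?ab// subrr.
Qed.

Lemma itg_le g h a b : (forall t, a <= t <= b -> econt g t) ->
  (forall t, a <= t <= b -> econt h t) ->
  (forall t, a <= t <= b -> g t <= h t) -> itg g a b <= itg h a b.
Proof.
move=> H1 H2 gh; apply: le_Rintegral => //; exact: econt_integrable.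
Qed.

Lemma itg_near g a b k e : a <= b -> (forall t, a <= t <= b -> econt g t) ->
  (forall t, a <= t <= b -> `|g t - k| <= e) ->
  `|itg g a b - k * (b - a)| <= e * (b - a).
Proof.
move=> ab H ge.
have h t : a <= t <= b -> k - e <= g t <= k + e.
  by move=> /ge; rewrite ler_distl.
rewrite ler_distl; apply/andP; split.
  rewrite -mulrBl -itg_cst//; apply: itg_le => // [*|t /h/andP[]//].
  exact: econt_cst.
rewrite -mulrDl -itg_cst//; apply: itg_le => // [*|t /h/andP[]//].
exact: econt_cst.
Qed.

(** [P n x y] speaks of the box with lower left corner [(x, y)] and sides [w / 2 ^+ n] and
    [h / 2 ^+ n]. In each coordinate the lower ends increase and stay below all upper ends, so the
    supremum of the lower ends lies in every box. *)
Lemma bisection (P : nat -> K -> K -> Prop) (w h a c : K) : 0 <= w -> 0 <= h ->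
  P 0%N a c ->
  (forall n x y, P n x y -> exists x' y',
    [/\ P n.+1 x' y', x <= x', x' + w / 2 ^+ n.+1 <= x + w / 2 ^+ n,
        y <= y' & y' + h / 2 ^+ n.+1 <= y + h / 2 ^+ n]) ->
  exists x0 y0, forall n, exists x y, [/\ P n x y,
    a <= x <= x0, x0 <= x + w / 2 ^+ n <= a + w,
    c <= y <= y0 & y0 <= y + h / 2 ^+ n <= c + h].
Proof.
move=> w0 h0 P0 step.
(* Where [P] fails the box is left as it is, so that [u] can be defined by plain recursion before
   [P] is known along it. *)
have step' (n : nat) (p : K * K) : {q : K * K | P n p.1 p.2 ->
    [/\ P n.+1 q.1 q.2, p.1 <= q.1, q.1 + w / 2 ^+ n.+1 <= p.1 + w / 2 ^+ n,
        p.2 <= q.2 & q.2 + h / 2 ^+ n.+1 <= p.2 + h / 2 ^+ n]}.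
  apply: cid; have [/step[x' [y' H]]|H] := pselect (P n p.1 p.2).
    by exists (x', y').
  by exists p.
pose u := fix u n := if n is m.+1 then projT1 (step' m (u m)) else (a, c).
have uP n : P n (u n).1 (u n).2.
  by elim: n => //= n IH; case: (projT2 (step' n (u n)) IH).
have uS n := projT2 (step' n (u n)) (uP n).
have mono (v : nat -> K) (l lo : K) : v 0%N = lo -> 0 <= l ->
    (forall n, v n <= v n.+1) ->
    (forall n, v n.+1 + l / 2 ^+ n.+1 <= v n + l / 2 ^+ n) ->
    exists x0, forall n, lo <= v n <= x0 /\ x0 <= v n + l / 2 ^+ n <= lo + l.
  move=> v0 l0 inc dec.
  have incm n m : v n <= v (n + m)%N.
    by elim: m => [|m IH]; rewrite ?addn0// addnS (le_trans IH).
  have decm n m : v (n + m)%N + l / 2 ^+ (n + m) <= v n + l / 2 ^+ n.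
    by elim: m => [|m IH]; rewrite ?addn0// addnS (le_trans _ IH).
  have bd n m : v n <= v m + l / 2 ^+ m.
    have [nm|/ltnW mn] := leqP n m.
      rewrite -(subnKC nm) (le_trans (incm n (m - n)%N))// lerDl.
      by rewrite divr_ge0// exprn_ge0.
    rewrite -(subnKC mn) (le_trans _ (decm m (n - m)%N))// lerDl.
    by rewrite divr_ge0// exprn_ge0.
  have supv : has_sup (range v).
    split; first by exists (v 0%N); exists 0%N.
    by exists (v 0%N + l / 2 ^+ 0); move=> _ [n _ <-].
  exists (sup (range v)) => n; split; apply/andP; split.
  - by rewrite -v0; have := incm 0%N n; rewrite add0n.
  - by apply: sup_upper_bound => //; exists n.
  - by apply: ge_sup; [exact: supv.1|move=> _ [m _ <-]].
  - by have := decm 0%N n; rewrite add0n v0 expr0 divr1.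
have [x0 Hx] := mono (fun n => (u n).1) w a erefl w0
  (fun n => let: And5 _ A _ _ _ := uS n in A)
  (fun n => let: And5 _ _ A _ _ := uS n in A).
have [y0 Hy] := mono (fun n => (u n).2) h c erefl h0
  (fun n => let: And5 _ _ _ A _ := uS n in A)
  (fun n => let: And5 _ _ _ _ A := uS n in A).
exists x0, y0 => n; exists (u n).1, (u n).2.
by have [? ?] := Hx n; have [? ?] := Hy n.
Qed.

End RealAnalysis.

Lemma ccont_line (f : CC -> CC) (a b : CC) (t : R) : ccont f (a + t%:C * b) ->
  forall e : R, 0 < e -> exists2 d : R, 0 < d & forall s : R, `|s - t| < d ->
    cabs (f (a + s%:C * b) - f (a + t%:C * b)) <= e.
Proof.
move=> H e /H[d d0 Hd]; exists (d / (cabs b + 1)).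
  by rewrite divr_gt0// ltr_wpDl ?cabs_ge0.
move=> s; rewrite ltr_pdivlMr ?ltr_wpDl ?cabs_ge0// => hs; apply: Hd.
rewrite opprD addrACA subrr add0r -mulrBl -rmorphB cabsM cabs_real.
by apply: le_lt_trans hs; rewrite ler_wpM2l// lerDl.
Qed.

Lemma econt_Re (f : R -> CC) (t : R) :
  (forall e : R, 0 < e -> exists2 d : R, 0 < d & forall s : R, `|s - t| < d ->
    cabs (f s - f t) <= e) -> econt (fun s => complex.Re (f s)) t.
Proof.
move=> H e /H[d d0 Hd]; exists d => // s /Hd.
by apply: le_trans; rewrite -Re_opp -Re_add cabs_ge_Re.
Qed.

Lemma econt_Im (f : R -> CC) (t : R) :
  (forall e : R, 0 < e -> exists2 d : R, 0 < d & forall s : R, `|s - t| < d ->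
    cabs (f s - f t) <= e) -> econt (fun s => complex.Im (f s)) t.
Proof.
move=> H e /H[d d0 Hd]; exists d => // s /Hd.
by apply: le_trans; rewrite -Im_opp -Im_add cabs_ge_Im.
Qed.

Lemma cabs_distB (z w : CC) : `|cabs z - cabs w| <= cabs (z - w).
Proof.
rewrite ler_norml; apply/andP; split.
  by rewrite lerNl opprB lerBlDr cabsB (le_trans _ (cabsD _ _))// subrK.
by rewrite lerBlDr (le_trans _ (cabsD _ _))// subrK.
Qed.

Lemma econt_cabs (f : R -> CC) (t : R) :
  (forall e : R, 0 < e -> exists2 d : R, 0 < d & forall s : R, `|s - t| < d ->
    cabs (f s - f t) <= e) -> econt (fun s => cabs (f s)) t.
Proof.
move=> H e /H[d d0 Hd]; exists d => // s /Hd.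
by apply: le_trans; rewrite cabs_distB.
Qed.

(** * Goursat's lemma and the maximum principle *)

Definition citg (g : R -> CC) (a b : R) : CC :=
  itg (fun t => complex.Re (g t)) a b +i* itg (fun t => complex.Im (g t)) a b.

Definition econtc (g : R -> CC) (t : R) :=
  econt (fun s => complex.Re (g s)) t /\ econt (fun s => complex.Im (g s)) t.

Lemma citg_split g a m b : a <= m -> m <= b ->
  (forall t, a <= t <= b -> econtc g t) -> citg g a b = citg g a m + citg g m b.
Proof.
move=> am mb H; rewrite /citg (itg_split am mb) => [|t /H[]//].
by rewrite (itg_split am mb) => [//|t /H[]//].
Qed.

Lemma citgB g h a b : (forall t, a <= t <= b -> econtc g t) ->
  (forall t, a <= t <= b -> econtc h t) ->
  citg (fun t => g t - h t) a b = citg g a b - citg h a b.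
Proof.
move=> H1 H2; apply: complexEP; rewrite ?Re_add ?Re_opp ?Im_add ?Im_opp /=.
  rewrite -itgB => [|t /H1[]//|t /H2[]//].
  by congr itg; apply/funext => t; rewrite Re_add Re_opp.
rewrite -itgB => [|t /H1[]//|t /H2[]//].
by congr itg; apply/funext => t; rewrite Im_add Im_opp.
Qed.

(** The factor 2 comes from estimating the real and imaginary parts separately. *)
Lemma citg_near g a b (k : CC) (e : R) : a <= b ->
  (forall t, a <= t <= b -> econtc g t) ->
  (forall t, a <= t <= b -> cabs (g t - k) <= e) ->
  cabs (citg g a b - k * (b - a)%:C) <= 2 * e * (b - a).
Proof.
move=> ab H ge; rewrite (le_trans (cabs_le_ReIm _))//.
rewrite -mulrA mulr2n mulrDl !mul1r lerD//.
  rewrite Re_add Re_opp Re_mul /= mulr0 subr0; apply: itg_near => // t /[dup] /H[]// _ _.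
  by move=> /ge; apply: le_trans; rewrite -Re_opp -Re_add cabs_ge_Re.
rewrite Im_add Im_opp Im_mul /= mulr0 add0r; apply: itg_near => // t /[dup] /H[]// _ _.
by move=> /ge; apply: le_trans; rewrite -Im_opp -Im_add cabs_ge_Im.
Qed.

Lemma econtcB g h t : econtc g t -> econtc h t -> econtc (fun s => g s - h s) t.
Proof.
have K (p q : R -> R) : econt p t -> econt q t -> econt (fun s => p s - q s) t.
  by move=> /econtP hp /econtP hq; apply/econtP; exact: cvgB hp hq.
move=> [g1 g2] [h1 h2]; split.
  by have := K _ _ g1 h1; under [X in _ -> econt X _]eq_fun do rewrite Re_add Re_opp.
by have := K _ _ g2 h2; under [X in _ -> econt X _]eq_fun do rewrite Im_add Im_opp.
Qed.

Lemma ccont_hline f x y : ccont f (x +i* y) -> econtc (fun t => f (t +i* y)) x.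
Proof.
move=> H.
have E t : (t +i* y) = (0 +i* y) + t%:C * 1 :> CC.
  by apply: complexEP; rewrite !ReImE /=; ring.
have := @ccont_line f (0 +i* y) 1 x; rewrite -E => /(_ H) K.
have {}K : forall e : R, 0 < e -> exists2 d : R, 0 < d & forall s : R, `|s - x| < d ->
    cabs (f (s +i* y) - f (x +i* y)) <= e.
  by move=> e /K[d d0 Hd]; exists d => // s /Hd; rewrite -E.
by split; [exact: econt_Re|exact: econt_Im].
Qed.

Lemma ccont_vline f x y : ccont f (x +i* y) -> econtc (fun t => f (x +i* t)) y.
Proof.
move=> H.
have E t : (x +i* t) = (x +i* 0) + t%:C * 'i%C :> CC.
  by apply: complexEP; rewrite !ReImE /=; ring.
have := @ccont_line f (x +i* 0) 'i%C y; rewrite -E => /(_ H) K.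
have {}K : forall e : R, 0 < e -> exists2 d : R, 0 < d & forall s : R, `|s - y| < d ->
    cabs (f (x +i* s) - f (x +i* y)) <= e.
  by move=> e /K[d d0 Hd]; exists d => // s /Hd; rewrite -E.
by split; [exact: econt_Re|exact: econt_Im].
Qed.

(* Counterclockwise contour integral over the boundary of [a,b] x [c,d]; pairing opposite
   edges makes the contribution of affine functions cancel pointwise in [circ_near]. *)
Definition circ (f : CC -> CC) (a b c d : R) : CC :=
  citg (fun x => f (x +i* c) - f (x +i* d)) a b +
  'i%C * citg (fun y => f (b +i* y) - f (a +i* y)) c d.

Lemma circ_hsplit f a m b c d : a <= m -> m <= b -> c <= d ->
  (forall x, a <= x <= b -> ccont f (x +i* c) /\ ccont f (x +i* d)) ->
  (forall y, c <= y <= d ->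
    [/\ ccont f (a +i* y), ccont f (m +i* y) & ccont f (b +i* y)]) ->
  circ f a b c d = circ f a m c d + circ f m b c d.
Proof.
move=> am mb cd H V; rewrite /circ (citg_split am mb); last first.
  by move=> t /H[h1 h2]; apply: (econtcB (ccont_hline h1) (ccont_hline h2)).
set A := citg _ _ _; set B := citg _ _ _.
by rewrite !citgB => [|y /V[h1 h2 h3]|y /V[h1 h2 h3]|y /V[h1 h2 h3]|y /V[h1 h2 h3]
  |y /V[h1 h2 h3]|y /V[h1 h2 h3]]; try exact: ccont_vline; ring.
Qed.

Lemma circ_vsplit f a b c m d : a <= b -> c <= m -> m <= d ->
  (forall y, c <= y <= d -> ccont f (a +i* y) /\ ccont f (b +i* y)) ->
  (forall x, a <= x <= b ->
    [/\ ccont f (x +i* c), ccont f (x +i* m) & ccont f (x +i* d)]) ->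
  circ f a b c d = circ f a b c m + circ f a b m d.
Proof.
move=> ab cm md V H; rewrite /circ (citg_split cm md); last first.
  by move=> t /V[h1 h2]; apply: (econtcB (ccont_vline h2) (ccont_vline h1)).
set A := citg _ c m; set B := citg _ m d.
by rewrite !citgB => [|y /H[h1 h2 h3]|y /H[h1 h2 h3]|y /H[h1 h2 h3]|y /H[h1 h2 h3]
  |y /H[h1 h2 h3]|y /H[h1 h2 h3]]; try exact: ccont_hline; ring.
Qed.

(** An affine function has zero contour integral, so only the remainder of the expansion at [z0]
    contributes. One factor 2 comes from taking differences over opposite edges, the other from
    [citg_near]. *)
Lemma circ_near f a b c d (z0 l : CC) (e r : R) : a <= b -> c <= d -> 0 <= e ->
  (forall z, a <= complex.Re z <= b -> c <= complex.Im z <= d ->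
    [/\ ccont f z, cabs (z - z0) <= r &
        cabs (f z - f z0 - l * (z - z0)) <= e * cabs (z - z0)]) ->
  cabs (circ f a b c d) <= 4 * e * r * ((b - a) + (d - c)).
Proof.
move=> ab cd e0 H.
have aab : a <= a <= b by rewrite lexx.
have bab : a <= b <= b by rewrite lexx ab.
have ccd : c <= c <= d by rewrite lexx.
have dcd : c <= d <= d by rewrite lexx cd.
have D (z w : CC) : a <= complex.Re z <= b -> c <= complex.Im z <= d ->
    a <= complex.Re w <= b -> c <= complex.Im w <= d ->
    cabs (f z - f w - l * (z - w)) <= 2 * e * r.
  move=> z1 z2 w1 w2; have [_ zr hz] := H z z1 z2; have [_ wr hw] := H w w1 w2.
  have -> : f z - f w - l * (z - w) = (f z - f z0 - l * (z - z0)) -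
    (f w - f z0 - l * (w - z0)) by ring.
  rewrite (le_trans (cabsD _ _))// cabsN -mulrA mulr2n mulrDl !mul1r lerD//.
    by rewrite (le_trans hz)// ler_wpM2l.
  by rewrite (le_trans hw)// ler_wpM2l.
have C (z : CC) : a <= complex.Re z <= b -> c <= complex.Im z <= d -> ccont f z.
  by move=> z1 z2; case: (H z z1 z2).
have I1 : cabs (citg (fun x => f (x +i* c) - f (x +i* d)) a b -
    (l * (0 +i* (c - d))) * (b - a)%:C) <= 2 * (2 * e * r) * (b - a).
  apply: citg_near => // [t tab|t tab].
    by apply: econtcB; apply: ccont_hline; apply: C.
  have := D (t +i* c) (t +i* d) tab ccd tab dcd.
  by have -> : (t +i* c) - (t +i* d) = (0 +i* (c - d)) :> CC
    by apply: complexEP; rewrite !ReImE /=; ring.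
have I2 : cabs (citg (fun y => f (b +i* y) - f (a +i* y)) c d -
    (l * (b - a)%:C) * (d - c)%:C) <= 2 * (2 * e * r) * (d - c).
  apply: citg_near => // [t tcd|t tcd].
    by apply: econtcB; apply: ccont_vline; apply: C.
  have := D (b +i* t) (a +i* t) bab tcd aab tcd.
  by have -> : (b +i* t) - (a +i* t) = (b - a)%:C :> CC
    by apply: complexEP; rewrite !ReImE /=; ring.
(* The subtracted terms cancel: [(c - d) + (d - c) = 0] after the common factor ['i * l * (b - a)]
   is taken out. *)
have -> : circ f a b c d = (citg (fun x => f (x +i* c) - f (x +i* d)) a b -
    (l * (0 +i* (c - d))) * (b - a)%:C) + 'i%C *
    (citg (fun y => f (b +i* y) - f (a +i* y)) c d - (l * (b - a)%:C) * (d - c)%:C).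
  rewrite /circ mulrBr addrACA -[LHS]addr0; congr (_ + _).
  by apply: complexEP; rewrite !ReImE /=; ring.
rewrite (le_trans (cabsD _ _))// cabsM.
have -> : cabs 'i%C = 1 by rewrite cabsE /= expr0n add0r expr1n sqrtr1.
rewrite mul1r mulrDr lerD//.
  by rewrite (le_trans I1)// !mulrA -natrM.
by rewrite (le_trans I2)// !mulrA -natrM.
Qed.

(* Quadrisection, then first-order expansion at the limit point. *)
Lemma goursat f a b c d : a <= b -> c <= d ->
  (forall z, a <= complex.Re z <= b -> c <= complex.Im z <= d -> cdiff f z) ->
  circ f a b c d = 0.
Proof.
move=> ab cd H; apply/eqP; rewrite -cabs_eq0; apply/eqP.
set eta := cabs _.
have w0 : 0 <= b - a by rewrite subr_ge0.
have h0 : 0 <= d - c by rewrite subr_ge0.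
have half_le (l : R) n : 0 <= l -> l / 2 ^+ n.+1 + l / 2 ^+ n.+1 = l / 2 ^+ n.
  move=> _; rewrite exprS invfM; set q := 2 ^- n; lra.
have pos (l : R) n : 0 <= l -> 0 <= l / 2 ^+ n.
  by move=> l0; rewrite divr_ge0// exprn_ge0.
(* Invariant of the quadrisection: the n-th box keeps at least the fraction [4 ^- n] of the
   integral. *)
pose P n x y := [/\ a <= x, x + (b - a) / 2 ^+ n <= b, c <= y,
  y + (d - c) / 2 ^+ n <= d &
  eta / 4 ^+ n <= cabs (circ f x (x + (b - a) / 2 ^+ n) y (y + (d - c) / 2 ^+ n))].
have abE : a + (b - a) = b by rewrite addrC subrK.
have cdE : c + (d - c) = d by rewrite addrC subrK.
have P0 : P 0%N a c by rewrite /P !(expr0, divr1, abE, cdE) !lexx.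
have step n x y : P n x y -> exists x' y',
    [/\ P n.+1 x' y', x <= x', x' + (b - a) / 2 ^+ n.+1 <= x + (b - a) / 2 ^+ n,
        y <= y' & y' + (d - c) / 2 ^+ n.+1 <= y + (d - c) / 2 ^+ n].
  move=> [ax xb cy yd]; move: (pos _ n.+1 w0) (pos _ n.+1 h0) xb yd.
  rewrite /P -!(half_le _ n)// [4 ^+ n.+1]exprS invfM.
  set u := (b - a) / _; set v := (d - c) / _ => u0 v0.
  rewrite !addrA => xb yd.
  have C z : x <= complex.Re z <= x + u + u -> y <= complex.Im z <= y + v + v ->
      ccont f z.
    move=> /andP[z1 z2] /andP[z3 z4]; apply: cdiff_ccont; apply: H; apply/andP; split.
    - exact: le_trans z1.
    - exact: le_trans xb.
    - exact: le_trans z3.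
    - exact: le_trans yd.
  have xm : x <= x + u <= x + u + u by rewrite !lerDl u0.
  have ym : y <= y + v <= y + v + v by rewrite !lerDl v0.
  have xl : x <= x <= x + u + u by rewrite lexx -addrA lerDl addr_ge0.
  have yl : y <= y <= y + v + v by rewrite lexx -addrA lerDl addr_ge0.
  have xr : x <= x + u + u <= x + u + u by rewrite lexx -addrA lerDl addr_ge0.
  have yr : y <= y + v + v <= y + v + v by rewrite lexx -addrA lerDl addr_ge0.
  have [x1 x2] := andP xm; have [y1 y2] := andP ym.
  rewrite (@circ_hsplit f x (x + u)) ?(le_trans y1)//; first last.
  - by move=> t ht; split; apply: C.
  - by move=> t ht; split; apply: C.
  rewrite (@circ_vsplit f x (x + u) y (y + v))//; first last.
  - by move=> t /andP[ht1 ht2]; split; apply: C => //=; rewrite ht1 (le_trans ht2).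
  - by move=> t ht; split; apply: C.
  rewrite (@circ_vsplit f (x + u) (x + u + u) y (y + v))//; first last.
  - by move=> t /andP[ht1 ht2]; split; apply: C => //=; rewrite ht2 (le_trans x1).
  - by move=> t ht; split; apply: C.
  set q1 := circ _ _ _ _ _; set q2 := circ _ _ _ _ _.
  set q3 := circ _ _ _ _ _; set q4 := circ _ _ _ _ _ => hq.
  have Q4 : eta / 4 ^+ n <= cabs q1 + cabs q2 + (cabs q3 + cabs q4).
    by rewrite (le_trans hq)// (le_trans (cabsD _ _))// lerD// cabsD.
  have [h1|h1] := leP (eta * (4^-1 / 4 ^+ n)) (cabs q1).
    exists x, y; split => //.
    by split => //; [exact: le_trans xb|exact: le_trans yd].
  have [h2|h2] := leP (eta * (4^-1 / 4 ^+ n)) (cabs q2).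
    exists x, (y + v); split => //.
    by split => //; [exact: le_trans xb|exact: le_trans y1].
  have [h3|h3] := leP (eta * (4^-1 / 4 ^+ n)) (cabs q3).
    exists (x + u), y; split => //.
    by split => //; [exact: le_trans x1|exact: le_trans yd].
  exists (x + u), (y + v); split => //.
  split => //; [exact: le_trans x1|exact: le_trans y1|].
  have E : eta * (4^-1 / 4 ^+ n) = eta / 4 ^+ n / 4 by rewrite mulrCA mulrC.
  rewrite !E in h1 h2 h3 *; move: Q4 h1 h2 h3; clear.
  move: (eta / _) (cabs q1) (cabs q2) (cabs q3) (cabs q4) => A a1 a2 a3 a4.
  by move=> *; lra.
have [x0 [y0 Hn]] := bisection w0 h0 P0 step.
have zab : a <= x0 <= b.
  have [x [y [_ /andP[u1 u2] /andP[u3 u4] _ _]]] := Hn 0%N.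
  by rewrite (le_trans u1)// (le_trans u3)// (le_trans u4)// abE.
have zcd : c <= y0 <= d.
  have [x [y [_ _ _ /andP[u1 u2] /andP[u3 u4]]]] := Hn 0%N.
  by rewrite (le_trans u1)// (le_trans u3)// (le_trans u4)// cdE.
have /cdiffP[l Hl] := H (x0 +i* y0) zab zcd.
set s := (b - a) + (d - c).
have s0 : 0 <= s by rewrite addr_ge0.
(* Diameter and half-perimeter of the n-th box are both at most [s / 2 ^+ n]; their product absorbs
   the [4 ^+ n] lost by quadrisection. *)
have key (e : R) : 0 < e -> eta <= 4 * e * s ^+ 2.
  move=> e0; have [r r0 Hr] := Hl e e0.
  have [n hn] : exists n, s / 2 ^+ n < r.
    have [n hn] : exists n : nat, s / r < n%:R.
      by exists (Num.truncn (s / r)).+1; rewrite truncnS_gt// divr_ge0// ltW.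
    exists n; rewrite ltr_pdivrMr ?exprn_gt0// mulrC -ltr_pdivrMr//.
    by rewrite (lt_le_trans hn)// -natrX ler_nat ltnW// ltn_expl.
  have [x [y [[p1 p2 p3 p4 p5] /andP[u1 u2] /andP[u3 u4] /andP[v1 v2] /andP[v3 v4]]]] := Hn n.
  have := @circ_near f x (x + (b - a) / 2 ^+ n) y (y + (d - c) / 2 ^+ n)
    (x0 +i* y0) l e (s / 2 ^+ n).
  rewrite !lerDl !pos// => /(_ isT isT (ltW e0)) K.
  have {}K := le_trans p5 (K _).
  have : eta / 4 ^+ n <= 4 * e * s ^+ 2 / 4 ^+ n.
    apply: le_trans (K _) _; last first.
      rewrite !(addrC _ (_ / 2 ^+ n)) !addrK -mulrDl -/s.
      have -> : 4 ^+ n = 2 ^+ n * 2 ^+ n :> R by rewrite -exprMn -natrM.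
      rewrite invfM; set q := 2 ^- n.
      by have -> : 4 * e * (s * q) * (s * q) = 4 * e * s ^+ 2 * (q * q) by ring.
    move=> z z1 z2.
    have zr : cabs (z - (x0 +i* y0)) <= s / 2 ^+ n.
      rewrite (le_trans (cabs_le_ReIm _))// !ReImE /= mulrDl lerD//.
        move: z1 => /andP[z1 z3]; rewrite ler_distl; apply/andP.
        by move: u2 u3 z1 z3; clear; move=> *; split; lra.
      move: z2 => /andP[z2 z4]; rewrite ler_distl; apply/andP.
      by move: v2 v3 z2 z4; clear; move=> *; split; lra.
    split => //; last by apply: Hr; exact: le_lt_trans hn.
    move: z1 z2 => /andP[z1 z3] /andP[z2 z4].
    apply: cdiff_ccont; apply: H.
      by rewrite (le_trans p1)// (le_trans z3).
    by rewrite (le_trans p3)// (le_trans z4).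
  by rewrite ler_pM2r// invr_gt0 exprn_gt0.
apply/eqP; rewrite eq_le cabs_ge0 andbT leNgt; apply/negP => eta0.
(* The summand 1 keeps the denominator positive when the rectangle degenerates to a point and
   [s = 0]. *)
have := key (eta / (8 * (s ^+ 2 + 1))).
have q0 : 0 < s ^+ 2 + 1 by rewrite ltr_wpDl ?sqr_ge0.
rewrite divr_gt0// ?mulr_gt0// => /(_ isT).
have -> : 4 * (eta / (8 * (s ^+ 2 + 1))) * s ^+ 2 = eta / 2 * (s ^+ 2 / (s ^+ 2 + 1)).
  by field; rewrite gt_eqF.
apply/negP; rewrite -ltNge.
have : s ^+ 2 / (s ^+ 2 + 1) <= 1 by rewrite ler_pdivrMr// mul1r lerDl.
have e20 : 0 < eta / 2 by rewrite divr_gt0.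
move=> /(ler_wpM2l (ltW e20)); rewrite mulr1 => h; apply: le_lt_trans h _; lra.
Qed.

Lemma circ_bound f a b c d (m : R) : a <= b -> c <= d ->
  (forall x, a <= x <= b -> [/\ ccont f (x +i* c), ccont f (x +i* d),
     cabs (f (x +i* c)) <= m & cabs (f (x +i* d)) <= m]) ->
  (forall y, c <= y <= d -> [/\ ccont f (a +i* y), ccont f (b +i* y),
     cabs (f (a +i* y)) <= m & cabs (f (b +i* y)) <= m]) ->
  cabs (circ f a b c d) <= 4 * m * ((b - a) + (d - c)).
Proof.
move=> ab cd H V.
have I1 : cabs (citg (fun x => f (x +i* c) - f (x +i* d)) a b) <= 2 * (2 * m) * (b - a).
  rewrite -[citg _ _ _]subr0 -[0](mul0r (b - a)%:C); apply: citg_near => // t /H[h1 h2 h3 h4].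
    exact: (econtcB (ccont_hline h1) (ccont_hline h2)).
  by rewrite subr0 (le_trans (cabsD _ _))// cabsN mulr2n mulrDl mul1r lerD.
have I2 : cabs (citg (fun y => f (b +i* y) - f (a +i* y)) c d) <= 2 * (2 * m) * (d - c).
  rewrite -[citg _ _ _]subr0 -[0](mul0r (d - c)%:C); apply: citg_near => // t /V[h1 h2 h3 h4].
    exact: (econtcB (ccont_vline h2) (ccont_vline h1)).
  by rewrite subr0 (le_trans (cabsD _ _))// cabsN mulr2n mulrDl mul1r lerD.
rewrite /circ (le_trans (cabsD _ _))// cabsM.
have -> : cabs 'i%C = 1 by rewrite cabsE /= expr0n add0r expr1n sqrtr1.
rewrite mul1r mulrDr lerD//.
  by rewrite (le_trans I1)// !mulrA -natrM.
by rewrite (le_trans I2)// !mulrA -natrM.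
Qed.

Lemma circB f g a b c d :
  (forall x, a <= x <= b -> [/\ ccont f (x +i* c), ccont f (x +i* d),
     ccont g (x +i* c) & ccont g (x +i* d)]) ->
  (forall y, c <= y <= d -> [/\ ccont f (a +i* y), ccont f (b +i* y),
     ccont g (a +i* y) & ccont g (b +i* y)]) ->
  circ (fun z => f z - g z) a b c d = circ f a b c d - circ g a b c d.
Proof.
move=> H V; rewrite /circ opprD addrACA -mulrBr -!citgB; last first.
- by move=> t /H[h1 h2 h3 h4]; exact: (econtcB (ccont_hline h3) (ccont_hline h4)).
- by move=> t /H[h1 h2 h3 h4]; exact: (econtcB (ccont_hline h1) (ccont_hline h2)).
- by move=> t /V[h1 h2 h3 h4]; exact: (econtcB (ccont_vline h4) (ccont_vline h3)).
- by move=> t /V[h1 h2 h3 h4]; exact: (econtcB (ccont_vline h2) (ccont_vline h1)).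
congr (citg _ _ _ + 'i%C * citg _ _ _); apply/funext => t.
  set p := f _; set q := f _; set r := g _; set s := g _; ring.
set p := f _; set q := f _; set r := g _; set s := g _; ring.
Qed.

(* Cut out a square of side 2t around the singularity and let t tend to 0. *)
Lemma cauchy_punctured (g : CC -> CC) (x0 y0 a b c d B r : R) :
  a < x0 < b -> c < y0 < d -> 0 < r ->
  (forall z, a <= complex.Re z <= b -> c <= complex.Im z <= d ->
     z != x0 +i* y0 -> cdiff g z) ->
  (forall z, cabs (z - (x0 +i* y0)) <= r -> z != x0 +i* y0 -> cabs (g z) <= B) ->
  circ g a b c d = 0.
Proof.
move=> /andP[ax xb] /andP[cy yd] r0 H HB.
pose t0 := Num.min (Num.min (x0 - a) (b - x0)) (Num.min (Num.min (y0 - c) (d - y0)) (r / 2)).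
have t00 : 0 < t0 by rewrite !lt_min !subr_gt0 ax xb cy yd divr_gt0.
have key t : 0 < t -> t <= t0 -> cabs (circ g a b c d) <= 16 * B * t.
  move=> tp; rewrite !le_min => /andP[/andP[t1 t2] /andP[/andP[t3 t4] t5]].
  have nx x y : x != x0 -> (x +i* y) != (x0 +i* y0) :> CC.
    by apply: contra_neq => -[].
  have ny x y : y != y0 -> (x +i* y) != (x0 +i* y0) :> CC.
    by apply: contra_neq => -[].
  have Cx x y : a <= x <= b -> c <= y <= d -> x != x0 -> ccont g (x +i* y).
    by move=> hx hy h; apply: cdiff_ccont; apply: H => //; exact: nx.
  have Cy x y : a <= x <= b -> c <= y <= d -> y != y0 -> ccont g (x +i* y).
    by move=> hx hy h; apply: cdiff_ccont; apply: H => //; exact: ny.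
  have zl : x0 - t != x0 by rewrite lt_eqF// ltrBlDr ltrDl.
  have zr : x0 + t != x0 by rewrite gt_eqF// ltrDl.
  have wl : y0 - t != y0 by rewrite lt_eqF// ltrBlDr ltrDl.
  have wr : y0 + t != y0 by rewrite gt_eqF// ltrDl.
  have ne1 : a != x0 by rewrite lt_eqF.
  have ne2 : b != x0 by rewrite gt_eqF.
  have ne3 : c != y0 by rewrite lt_eqF.
  have ne4 : d != y0 by rewrite gt_eqF.
  have ab : a <= b by lra.
  have cd : c <= d by lra.
  (* Two vertical and then two horizontal cuts; [goursat] removes the four outer rectangles and
     leaves the small square around the singularity. *)
  have Eq : circ g a b c d = circ g (x0 - t) (x0 + t) (y0 - t) (y0 + t).
    have e1 : a <= x0 - t by lra.
    have e2 : x0 - t <= b by lra.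
    have e3 : x0 - t <= x0 + t by lra.
    have e4 : x0 + t <= b by lra.
    have e5 : c <= y0 - t by lra.
    have e6 : y0 - t <= d by lra.
    have e7 : y0 - t <= y0 + t by lra.
    have e8 : y0 + t <= d by lra.
    rewrite (circ_hsplit e1 e2 cd); first last.
    - by move=> y hy; split; apply: Cx => //; move: ax xb cy yd tp t1 t2 t3 t4 hy; clear; lra.
    - by move=> x hx; split; apply: Cy => //; move: ax xb cy yd tp t1 t2 t3 t4 hx; clear; lra.
    rewrite (circ_hsplit e3 e4 cd); first last.
    - by move=> y hy; split; apply: Cx => //; move: ax xb cy yd tp t1 t2 t3 t4 hy; clear; lra.
    - by move=> x hx; split; apply: Cy => //; move: ax xb cy yd tp t1 t2 t3 t4 hx; clear; lra.
    rewrite (circ_vsplit e3 e5 e6); first last.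
    - by move=> x hx; split; apply: Cy => //; move: ax xb cy yd tp t1 t2 t3 t4 hx; clear; lra.
    - by move=> y hy; split; apply: Cx => //; move: ax xb cy yd tp t1 t2 t3 t4 hy; clear; lra.
    rewrite (circ_vsplit e3 e7 e8); first last.
    - by move=> x hx; split; apply: Cy => //; move: ax xb cy yd tp t1 t2 t3 t4 hx; clear; lra.
    - by move=> y hy; split; apply: Cx => //; move: ax xb cy yd tp t1 t2 t3 t4 hy; clear; lra.
    rewrite (goursat e1 cd); last first.
      move=> [x y] /= hx hy; apply: H => //=; first by move: ax xb tp t1 t2 hx; clear; lra.
      by apply: nx; rewrite lt_eqF//; move: tp hx; clear; lra.
    rewrite (goursat e4 cd); last first.
      move=> [x y] /= hx hy; apply: H => //=; first by move: ax xb tp t1 t2 hx; clear; lra.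
      by apply: nx; rewrite gt_eqF//; move: tp hx; clear; lra.
    rewrite (goursat e3 e5); last first.
      move=> [x y] /= hx hy; apply: H => //=; [move: ax xb tp t1 t2 hx|move: cy yd tp t3 t4 hy|]; try by clear; lra.
      by apply: ny; rewrite lt_eqF//; move: tp hy; clear; lra.
    rewrite (goursat e3 e8); last first.
      move=> [x y] /= hx hy; apply: H => //=; [move: ax xb tp t1 t2 hx|move: cy yd tp t3 t4 hy|]; try by clear; lra.
      by apply: ny; rewrite gt_eqF//; move: tp hy; clear; lra.
    by rewrite !add0r !addr0.
  rewrite Eq.
  have near x y : x0 - t <= x <= x0 + t -> y0 - t <= y <= y0 + t ->
      cabs ((x +i* y) - (x0 +i* y0)) <= r.
    move=> hx hy; rewrite (le_trans (cabs_le_ReIm _))// !ReImE /=.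
    have : `|x - x0| <= t by rewrite ler_distl; lra.
    have : `|y - y0| <= t by rewrite ler_distl; lra.
    lra.
  apply: (@le_trans _ _ (4 * B * ((x0 + t - (x0 - t)) + (y0 + t - (y0 - t))))).
    apply: circ_bound; try (by move: tp; clear; lra).
      move=> x hx; split; try (by apply: Cy => //; move: ax xb cy yd tp t1 t2 t3 t4 hx; clear; lra).
        by apply: HB; [by apply: near; move: tp hx; clear; lra|exact: ny].
      by apply: HB; [by apply: near; move: tp hx; clear; lra|exact: ny].
    move=> y hy; split; try (by apply: Cx => //; move: ax xb cy yd tp t1 t2 t3 t4 hy; clear; lra).
      by apply: HB; [by apply: near; move: tp hy; clear; lra|exact: nx].
    by apply: HB; [by apply: near; move: tp hy; clear; lra|exact: nx].
  by rewrite le_eqVlt; apply/orP; left; apply/eqP; ring.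
have B0 : 0 <= B.
  apply: le_trans (cabs_ge0 (g ((x0 + r) +i* y0))) _; apply: HB.
    rewrite (le_trans (cabs_le_ReIm _))// !ReImE /= subrr normr0 addr0.
    by rewrite addrAC subrr add0r gtr0_norm.
  by apply: contra_neq (lt0r_neq0 r0) => -[] h; lra.
apply/eqP; rewrite -cabs_eq0 eq_le cabs_ge0 andbT leNgt; apply/negP => e0.
set e := cabs _ in e0 key.
have d0 : 0 < 16 * B + 1 by lra.
pose t := Num.min t0 (e / (16 * B + 1) / 2).
have t0' : 0 < t by rewrite lt_min t00 !divr_gt0.
have := key t t0'; rewrite ge_min lexx => /(_ isT).
apply/negP; rewrite -ltNge.
have te : (16 * B + 1) * t <= e / 2.
  have : t <= e / (16 * B + 1) / 2 by rewrite ge_min lexx orbT.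
  move=> /(ler_wpM2l (ltW d0)) h; apply: le_trans h _.
  by rewrite le_eqVlt; apply/orP; left; apply/eqP; field; rewrite gt_eqF.
by rewrite mulrDl mul1r in te; lra.
Qed.

Lemma cdiff_inv_sub (z0 z : CC) : z != z0 -> cdiff (fun w => (w - z0)^-1) z.
Proof.
move=> zz0; apply: cdiffV; first by rewrite subr_eq0.
by apply: cdiffB; [exact: cdiff_id|exact: cdiff_cst].
Qed.

(** No winding number is computed: the imaginary part of dz / (z - z0), the differential of the
    argument, is nonnegative along every edge, and the right edge alone contributes a positive
    amount. *)
Lemma circ_inv_neq0 (x0 y0 a b c d : R) : a < x0 < b -> c < y0 < d ->
  0 < cabs (circ (fun z => (z - (x0 +i* y0))^-1) a b c d).
Proof.
move=> /andP[ax xb] /andP[cy yd].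
have nx x y : x != x0 -> (x +i* y) != (x0 +i* y0) :> CC.
  by apply: contra_neq => -[].
have ny x y : y != y0 -> (x +i* y) != (x0 +i* y0) :> CC.
  by apply: contra_neq => -[].
have ab : a <= b by lra.
have cd : c <= d by lra.
set g := fun z : CC => _.
(* The squared diagonal, an upper bound for |z - z0|^2 on the rectangle. *)
pose D := (b - a) ^+ 2 + (d - c) ^+ 2.
have D0 : 0 < D by rewrite ltr_wpDr ?sqr_ge0// exprn_gt0//; lra.
suff : 0 < complex.Im (circ g a b c d).
  by move=> h; apply: lt_le_trans (cabs_ge_Im _); rewrite gtr0_norm.
rewrite /circ Im_add Im_mul /= mul0r add0r mul1r.
have sq (u v w : R) : - w <= u <= w -> u ^+ 2 <= w ^+ 2.
  move=> h; rewrite -real_normK ?num_real//; apply: lerXn2r; rewrite ?nnegrE ?ler_norml//; lra.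
have le1 (u v : R) : - (b - a) <= u <= b - a -> - (d - c) <= v <= d - c ->
    u ^+ 2 + v ^+ 2 <= D.
  by move=> hu hv; rewrite lerD// sq.
have gE x y : g (x +i* y) =
  ((x - x0) / ((x - x0) ^+ 2 + (y - y0) ^+ 2)) +i*
  ((y0 - y) / ((x - x0) ^+ 2 + (y - y0) ^+ 2)) :> CC.
  apply: complexEP; rewrite /g.
    by rewrite Re_inv !ReImE /=.
  by rewrite Im_inv !ReImE /= -mulNr opprB.
have Dpos (u v : R) : u != 0 \/ v != 0 -> 0 < u ^+ 2 + v ^+ 2.
  move=> [h|h]; first by rewrite ltr_pwDl ?sqr_ge0// exprn_even_gt0.
  by rewrite ltr_pwDr ?sqr_ge0// exprn_even_gt0.
apply: lt_le_trans (_ : 0 + (b - x0) / D * (d - c) <= _).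
  by rewrite add0r mulr_gt0 ?divr_gt0//; lra.
rewrite lerD//.
  rewrite -(mul0r (b - a)) -itg_cst//; apply: itg_le.
  - by move=> *; exact: econt_cst.
  - move=> x hx; have [] // := @econtcB (fun x => g (x +i* c)) (fun x => g (x +i* d)) x _ _.
    + by apply: ccont_hline; apply: cdiff_ccont; apply: cdiff_inv_sub; apply: ny; rewrite lt_eqF.
    + by apply: ccont_hline; apply: cdiff_ccont; apply: cdiff_inv_sub; apply: ny; rewrite gt_eqF.
  - move=> x hx; rewrite -[leRHS]/(complex.Im (g (x +i* c) - g (x +i* d))).
    rewrite Im_add Im_opp !gE /=.
    have p1 : 0 < (x - x0) ^+ 2 + (c - y0) ^+ 2.
      by apply: Dpos; right; rewrite subr_eq0 lt_eqF.
    have p2 : 0 < (x - x0) ^+ 2 + (d - y0) ^+ 2.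
      by apply: Dpos; right; rewrite subr_eq0 gt_eqF.
    rewrite addr_ge0//; first by rewrite divr_ge0 ?ltW//; lra.
    by rewrite oppr_ge0 mulr_le0_ge0// ?invr_ge0 ?(ltW p2)//; lra.
rewrite -itg_cst//; apply: itg_le.
- by move=> *; exact: econt_cst.
- move=> y hy; have [] // := @econtcB (fun y => g (b +i* y)) (fun y => g (a +i* y)) y _ _.
  + by apply: ccont_vline; apply: cdiff_ccont; apply: cdiff_inv_sub; apply: nx; rewrite gt_eqF.
  + by apply: ccont_vline; apply: cdiff_ccont; apply: cdiff_inv_sub; apply: nx; rewrite lt_eqF.
- move=> y hy; rewrite -[leRHS]/(complex.Re (g (b +i* y) - g (a +i* y))).
  rewrite Re_add Re_opp !gE /=.
  have p1 : 0 < (b - x0) ^+ 2 + (y - y0) ^+ 2.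
    by apply: Dpos; left; rewrite subr_eq0 gt_eqF.
  have p2 : 0 < (a - x0) ^+ 2 + (y - y0) ^+ 2.
    by apply: Dpos; left; rewrite subr_eq0 lt_eqF.
  rewrite -[leLHS]addr0 lerD//.
    rewrite ler_wpM2l ?lef_pV2// ?posrE//; first lra.
    by apply: le1; lra.
  by rewrite oppr_ge0 mulr_le0_ge0// ?invr_ge0 ?(ltW p2)//; lra.
Qed.

Lemma expr_small (q C e : R) : 0 <= q < 1 -> 0 < e -> exists n, C * q ^+ n < e.
Proof.
move=> /andP[q0 q1] e0; have [C0|C0] := leP C 0.
  by exists 0%N; rewrite expr0 mulr1 (le_lt_trans C0).
have [->|qn0] := eqVneq q 0; first by exists 1%N; rewrite expr1 mulr0.
have qp : 0 < q by rewrite lt_neqAle eq_sym qn0.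
pose h := q^-1 - 1.
have h0 : 0 < h by rewrite subr_gt0 invf_gt1.
have bern n : 1 + n%:R * h <= q^-1 ^+ n.
  elim: n => [|n IH]; first by rewrite mul0r addr0 expr0.
  rewrite exprSr -natr1 (le_trans _ (ler_wpM2r _ IH)) ?invr_ge0//.
  have -> : q^-1 = 1 + h by rewrite /h addrC subrK.
  have : 0 <= n%:R * h * h by rewrite !mulr_ge0// ltW.
  set k : R := n%:R; move: (h) => u; lra.
have [n hn] : exists n : nat, C / e / h < n%:R.
  by exists (Num.truncn (C / e / h)).+1; rewrite truncnS_gt// !divr_ge0// ltW.
exists n; have {}bern := bern n.
have : C / e < q^-1 ^+ n.
  rewrite ltr_pdivrMr// in hn; lra.
rewrite ltr_pdivrMr// exprVn mulrC ltr_pdivlMr ?exprn_gt0//.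
Qed.

(* Cauchy's formula bounds |f z0| by a constant times the boundary maximum; applying it
   to f^n and letting n grow removes the constant. *)
Lemma maximum_modulus f a b c d m : a <= b -> c <= d ->
  (forall z, a <= complex.Re z <= b -> c <= complex.Im z <= d -> cdiff f z) ->
  (forall x, a <= x <= b -> cabs (f (x +i* c)) <= m /\ cabs (f (x +i* d)) <= m) ->
  (forall y, c <= y <= d -> cabs (f (a +i* y)) <= m /\ cabs (f (b +i* y)) <= m) ->
  forall z, a <= complex.Re z <= b -> c <= complex.Im z <= d -> cabs (f z) <= m.
Proof.
move=> ab cd H Hh Hv [x0 y0] /= hx hy.
have [->|xa] := eqVneq x0 a; first by case: (Hv y0 hy).
have [->|xb] := eqVneq x0 b; first by case: (Hv y0 hy).
have [->|yc] := eqVneq y0 c; first by case: (Hh x0 hx).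
have [->|yd] := eqVneq y0 d; first by case: (Hh x0 hx).
have {}hx : a < x0 < b by rewrite !lt_neqAle eq_sym xa xb.
have {}hy : c < y0 < d by rewrite !lt_neqAle eq_sym yc yd.
set z0 := x0 +i* y0; rewrite leNgt; apply/negP => mf.
have m0 : 0 <= m.
  have cc : c <= c <= d by rewrite lexx.
  have [h _] := Hv c cc; exact: le_trans (cabs_ge0 _) h.
have f0 : 0 < cabs (f z0) by apply: le_lt_trans mf.
have fn0 : f z0 != 0 by rewrite -cabs_gt0.
pose q := m / cabs (f z0).
have q01 : 0 <= q < 1 by rewrite divr_ge0 ?(ltW f0)//= ltr_pdivrMr// mul1r.
pose rho := Num.min (Num.min (x0 - a) (b - x0)) (Num.min (y0 - c) (d - y0)).
have rho0 : 0 < rho.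
  by move: hx hy => /andP[? ?] /andP[? ?]; rewrite !lt_min !subr_gt0; apply/andP; split; apply/andP.
have k0 := circ_inv_neq0 hx hy.
set g := fun z : CC => _ in k0.
(* The contradiction: the contour integral of [g] is a positive constant, yet for every n it is at
   most this multiple of [q ^+ n]. *)
have [n] := expr_small (4 * rho^-1 * ((b - a) + (d - c))) q01 k0.
apply/negP; rewrite -leNgt.
pose F z := (f z / f z0) ^+ n.
have dF z : a <= complex.Re z <= b -> c <= complex.Im z <= d -> cdiff F z.
  by move=> z1 z2; apply: cdiffX; apply: cdiffM; [exact: H|exact: cdiff_cst].
have F0 : F z0 = 1 by rewrite /F divff// expr1n.
have dg z : z != z0 -> cdiff g z by exact: cdiff_inv_sub.
have bd x y : a <= x <= b -> c <= y <= d -> [|| x == a, x == b, y == c | y == d] ->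
    rho <= cabs ((x +i* y) - z0) /\ (x +i* y) != z0.
  move=> h1 h2 h3.
  have hr : rho <= cabs ((x +i* y) - z0).
    rewrite /rho; have [/orP[] /eqP hh|] := boolP ((x == a) || (x == b)).
    - rewrite (le_trans _ (cabs_ge_Re _))// !ReImE /= hh ltr0_norm; last by rewrite subr_lt0; case/andP: hx.
      by rewrite opprB !ge_min lexx.
    - rewrite (le_trans _ (cabs_ge_Re _))// !ReImE /= hh gtr0_norm; last by rewrite subr_gt0; case/andP: hx.
      by rewrite !ge_min lexx orbT.
    rewrite negb_or => /andP[/negbTE n1 /negbTE n2]; move: h3; rewrite n1 n2 /= => /orP[] /eqP hh.
    - rewrite (le_trans _ (cabs_ge_Im _))// !ReImE /= hh ltr0_norm; last by rewrite subr_lt0; case/andP: hy.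
      by rewrite opprB !ge_min lexx !orbT.
    - rewrite (le_trans _ (cabs_ge_Im _))// !ReImE /= hh gtr0_norm; last by rewrite subr_gt0; case/andP: hy.
      by rewrite !ge_min lexx !orbT.
  by split => //; rewrite -subr_eq0 -cabs_gt0 (lt_le_trans rho0).
have bF x y : a <= x <= b -> c <= y <= d -> cabs (f (x +i* y)) <= m ->
    [|| x == a, x == b, y == c | y == d] ->
    [/\ ccont (fun z => F z * g z) (x +i* y), ccont g (x +i* y) &
      cabs (F (x +i* y) * g (x +i* y)) <= q ^+ n * rho^-1].
  move=> h1 h2 h3 /(bd _ _ h1 h2)[hr hn]; split.
  - by apply: cdiff_ccont; apply: cdiffM; [exact: dF|exact: dg].
  - by apply: cdiff_ccont; exact: dg.
  rewrite cabsM cabsX cabsM !cabsV ler_pM ?exprn_ge0 ?mulr_ge0 ?invr_ge0 ?cabs_ge0//.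
    by rewrite lerXn2r ?nnegrE ?mulr_ge0 ?invr_ge0 ?cabs_ge0// ler_wpM2r ?invr_ge0 ?cabs_ge0.
  by rewrite lef_pV2// posrE// (lt_le_trans rho0).
have aab : a <= a <= b by rewrite lexx.
have bab : a <= b <= b by rewrite lexx ab.
have ccd : c <= c <= d by rewrite lexx.
have dcd : c <= d <= d by rewrite lexx cd.
have BX x : a <= x <= b -> let P y := [/\ ccont (fun z => F z * g z) (x +i* y), ccont g (x +i* y) &
      cabs (F (x +i* y) * g (x +i* y)) <= q ^+ n * rho^-1] in P c /\ P d.
  by move=> h /=; case: (Hh x h) => h1 h2; split; apply: bF => //; rewrite eqxx !orbT.
have BY y : c <= y <= d -> let P x := [/\ ccont (fun z => F z * g z) (x +i* y), ccont g (x +i* y) &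
      cabs (F (x +i* y) * g (x +i* y)) <= q ^+ n * rho^-1] in P a /\ P b.
  by move=> h /=; case: (Hv y h) => h1 h2; split; apply: bF => //; rewrite eqxx ?orbT.
(* [F z0 = 1] and [F] is differentiable at [z0], so [(F - 1) * g] stays bounded near [z0] and
   [cauchy_punctured] applies to it. *)
have -> : circ g a b c d = circ (fun z => F z * g z) a b c d.
  apply/esym/eqP; rewrite -subr_eq0 -circB; first last.
  - by move=> y /BY[[? ? ?] [? ? ?]]; split.
  - by move=> x /BX[[? ? ?] [? ? ?]]; split.
  have /cdiffP[l Hl] := dF z0 (ltac:(rewrite /=; lra)) (ltac:(rewrite /=; lra)).
  have [r r0 Hr] := hasder_lip Hl.
  apply/eqP; apply: (@cauchy_punctured _ x0 y0 a b c d (cabs l + 1) (r / 2)) => //.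
  - by rewrite divr_gt0.
  - move=> z z1 z2 zz; apply: cdiffB; last exact: dg.
    by apply: cdiffM; [exact: dF|exact: dg].
  - move=> z zr zz; have : cabs (z - z0) < r by apply: le_lt_trans zr _; lra.
    move=> /Hr; rewrite F0 => h.
    have -> : F z * g z - g z = (F z - 1) * g z by ring.
    rewrite cabsM /g cabsV ler_pdivrMr// cabs_gt0 subr_eq0//.
have -> : 4 * rho^-1 * (b - a + (d - c)) * q ^+ n = 4 * (q ^+ n * rho^-1) * (b - a + (d - c)) by ring.
apply: circ_bound => //.
- by move=> x /BX[[? ? ?] [? ? ?]]; split.
- by move=> y /BY[[? ? ?] [? ? ?]]; split.
Qed.

(** If [v < u], then [C * (v / u) ^+ n] drops below [al] for large n. This is how constant factors
    disappear from estimates that survive taking powers. *)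
Lemma le_of_expr_le (al C u v : R) : 0 < al -> 0 <= v ->
  (forall n, al * u ^+ n <= C * v ^+ n) -> u <= v.
Proof.
move=> al0 v0 H; rewrite leNgt; apply/negP => vu.
have u0 : 0 < u by apply: le_lt_trans vu.
have q01 : 0 <= v / u < 1 by rewrite divr_ge0 ?(ltW u0)//= ltr_pdivrMr// mul1r.
have [n] := expr_small C q01 al0.
rewrite expr_div_n mulrA ltr_pdivrMr ?exprn_gt0// => h.
by have := le_lt_trans (H n) h; rewrite ltxx.
Qed.

(** * Schwarz lemma, continuity of derivatives and the Phragmen-Lindelof principle *)

Lemma ccontX n (l : CC) : ccont (fun w => w ^+ n) l.
Proof. by apply: cdiff_ccont; apply: cdiffX; exact: cdiff_id. Qed.

(** With [g] the quotient, the error of the linear approximation is [(g ^+ n - l ^+ n) * (z - z0)],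
    and [g] tends to [l]. At [z0] itself the factor [z - z0] makes the function 0, whatever value
    the quotient has there. *)
Lemma hasder_quotient_power (f : CC -> CC) (z0 l : CC) n : hasder f z0 l ->
  hasder (fun z => (z - z0) * ((f z - f z0) / (z - z0)) ^+ n) z0 (l ^+ n).
Proof.
move=> H e e0; have [d d0 Hd] := ccontX n l e0.
have [|r r0 Hr] := H (d / 2); first by rewrite divr_gt0.
exists r => // w wr; have [->|wz] := eqVneq w z0.
  by rewrite (subrr z0) !mul0r mulr0 !subrr cabs0 mulr0.
have wz0 : w - z0 != 0 by rewrite subr_eq0.
set g := (f w - f z0) / (w - z0).
have -> : (w - z0) * g ^+ n - (z0 - z0) * ((f z0 - f z0) / (z0 - z0)) ^+ n -
    l ^+ n * (w - z0) = (g ^+ n - l ^+ n) * (w - z0).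
  by rewrite (subrr z0) mul0r; ring.
rewrite cabsM ler_wpM2r ?cabs_ge0//; apply: Hd.
have -> : g - l = (f w - f z0 - l * (w - z0)) / (w - z0) by rewrite /g; field.
rewrite cabsM cabsV ltr_pdivrMr ?cabs_gt0//.
apply: le_lt_trans (Hr w wr) _.
by rewrite ltr_pM2r ?cabs_gt0// ltr_pdivrMr// ltr_pMr// ltr1n.
Qed.

(** Squares rather than disks, because the maximum principle is proved on rectangles. *)
Definition sqr_nbhd (z0 : CC) (r : R) (z : CC) :=
  `|complex.Re z - complex.Re z0| <= r /\ `|complex.Im z - complex.Im z0| <= r.

(* The quotient (f z - f z0) / (z - z0) is only continuous at z0, but its n-th power
   times z - z0 is differentiable there. *)
Lemma schwarz f (z0 : CC) (r B : R) : 0 < r ->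
  (forall z, sqr_nbhd z0 r z -> cdiff f z /\ cabs (f z) <= B) ->
  forall z, sqr_nbhd z0 r z -> cabs (f z - f z0) <= 2 * B / r * cabs (z - z0).
Proof.
move=> r0 H z hz.
have [->|zz] := eqVneq z z0; first by rewrite !subrr cabs0 mulr0.
have Hz0 : sqr_nbhd z0 r z0 by split; rewrite subrr normr0 ltW.
have B0 : 0 <= B by apply: le_trans (cabs_ge0 _) (H z0 Hz0).2.
have zz0 : 0 < cabs (z - z0) by rewrite cabs_gt0 subr_eq0.
pose g w := (f w - f z0) / (w - z0).
suff : cabs (g z) <= 2 * B / r.
  by rewrite /g cabsM cabsV ler_pdivrMr.
(* On the boundary of the square [r <= |w - z0| <= 2 * r], and the numerator of [g] is at most
   [2 * B]. Letting n grow removes the factor [2 * r]. *)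
apply: (@le_of_expr_le (cabs (z - z0)) (2 * r)) => //.
  by rewrite !mulr_ge0 ?invr_ge0// ltW.
move=> n; rewrite -cabsX -cabsM.
set x0 := complex.Re z0; set y0 := complex.Im z0.
have sq x y : x0 - r <= x <= x0 + r -> y0 - r <= y <= y0 + r ->
    sqr_nbhd z0 r (x +i* y).
  by move=> h1 h2; split; rewrite /= ler_distl.
have bd x y : `|x - x0| = r \/ `|y - y0| = r ->
    sqr_nbhd z0 r (x +i* y) ->
    cabs ((x +i* y - z0) * g (x +i* y) ^+ n) <= 2 * r * (2 * B / r) ^+ n.
  move=> hb hs; have [h1 h2] := hs; rewrite /= in h1 h2.
  rewrite cabsM cabsX.
  have wr : r <= cabs (x +i* y - z0).
    case: hb => <-.
      by apply: le_trans (cabs_ge_Re _); rewrite !ReImE.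
    by apply: le_trans (cabs_ge_Im _); rewrite !ReImE.
  have wp : 0 < cabs (x +i* y - z0) by apply: lt_le_trans wr.
  apply: ler_pM; rewrite ?exprn_ge0 ?cabs_ge0//.
    rewrite (le_trans (cabs_le_ReIm _))// !ReImE /= mulr2n mulrDl mul1r lerD//.
  rewrite lerXn2r// ?nnegrE ?cabs_ge0 ?mulr_ge0 ?invr_ge0 ?(ltW r0)//.
  rewrite /g cabsM cabsV ler_pM ?invr_ge0 ?cabs_ge0//; last by rewrite lef_pV2 ?posrE.
  rewrite (le_trans (cabsD _ _))// cabsN mulr2n mulrDl mul1r lerD//.
    exact: (H _ hs).2.
  exact: (H _ Hz0).2.
have [hz1 hz2] := hz.
have xr1 : `|x0 - r - x0| = r by rewrite addrAC subrr add0r normrN gtr0_norm.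
have xr2 : `|x0 + r - x0| = r by rewrite addrAC subrr add0r gtr0_norm.
have yr1 : `|y0 - r - y0| = r by rewrite addrAC subrr add0r normrN gtr0_norm.
have yr2 : `|y0 + r - y0| = r by rewrite addrAC subrr add0r gtr0_norm.
have xi1 : x0 - r <= x0 - r <= x0 + r by clear -r0; lra.
have xi2 : x0 - r <= x0 + r <= x0 + r by clear -r0; lra.
have yi1 : y0 - r <= y0 - r <= y0 + r by clear -r0; lra.
have yi2 : y0 - r <= y0 + r <= y0 + r by clear -r0; lra.
apply: (@maximum_modulus (fun w => (w - z0) * g w ^+ n) (x0 - r) (x0 + r) (y0 - r) (y0 + r)
  (2 * r * (2 * B / r) ^+ n)).
- by clear -r0; lra.
- by clear -r0; lra.
- move=> [x y] /= hx hy; have [df _] := H _ (sq _ _ hx hy).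
  have [->|ne] := eqVneq (x +i* y) z0.
    have /cdiffP[l Hl] := (H _ Hz0).1.
    by apply/cdiffP; exists (l ^+ n); exact: hasder_quotient_power Hl.
  have dg : cdiff g (x +i* y).
    exact: cdiffM (cdiffB df (@cdiff_cst _ _)) (cdiff_inv_sub ne).
  exact: cdiffM (cdiffB (@cdiff_id _) (@cdiff_cst _ _)) (@cdiffX _ n _ dg).
- move=> x hx; split; apply: bd; try exact: sq; by right.
- move=> y hy; split; apply: bd; try exact: sq; by left.
- by rewrite -ler_distl.
- by rewrite -ler_distl.
Qed.

Lemma hasder_limit (f : CC -> CC) (z l : CC) : hasder f z l ->
  forall e : R, 0 < e -> exists2 d : R, 0 < d & forall h, h != 0 -> cabs h < d ->
    cabs ((f (z + h) - f z) / h - l) <= e.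
Proof.
move=> H e /H[d d0 Hd]; exists d => // h h0 hd.
have := Hd (z + h); rewrite addrAC subrr add0r => /(_ hd) K.
have -> : (f (z + h) - f z) / h - l = (f (z + h) - f z - l * h) / h by field.
by rewrite cabsM cabsV ler_pdivrMr ?cabs_gt0.
Qed.

Lemma sqr_nbhd_cabs (z0 z : CC) (r : R) : cabs (z - z0) <= r -> sqr_nbhd z0 r z.
Proof.
move=> h; split; rewrite (le_trans _ h)//.
  by rewrite -Re_opp -Re_add cabs_ge_Re.
by rewrite -Im_opp -Im_add cabs_ge_Im.
Qed.

Lemma cabs_sqr_nbhd (z0 z : CC) (r : R) : sqr_nbhd z0 r z -> cabs (z - z0) <= 2 * r.
Proof.
move=> [h1 h2]; rewrite (le_trans (cabs_le_ReIm _))// !ReImE mulr2n mulrDl mul1r.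
by rewrite lerD.
Qed.

Lemma sqr_nbhdD (z0 z w : CC) (r s : R) : sqr_nbhd z0 r z -> sqr_nbhd z s w ->
  sqr_nbhd z0 (r + s) w.
Proof.
move=> [h1 h2] [h3 h4]; split.
  by rewrite (le_trans (ler_distD (complex.Re z) _ _))// addrC lerD.
by rewrite (le_trans (ler_distD (complex.Im z) _ _))// addrC lerD.
Qed.

(** Difference quotients with a small step [h] are holomorphic and, by the Schwarz lemma, bounded
    uniformly in [h]. A second use of that lemma makes them Lipschitz at [z0] with a constant [Q]
    free of [h], and this survives [h -> 0]. *)
Lemma derivative_continuous (f df : CC -> CC) (z0 : CC) (rho : R) : 0 < rho ->
  (forall z, cabs (z - z0) < rho -> hasder f z (df z)) -> ccont df z0.
Proof.
move=> rho0 H.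
have H0 : hasder f z0 (df z0) by apply: H; rewrite subrr cabs0.
have [d d0 Hd] := cdiff_ccont (hasder_cdiff H0) ltr01.
(* All points used below lie in the square of half-side [3 * r], hence at distance at most
   [6 * r < 8 * r] from [z0]. *)
pose r := Num.min d rho / 8.
have m0 : 0 < Num.min d rho by rewrite lt_min d0.
have r0 : 0 < r by rewrite divr_gt0.
have [r8d r8rho] : 8 * r <= d /\ 8 * r <= rho.
  by rewrite /r mulrC divfK ?pnatr_eq0// !ge_min !lexx orbT.
have dcf z : sqr_nbhd z0 (r + r + r) z -> cdiff f z.
  move=> /cabs_sqr_nbhd hz; apply: hasder_cdiff (H z _).
  by apply: le_lt_trans hz _; move: r0 r8rho; clear; lra.
have Hr z : cabs (z - z0) <= r -> hasder f z (df z).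
  by move=> hz; apply: H; apply: le_lt_trans hz _; move: r0 r8rho; clear; lra.
pose B := cabs (f z0) + 1.
have B0 : 0 <= B by rewrite addr_ge0// cabs_ge0.
have fB z : sqr_nbhd z0 (r + r + r) z -> cabs (f z) <= B.
  move=> /cabs_sqr_nbhd hz; rewrite -(subrK (f z0) (f z)) (le_trans (cabsD _ _))//.
  by rewrite addrC lerD// Hd// (le_lt_trans hz)//; move: r0 r8d; clear; lra.
have three z u : sqr_nbhd z0 r z -> sqr_nbhd z r u -> sqr_nbhd z0 (r + r + r) u.
  move=> hz hu; have [hh1 hh2] := sqr_nbhdD hz hu; split.
    by rewrite (le_trans hh1)// lerDl ltW.
  by rewrite (le_trans hh2)// lerDl ltW.
pose Q := 2 * (2 * B / r) / r.
have Q0 : 0 <= Q by rewrite !mulr_ge0 ?invr_ge0// ltW.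
have key w : cabs (w - z0) <= r -> cabs (df w - df z0) <= Q * cabs (w - z0).
  move=> wr; apply/ler_addgt0Pr => e e0.
  have e20 : 0 < e / 2 by rewrite divr_gt0.
  have [d1 d10 H1] := hasder_limit (Hr w wr) e20.
  have [d2 d20 H2] := hasder_limit H0 e20.
  pose t := Num.min (Num.min d1 d2) r / 2.
  have t0 : 0 < t by rewrite divr_gt0// !lt_min d10 d20.
  have tm : t < Num.min (Num.min d1 d2) r.
    by rewrite /t ltr_pdivrMr// ltr_pMr ?ltr1n// !lt_min d10 d20.
  pose h : CC := t%:C.
  have hE : cabs h = t by rewrite cabs_real gtr0_norm.
  have h0 : h != 0 by rewrite -cabs_gt0 hE.
  move: tm; rewrite !lt_min => /andP[/andP[td1 td2] tr].
  pose D z := (f (z + h) - f z) / h.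
  have := H1 h h0; rewrite hE => /(_ td1); rewrite -/(D w) => K1.
  have := H2 h h0; rewrite hE => /(_ td2); rewrite -/(D z0) => K2.
  have DB z : sqr_nbhd z0 r z -> cdiff D z /\ cabs (D z) <= 2 * B / r.
    move=> hz; split.
      apply: cdiffM; last exact: cdiff_cst.
      apply: cdiffB; last first.
        apply: dcf; have [hh1 hh2] := hz; split.
          by rewrite (le_trans hh1)// lerDr addr_ge0// ltW.
        by rewrite (le_trans hh2)// lerDr addr_ge0// ltW.
      have /cdiffP[l hl] : cdiff f (z + h).
        apply: dcf; apply: three hz _; apply: sqr_nbhd_cabs.
        by rewrite addrAC subrr add0r hE ltW.
      exact: hasder_cdiff (hasder_shift hl).
    rewrite /D cabsM cabsV ler_pdivrMr ?cabs_gt0//.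
    have := @schwarz f z r B r0 _ (z + h).
    rewrite addrAC subrr add0r; apply.
      move=> u hu; split; first exact: dcf (three _ _ hz hu).
      exact: fB (three _ _ hz hu).
    by apply: sqr_nbhd_cabs; rewrite addrAC subrr add0r hE ltW.
  have K3 := schwarz r0 DB (sqr_nbhd_cabs wr).
  have -> : df w - df z0 = - (D w - df w) + (D w - D z0) + (D z0 - df z0) by ring.
  rewrite (le_trans (cabsD _ _))//.
  have := cabsD (- (D w - df w)) (D w - D z0); rewrite cabsN => K4.
  rewrite -/Q in K3; move: K1 K2 K3 K4; clear; lra.
move=> e e0; exists (Num.min r (e / (Q + 1))).
  by rewrite lt_min r0 divr_gt0// ltr_wpDl.
move=> w; rewrite lt_min => /andP[/ltW/key hw]; rewrite ltr_pdivlMr ?ltr_wpDl// => we.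
rewrite (le_trans hw)// mulrC (le_trans _ (ltW we))//.
by rewrite ler_wpM2l ?cabs_ge0// lerDl.
Qed.

(* Apply the maximum principle to [F ^+ n / (z + i)] on large rectangles. *)
Lemma phragmen_lindelof (F : CC -> CC) (B m : R) : 0 < m ->
  (forall z, 0 <= complex.Im z -> cdiff F z) ->
  (forall z, 0 <= complex.Im z -> cabs (F z) <= B) ->
  (forall x : R, cabs (F x%:C) <= m) ->
  forall z, 0 <= complex.Im z -> cabs (F z) <= m.
Proof.
move=> m0 dF FB Fm z z0.
have B0 : 0 <= B by apply: le_trans (cabs_ge0 _) (FB z z0).
have iE (w : CC) : 0 <= complex.Im w -> 1 <= cabs (w + 'i%C).
  move=> w0; apply: le_trans (cabs_ge_Im _); rewrite Im_add /=.
  by rewrite (le_trans _ (ler_norm _))// lerDr.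
have i0 (w : CC) : 0 <= complex.Im w -> w + 'i%C != 0.
  by move=> /iE h; rewrite -cabs_gt0 (lt_le_trans ltr01).
have ip (w : CC) : 0 <= complex.Im w -> 0 < cabs (w + 'i%C).
  by move=> /i0; rewrite cabs_gt0.
apply: (@le_of_expr_le (cabs (z + 'i%C))^-1 1) => //; last 1 first.
  move=> n; rewrite mul1r.
  (* Where |w + i| is at least [B ^+ n / m ^+ n], division by it brings [B ^+ n] down to [m ^+ n];
     the other two summands put [z] inside the rectangle. *)
  pose X := `|complex.Re z| + complex.Im z + B ^+ n / m ^+ n.
  have q0 : 0 <= B ^+ n / m ^+ n by rewrite divr_ge0 ?exprn_ge0// ltW.
  have X0 : 0 <= X by rewrite !addr_ge0.
  pose g w := F w ^+ n * (w + 'i%C)^-1.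
  have gb w : 0 <= complex.Im w -> X <= cabs (w + 'i%C) -> cabs (g w) <= m ^+ n.
    move=> w0 wX; rewrite cabsM cabsX cabsV ler_pdivrMr ?ip//.
    apply: le_trans (_ : B ^+ n <= _).
      by rewrite lerXn2r ?nnegrE ?cabs_ge0 ?FB.
    rewrite mulrC -ler_pdivrMr ?exprn_gt0//.
    by apply: le_trans wX; rewrite lerDr addr_ge0.
  have -> : (cabs (z + 'i%C))^-1 * cabs (F z) ^+ n = cabs (g z).
    by rewrite cabsM cabsX cabsV mulrC.
  have XX : `|X| = X by rewrite ger0_norm.
  apply: (@maximum_modulus g (- X) X 0 X) => //.
  - by clear -X0; lra.
  - move=> w _ /andP[w0 _]; apply: cdiffM; first by apply: cdiffX; exact: dF.
    apply: cdiffV; first exact: i0.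
    by apply: cdiffD; [exact: cdiff_id|exact: cdiff_cst].
  - move=> x hx; split.
      have x0 : 0 <= complex.Im (x +i* 0)%C by [].
      rewrite cabsM cabsX cabsV ler_pdivrMr ?ip// -[leLHS]mulr1.
      by rewrite ler_pM ?exprn_ge0 ?cabs_ge0 ?iE// lerXn2r ?nnegrE ?cabs_ge0 ?(ltW m0)// Fm.
    apply: gb => //=; apply: le_trans (cabs_ge_Im _); rewrite Im_add /= ger0_norm ?addr_ge0//.
    by rewrite lerDl.
  - move=> y /andP[y0 _]; split; apply: gb => //; apply: le_trans (cabs_ge_Re _).
      by rewrite Re_add /= addr0 normrN XX.
    by rewrite Re_add /= addr0 XX.
  - by rewrite -ler_norml /X -addrA lerDl addr_ge0.
  - by rewrite z0 /X addrAC addrC lerDl addr_ge0.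
- by rewrite invr_gt0 ip.
- exact: ltW.
Qed.

(** * Derivatives along curves *)

Section RealDerivative.
Variable K : realType.
Implicit Types (g : K -> K) (t l : K).

Definition rder g t l := forall e : K, 0 < e -> exists2 d : K, 0 < d &
  forall s, `|s - t| < d -> `|g s - g t - l * (s - t)| <= e * `|s - t|.

Lemma rderP g t l : rder g t l <-> is_derive t 1 g l.
Proof.
split=> [H|[df dl] e e0].
- have cl : (fun h => h^-1 *: ((g \o shift t) (h *: 1) - g t)) @ 0^' --> l.
    apply/cvgrPdist_le => e /H[d d0 Hd].
    rewrite near_withinE; apply/nbhs_ballP; exists d => //= h.
    rewrite /ball/= sub0r normrN => hd h0.
    have := Hd (h + t); rewrite addrK => /(_ hd) Hw.
    rewrite /GRing.scale /= mulr1.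
    have -> : l - h^-1 * (g (h + t) - g t) = - ((g (h + t) - g t - l * h) / h).
      by field.
    by rewrite normrN normrM normfV ler_pdivrMr ?normr_gt0.
  split; first by apply/cvg_ex; exists l.
  by apply: cvg_lim cl; exact: norm_hausdorff.
- have := df; rewrite /derivable => /cvg_ex[/= l' cl'].
  have ll' : l' = l.
    by rewrite -dl /derive; apply/esym; apply: cvg_lim cl'; exact: norm_hausdorff.
  have /cvgrPdist_le/(_ _ e0) := cl'.
  rewrite near_withinE => /nbhs_ballP[d /= d0 Hd]; exists d => // s sd.
  have [->|st] := eqVneq s t; first by rewrite !subrr mulr0 subrr normr0 mulr0.
  have h0 : s - t != 0 by rewrite subr_eq0.
  have := Hd (s - t); rewrite /ball/= sub0r normrN => /(_ sd h0).
  rewrite ll' /GRing.scale /= mulr1 subrK => Hw.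
  have -> : g s - g t - l * (s - t) = - ((l - (s - t)^-1 * (g s - g t)) * (s - t)).
    by field.
  by rewrite normrN normrM ler_wpM2r.
Qed.

Lemma rder_unique g t l m : rder g t l -> rder g t m -> l = m.
Proof. by move=> /rderP[_ <-] /rderP[_ <-]. Qed.

Lemma rder_econt g t l : rder g t l -> econt g t.
Proof.
move=> /(_ _ ltr01)[d d0 Hd] e e0.
have l0 : 0 < `|l| + 1 by rewrite ltr_wpDl.
exists (Num.min d (e / (`|l| + 1))); first by rewrite lt_min d0 divr_gt0.
move=> s; rewrite lt_min => /andP[/Hd]; rewrite mul1r => hs.
rewrite ltr_pdivlMr// => he; rewrite -(subrK (l * (s - t)) (g s - g t)).
rewrite (le_trans (ler_normD _ _))// normrM.
by move: hs he; set u := `|s - t|; set v := `|_ - _|; lra.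
Qed.

Lemma rder_MVT g dg a b : a <= b -> (forall t, a <= t <= b -> rder g t (dg t)) ->
  exists2 c, a <= c <= b & g b - g a = dg c * (b - a).
Proof.
move=> ab H; have [||c] := @MVT_segment K g dg a b ab.
- by move=> x; rewrite in_itv/= => /andP[/ltW h1 /ltW h2]; apply/rderP/H; rewrite h1.
- by apply: econt_within => t /H; exact: rder_econt.
- by rewrite in_itv/=; exists c.
Qed.

Lemma rder_cos g t l : rder g t l -> rder (fun s => cos (g s)) t (- sin (g t) * l).
Proof. by move=> /rderP h; apply/rderP; exact: is_derive1_comp. Qed.

Lemma rder_sin g t l : rder g t l -> rder (fun s => sin (g s)) t (cos (g t) * l).
Proof. by move=> /rderP h; apply/rderP; exact: is_derive1_comp. Qed.

Lemma rder_acos g t l : -1 < g t < 1 -> rder g t l ->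
  rder (fun s => acos (g s)) t (- (Num.sqrt (1 - g t ^+ 2))^-1 * l).
Proof.
move=> h1 /rderP h; apply/rderP; exact: (@is_derive1_comp _ (@acos K) g t).
Qed.

Lemma rder_derive1 (g : K -> K) t : derivable g t 1 -> rder g t (derive1 g t).
Proof. by move=> h; apply/rderP; rewrite derive1E; exact: derivableP. Qed.

End RealDerivative.

Definition curve_der (g : R -> CC) (t : R) (l : CC) := forall e : R, 0 < e ->
  exists2 d : R, 0 < d & forall s : R, `|s - t| < d ->
    cabs (g s - g t - l * (s - t)%:C) <= e * `|s - t|.

Lemma hasder_curve f a b t l : hasder f (a + t%:C * b) l ->
  curve_der (fun s => f (a + s%:C * b)) t (l * b).
Proof.
move=> H e e0; have b0 : 0 < cabs b + 1 by rewrite ltr_wpDl ?cabs_ge0.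
have [|d d0 Hd] := H (e / (cabs b + 1)); first by rewrite divr_gt0.
exists (d / (cabs b + 1)); first by rewrite divr_gt0.
move=> s; rewrite ltr_pdivlMr// => hs.
have E : a + s%:C * b - (a + t%:C * b) = b * (s - t)%:C :> CC.
  by rewrite rmorphB /=; ring.
have Eb : cabs (b * (s - t)%:C) <= (cabs b + 1) * `|s - t|.
  by rewrite cabsM cabs_real ler_wpM2r// lerDl.
have := Hd (a + s%:C * b); rewrite E => K.
have {}K := K (le_lt_trans Eb (eq_ind _ (fun u => u < d) hs _ (mulrC _ _))).
rewrite -mulrA; apply: le_trans K _.
apply: le_trans (ler_wpM2l _ Eb) _; first by rewrite divr_ge0// ltW.
by rewrite mulrA divfK// lt0r_neq0.
Qed.

Lemma curve_der_Re g t l : curve_der g t l -> rder (fun s => complex.Re (g s)) t (complex.Re l).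
Proof.
move=> H e /H[d d0 Hd]; exists d => // s /Hd; apply: le_trans.
apply: le_trans (cabs_ge_Re _); rewrite !ReImE /=.
by rewrite mulr0 subr0.
Qed.

Lemma curve_der_Im g t l : curve_der g t l -> rder (fun s => complex.Im (g s)) t (complex.Im l).
Proof.
move=> H e /H[d d0 Hd]; exists d => // s /Hd; apply: le_trans.
apply: le_trans (cabs_ge_Im _); rewrite !ReImE /=.
by rewrite mulr0 add0r.
Qed.

Lemma curve_der_unique g t l m : curve_der g t l -> curve_der g t m -> l = m.
Proof.
move=> hl hm; apply: complexEP.
  exact: rder_unique (curve_der_Re hl) (curve_der_Re hm).
exact: rder_unique (curve_der_Im hl) (curve_der_Im hm).
Qed.

Lemma curve_derZ (c : CC) g t l : curve_der g t l -> curve_der (fun s => c * g s) t (c * l).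
Proof.
move=> H e e0; have c0 : 0 < cabs c + 1 by rewrite ltr_wpDl ?cabs_ge0.
have [|d d0 Hd] := H (e / (cabs c + 1)); first by rewrite divr_gt0.
exists d => // s /Hd hs.
have -> : c * g s - c * g t - c * l * (s - t)%:C = c * (g s - g t - l * (s - t)%:C) by ring.
rewrite cabsM (le_trans (ler_wpM2l (cabs_ge0 _) hs))//.
rewrite mulrA ler_wpM2r// mulrCA -[leRHS]mulr1 ler_wpM2l ?(ltW e0)//.
by rewrite ltW// ltr_pdivrMr// mul1r ltrDl.
Qed.

Lemma curve_der_ReIm g t l m :
  rder (fun s => complex.Re (g s)) t l -> rder (fun s => complex.Im (g s)) t m ->
  curve_der g t (l +i* m).
Proof.
move=> hl hm e e0; have e20 : 0 < e / 2 by rewrite divr_gt0.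
have [d1 d10 H1] := hl _ e20; have [d2 d20 H2] := hm _ e20.
exists (Num.min d1 d2); first by rewrite lt_min d10.
move=> s; rewrite lt_min => /andP[/H1 h1 /H2 h2].
rewrite (le_trans (cabs_le_ReIm _))// !ReImE /= !mulr0 subr0 add0r.
rewrite (le_trans (lerD h1 h2))// -mulrDl ler_wpM2r//.
by clear; lra.
Qed.

(* Apply the mean value theorem to the component of g along its chord. *)
Lemma curve_lipschitz g dg (a b M : R) : a <= b ->
  (forall t, a <= t <= b -> curve_der g t (dg t)) ->
  (forall t, a <= t <= b -> cabs (dg t) <= M) ->
  cabs (g b - g a) <= M * (b - a).
Proof.
move=> ab H HM; have [->|ne] := eqVneq (g b - g a) 0.
  rewrite cabs0 mulr_ge0 ?subr_ge0// (le_trans (cabs_ge0 (dg a)))// HM// lexx//.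
pose w := g b - g a; pose c : CC := (w^*)%C.
have w0 : 0 < cabs w by rewrite cabs_gt0.
have [t ht E] := rder_MVT ab (fun t ht => curve_der_Re (curve_derZ c (H t ht))).
have {}E : cabs w ^+ 2 = complex.Re (c * dg t) * (b - a).
  rewrite -E -Re_opp -Re_add -mulrBr -/w sqr_cabs /c; case: (w) => p q /=.
  by ring.
have : cabs w ^+ 2 <= cabs w * M * (b - a).
  rewrite E ler_wpM2r ?subr_ge0// (le_trans (ler_norm _))//.
  rewrite (le_trans (cabs_ge_Re _))// cabsM cabsJ ler_wpM2l ?cabs_ge0//.
  exact: HM.
by rewrite expr2 -mulrA ler_pM2l.
Qed.

(** * The inner function of a Hermite-Biehler function *)

Lemma cabs_expi (t : R) : cabs (expi t) = 1.
Proof. by rewrite cabsE /= cos2Dsin2 sqrtr1. Qed.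

Lemma complex_real_part (z : CC) : complex.Im z = 0 -> z = (complex.Re z)%:C.
Proof. by move=> h; apply: complexEP. Qed.

Lemma hasder_real_curve f (t : R) l : hasder f t%:C l ->
  curve_der (fun s => f s%:C) t l.
Proof.
move=> H; have K : hasder f (0 + t%:C * 1) l by rewrite mulr1 add0r.
have := hasder_curve K; rewrite mulr1.
have -> // : (fun s : R => f (0 + s%:C * 1)) = (fun s : R => f s%:C).
by apply/funext => s; rewrite mulr1 add0r.
Qed.

Lemma curve_der_expi (g : R -> R) t l : rder g t l ->
  curve_der (fun s => expi (g s)) t ((- sin (g t) * l) +i* (cos (g t) * l)).
Proof. by move=> h; apply: curve_der_ReIm; [exact: rder_cos|exact: rder_sin]. Qed.

Lemma cdiff_hasder f z : cdiff f z -> hasder f z (derive (f : CC^o -> CC^o) z 1).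
Proof. by move=> h; apply/is_derive_hasder; exact: derivableP. Qed.

Section HermiteBiehler.
Variables (E : CC -> CC) (phi : R -> R) (tau : R).
Hypotheses (HE : hermite_biehler E) (E0 : forall x : R, E x%:C != 0).
Hypothesis (Hphi : phase_function E phi).
Hypothesis (Htau : Linf_norm (derive1 (phi : R^o -> R^o)) = tau%:E).
Local Notation Theta := (cdivf (sharp E) E).
Local Notation dphi := (derive1 (phi : R^o -> R^o)).

Lemma E_neq0 z : 0 <= complex.Im z -> E z != 0.
Proof.
rewrite le_eqVlt => /orP[/eqP/esym/complex_real_part ->//|z0].
by rewrite -normr_gt0 (le_lt_trans (normr_ge0 _) (HE.2 z z0)).
Qed.

Lemma sharp_cdiff z : cdiff (sharp E) z.
Proof. by apply: cdiff_sharp; exact: HE.1. Qed.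

Lemma Theta_cdiff z : E z != 0 -> cdiff Theta z.
Proof. by move=> z0; exact: cdiff_div z0 (@sharp_cdiff z) (HE.1 z). Qed.

Lemma Theta_real (x : R) : Theta x%:C = expi (phi x).
Proof. exact: Hphi.2. Qed.

Lemma Theta_lt1 z : 0 < complex.Im z -> cabs (Theta z) < 1.
Proof.
move=> z0; have En0 : E z != 0 by apply: E_neq0; exact: ltW.
rewrite /cdivf cabsM cabsV ltr_pdivrMr ?cabs_gt0// mul1r /sharp cabsJ.
by have := HE.2 z z0; rewrite !normC_cabs ltcR.
Qed.

Lemma Theta_le1 z : 0 <= complex.Im z -> cabs (Theta z) <= 1.
Proof.
rewrite le_eqVlt => /orP[/eqP/esym/complex_real_part ->|/Theta_lt1/ltW//].
by rewrite Theta_real cabs_expi.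
Qed.

Lemma rder_phi x : rder phi x (dphi x).
Proof. by apply: rder_derive1; exact: Hphi.1. Qed.

Lemma Theta_derivative (x : R) l : hasder Theta x%:C l ->
  l = (- sin (phi x) * dphi x) +i* (cos (phi x) * dphi x).
Proof.
move=> /hasder_real_curve h; apply: (curve_der_unique h).
have := curve_der_expi (rder_phi x).
by have -> : (fun s => expi (phi s)) = (fun s => Theta s%:C)
  by apply/funext => s; rewrite Theta_real.
Qed.

Lemma cabs_Theta_derivative (x : R) l : hasder Theta x%:C l -> cabs l = `|dphi x|.
Proof.
move=> /Theta_derivative ->; rewrite cabsE /=.
set d := dphi x.
have -> : (- sin (phi x) * d) ^+ 2 + (cos (phi x) * d) ^+ 2 = d ^+ 2.
  rewrite !exprMn -mulrDl sqrrN addrC cos2Dsin2 mul1r//.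
by rewrite sqrtr_sqr.
Qed.

(** On the real line |phi'| = |Theta'|, and the derivative of a holomorphic function is continuous.
    This is what turns the essential supremum into a pointwise bound, [phi] being assumed
    differentiable only. *)
Lemma dphi_econt x : econt (fun s => `|dphi s|) x.
Proof.
have [rho rho0 Hrho] := ccont_neq0 (cdiff_ccont (HE.1 x%:C)) (E0 x).
have C := derivative_continuous rho0 (fun z hz => cdiff_hasder (Theta_cdiff (Hrho z hz))).
move=> e /C[d d0 Hd]; exists (Num.min d rho); first by rewrite lt_min d0.
move=> s; rewrite lt_min => /andP[sd sr].
have sE : cabs (s%:C - x%:C) = `|s - x| by rewrite -rmorphB cabs_real.
rewrite -(cabs_Theta_derivative (cdiff_hasder (Theta_cdiff (E0 s)))).
rewrite -(cabs_Theta_derivative (cdiff_hasder (Theta_cdiff (E0 x)))).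
by rewrite (le_trans (cabs_distB _ _))// Hd// sE.
Qed.

Lemma dphi_le x : `|dphi x| <= tau.
Proof.
rewrite leNgt; apply/negP => h.
have [|d d0 Hd] := dphi_econt x (e := (`|dphi x| - tau) / 2).
  by rewrite divr_gt0// subr_gt0.
have := ess_sup_ge (@lebesgue_measure R) (fun x => (`|dphi x|)%:E).
rewrite -/(Linf_norm _) Htau => -[N [mN N0 sub]].
(* By continuity the excess over [tau] persists on an interval, which cannot be contained in a null
   set. *)
have sI : `]x - d, x + d[%classic `<=` N.
  move=> s /=; rewrite in_itv/= -ltr_distl => /Hd hs.
  apply: sub => /=; apply/negP; rewrite -ltNge lte_fin.
  by move: hs h; rewrite ler_distl => /andP[+ _]; lra.
have : (@lebesgue_measure R `](x - d)%R, (x + d)%R[%classic <= @lebesgue_measure R N)%E.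
  by apply: le_measure => //; rewrite inE.
rewrite N0 lebesgue_measure_itv/= lte_fin.
have -> : x - d < x + d by lra.
by rewrite -EFinD lee_fin; apply/negP; rewrite -ltNge; lra.
Qed.

Lemma tau_ge0 : 0 <= tau.
Proof. exact: le_trans (normr_ge0 _) (dphi_le 0). Qed.

Lemma Theta_real_lipschitz (a b : R) : a <= b ->
  cabs (Theta b%:C - Theta a%:C) <= tau * (b - a).
Proof.
move=> ab; have D t := cdiff_hasder (Theta_cdiff (E0 t)).
apply: (curve_lipschitz (g := fun s : R => Theta s%:C) ab
  (fun t _ => hasder_real_curve (D t))).
by move=> t _; rewrite (cabs_Theta_derivative (D t)) dphi_le.
Qed.

(* Phragmen-Lindelof for the difference quotients of Theta, bounded by 2/h. *)
Lemma Theta_derivative_le z l : 0 <= complex.Im z -> hasder Theta z l -> cabs l <= tau.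
Proof.
move=> z0 Hl; apply/ler_addgt0Pr => e e0.
have e20 : 0 < e / 2 by rewrite divr_gt0.
have [d d0 Hd] := hasder_limit Hl e20.
pose t := d / 2; have t0 : 0 < t by rewrite divr_gt0.
pose h : CC := t%:C.
have hE : cabs h = t by rewrite cabs_real gtr0_norm.
have h0 : h != 0 by rewrite -cabs_gt0 hE.
have hd : cabs h < d by rewrite hE /t; lra.
have Imh w : complex.Im (w + h) = complex.Im w by rewrite Im_add addr0.
pose D w := (Theta (w + h) - Theta w) * h^-1.
(* The margin [e / 2] keeps the bound positive for [phragmen_lindelof]; [tau > 0] is itself derived
   from the present estimate, in [tau_gt0]. *)
have m0 : 0 < tau + e / 2 by rewrite ltr_wpDl// tau_ge0.
have Dle : cabs (D z) <= tau + e / 2.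
  apply: (@phragmen_lindelof D (2 / t)) => //.
  - move=> w w0; have w0' : 0 <= complex.Im (w + h) by rewrite Imh.
    have /cdiffP[l1 h1] := Theta_cdiff (E_neq0 w0').
    exact: cdiffM (cdiffB (hasder_cdiff (hasder_shift h1)) (Theta_cdiff (E_neq0 w0)))
      (@cdiff_cst _ _).
  - move=> w w0; have w0' : 0 <= complex.Im (w + h) by rewrite Imh.
    rewrite cabsM cabsV hE ler_wpM2r ?invr_ge0 ?(ltW t0)//.
    by rewrite (le_trans (cabsD _ _))// cabsN mulr2n lerD ?Theta_le1.
  - move=> x; rewrite cabsM cabsV hE ler_pdivrMr// -rmorphD.
    apply: le_trans (Theta_real_lipschitz _) _; first by rewrite lerDl ltW.
    by rewrite addrAC subrr add0r ler_wpM2r ?(ltW t0)// lerDl ltW.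
have := Hd h h0 hd; rewrite -/(D z) => K.
rewrite -(subrK (D z) l) (le_trans (cabsD _ _))// cabsB.
by move: K Dle; lra.
Qed.

(** |Theta| is 1 at [x], and Theta moves by at most [tau * y] along the vertical segment from [x] to
    [x + i y]. *)
Lemma Theta_lower (x y : R) : 0 <= y -> 1 - tau * y <= cabs (Theta (x +i* y)).
Proof.
move=> y0; have lineE t : (x +i* t) = x%:C + t%:C * 'i%C :> CC.
  by apply: complexEP; rewrite !ReImE /=; ring.
have D t : 0 <= t <= y -> hasder Theta (x%:C + t%:C * 'i%C)
    (derive (Theta : CC^o -> CC^o) (x +i* t) 1).
  by move=> /andP[t0 _]; rewrite -lineE; apply: cdiff_hasder; apply: Theta_cdiff; exact: E_neq0.
have := curve_lipschitz (g := fun t : R => Theta (x%:C + t%:C * 'i%C)) (M := tau) y0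
  (fun t ht => hasder_curve (D t ht)).
rewrite -!lineE subr0 => K.
have {}K : cabs (Theta (x +i* y) - Theta (x +i* 0)) <= tau * y.
  apply: K => t ht; have [t0 _] := andP ht.
  rewrite cabsM.
  have -> : cabs 'i%C = 1 by rewrite cabsE /= expr0n add0r expr1n sqrtr1.
  have H := D t ht; rewrite -lineE in H.
  by rewrite mulr1; exact: Theta_derivative_le H.
have : cabs (Theta (x +i* 0)) = 1 by rewrite Theta_real cabs_expi.
have := cabsD (Theta (x +i* 0) - Theta (x +i* y)) (Theta (x +i* y)).
rewrite subrK cabsB; move: K; lra.
Qed.

(** For [tau = 0] the lower bound would give |Theta(i)| >= 1, against the strict Hermite-Biehler
    inequality. *)
Lemma tau_gt0 : 0 < tau.
Proof.
rewrite lt_neqAle tau_ge0 andbT; apply/eqP => t0.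
have := @Theta_lower 0 1 ler01; rewrite -t0 mul0r subr0 leNgt.
by rewrite Theta_lt1//=.
Qed.

End HermiteBiehler.

(** * Boundedness of f/E *)

Section RealIntegral.
Variable K : realType.
Local Notation mu := (@lebesgue_measure K).

Lemma itg_le_integral (g h : K -> K) a b : measurable_fun setT g ->
  (forall t, 0 <= g t) -> (forall t, a <= t <= b -> econt h t) ->
  (forall t, a <= t <= b -> 0 <= h t <= g t) ->
  ((itg h a b)%:E <= \int[mu]_t (g t)%:E)%E.
Proof.
move=> mg g0 ch hg; have ih := econt_integrable ch.
have fin : (\int[mu]_(t in `[a, b]) (h t)%:E)%E \is a fin_num.
  exact: integrable_fin_num.
rewrite /itg /Rintegral fineK//.
apply: (@le_trans _ _ (\int[mu]_(t in `[a, b]) (g t)%:E)%E).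
  apply: ge0_le_integral => //.
  - by move=> t /=; rewrite in_itv/= => /hg/andP[h0 _]; rewrite lee_fin.
  - exact: measurable_int ih.
  - by apply/measurable_EFinP; exact: measurable_funTS.
  - by move=> t /=; rewrite in_itv/= => /hg/andP[_ h0]; rewrite lee_fin.
apply: ge0_subset_integral => //.
- exact/measurable_EFinP.
- by move=> t _; rewrite lee_fin.
Qed.

Lemma itg_FTC (h H : K -> K) a b : a < b -> (forall t, rder H t (h t)) ->
  (forall t, a <= t <= b -> econt h t) -> itg h a b = H b - H a.
Proof.
move=> ab dH ch; rewrite /itg /Rintegral (continuous_FTC2 (F := H))//.
- exact: econt_within.
- split.
  + by move=> t _; have /rderP[] := dH t.
  + by apply: cvg_at_right_filter; have /econtP := rder_econt (dH a).
  + by apply: cvg_at_left_filter; have /econtP := rder_econt (dH b).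
- by move=> t _; rewrite derive1E; have /rderP[] := dH t.
Qed.

Lemma econt_measurable (g : K -> K) : (forall t, econt g t) -> measurable_fun setT g.
Proof. by move=> H; apply: continuous_measurable_fun => t; exact/econtP. Qed.

Lemma econt_bounded (g : K -> K) a b : a <= b ->
  (forall t, a <= t <= b -> econt g t) ->
  exists B, forall t, a <= t <= b -> g t <= B.
Proof.
move=> ab ch; have [c _ Hc] := EVT_max ab (econt_within ch).
by exists (g c) => t ht; apply: Hc; rewrite in_itv.
Qed.

End RealIntegral.

Lemma econtc_cabs (g : R -> CC) t : econtc g t -> econt (fun s => cabs (g s)) t.
Proof.
move=> [h1 h2]; apply: econt_cabs => e e0.
have e20 : 0 < e / 2 by rewrite divr_gt0.
have [d1 d10 H1] := h1 _ e20; have [d2 d20 H2] := h2 _ e20.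
exists (Num.min d1 d2); first by rewrite lt_min d10.
move=> s; rewrite lt_min => /andP[/H1 k1 /H2 k2].
rewrite (le_trans (cabs_le_ReIm _))// !ReImE (le_trans (lerD k1 k2))//.
by clear; lra.
Qed.

(** The extreme value theorem bounds |f| on each of the four sides, and the maximum principle
    carries the bound inside. *)
Lemma bounded_on_square f (z0 : CC) (r : R) : 0 < r ->
  (forall z, sqr_nbhd z0 r z -> cdiff f z) ->
  exists B, forall z, sqr_nbhd z0 r z -> cabs (f z) <= B.
Proof.
move=> r0 H; set x0 := complex.Re z0; set y0 := complex.Im z0.
have xx : x0 - r <= x0 + r by clear -r0; lra.
have yy : y0 - r <= y0 + r by clear -r0; lra.
have xl : x0 - r <= x0 - r <= x0 + r by rewrite lexx.
have xr : x0 - r <= x0 + r <= x0 + r by rewrite lexx xx.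
have yl : y0 - r <= y0 - r <= y0 + r by rewrite lexx.
have yr : y0 - r <= y0 + r <= y0 + r by rewrite lexx yy.
have C x y : x0 - r <= x <= x0 + r -> y0 - r <= y <= y0 + r -> ccont f (x +i* y).
  move=> h1 h2; apply: cdiff_ccont; apply: H; split.
    by rewrite ler_distl.
  by rewrite ler_distl.
have [B1 H1] := econt_bounded xx (fun x hx => econtc_cabs (ccont_hline (C x _ hx yl))).
have [B2 H2] := econt_bounded xx (fun x hx => econtc_cabs (ccont_hline (C x _ hx yr))).
have [B3 H3] := econt_bounded yy (fun y hy => econtc_cabs (ccont_vline (C _ y xl hy))).
have [B4 H4] := econt_bounded yy (fun y hy => econtc_cabs (ccont_vline (C _ y xr hy))).
exists (Num.max (Num.max B1 B2) (Num.max B3 B4)) => z [hx hy].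
apply: (@maximum_modulus f (x0 - r) (x0 + r) (y0 - r) (y0 + r)) => //.
- by move=> w h1 h2; apply: H; split; rewrite ler_distl.
- by move=> x hx'; rewrite !le_max H1// H2// orbT.
- by move=> y hy'; rewrite !le_max H3// H4// !orbT.
- by rewrite -ler_distl.
- by rewrite -ler_distl.
Qed.

(* A substitute for the subharmonicity of |f|^p valid for all p > 0: at a near-maximum
   of dist(z, boundary) * |f z|^p, the Schwarz lemma keeps |f| above half its value
   on a disk of radius proportional to the distance. *)
Lemma local_bound (p : R) : 0 < p -> exists2 C : R, 0 < C &
  forall f (z0 : CC) (rho M : R), 0 < rho ->
  (forall z, `|complex.Im z - complex.Im z0| <= rho -> cdiff f z) ->
  (forall y : R, `|y - complex.Im z0| <= rho -> y != 0 ->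
    (\int[@lebesgue_measure R]_x ((cabs (f (x +i* y)%C)) `^ p)%:E <= M%:E)%E) ->
  rho * (cabs (f z0)) `^ p <= C * M.
Proof.
(* [k] to the power [p] is 4: at a point whose distance to the boundary is still at least half of
   that of [zs], a value of |f| above [k * |f zs|] would more than double the weight [w]. *)
move=> p0; pose k : R := 4 `^ p^-1.
have k1 : 1 <= k.
  rewrite -(powRr0 (4 : R)); apply: ler_powR; first by rewrite ler1n.
  by rewrite invr_ge0 ltW.
have k0 : 0 < k by apply: lt_le_trans k1.
have kp : k `^ p = 4 by rewrite -powRrM mulVf ?gt_eqF// powRr1.
pose C : R := 2 * (8 * k) * 2 `^ p.
have C0 : 0 < C by rewrite !mulr_gt0// powR_gt0.
exists C => // f z0 rho M rho0 df Hint.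
have sqP z : sqr_nbhd z0 rho z -> cdiff f z by move=> [_ h]; exact: df.
have [B HB] := bounded_on_square rho0 sqP.
(* Distance to the boundary of the square, in the maximum norm. *)
pose d z := rho - Num.max `|complex.Re z - complex.Re z0| `|complex.Im z - complex.Im z0|.
have dle z : d z <= rho by rewrite lerBlDr lerDl le_max normr_ge0.
have d0P z : 0 <= d z -> sqr_nbhd z0 rho z.
  by rewrite subr_ge0 ge_max => /andP[].
have Pd z : sqr_nbhd z0 rho z -> 0 <= d z.
  by move=> [h1 h2]; rewrite subr_ge0 ge_max h1.
pose w z := d z * cabs (f z) `^ p.
pose S := [set w z | z in sqr_nbhd z0 rho].
have z0in : sqr_nbhd z0 rho z0 by split; rewrite subrr normr0 ltW.
have wz0 : w z0 = rho * cabs (f z0) `^ p.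
  by rewrite /w /d !subrr normr0 maxxx subr0.
have supS : has_sup S.
  split; first by exists (w z0); exists z0.
  exists (rho * B `^ p) => _ [z hz <-]; apply: ler_pM => //; rewrite ?powR_ge0//.
    exact: Pd.
  apply: ge0_ler_powR; rewrite ?nnegrE ?cabs_ge0 ?(ltW p0) ?HB//.
  exact: le_trans (cabs_ge0 _) (HB z hz).
have wle : w z0 <= sup S by apply: sup_upper_bound => //; exists z0.
(* In the trivial case only [0 <= M] is needed, and some horizontal line of the strip other than the
   real axis provides it. *)
have [w0|w0] := leP (w z0) 0.
  rewrite -wz0 (le_trans w0)// mulr_ge0 ?(ltW C0)//.
  have [h|h] := eqVneq (complex.Im z0) 0.
    have := Hint rho; rewrite h subr0 gtr0_norm// gt_eqF// => /(_ (lexx _) isT).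
    rewrite -lee_fin; apply: le_trans; apply: integral_ge0 => x _.
    by rewrite lee_fin powR_ge0.
  have := Hint (complex.Im z0); rewrite subrr normr0 => /(_ (ltW rho0) h).
  rewrite -lee_fin; apply: le_trans; apply: integral_ge0 => x _.
  by rewrite lee_fin powR_ge0.
have S0 : 0 < sup S by apply: lt_le_trans wle.
have [|_ [zs hzs <-] wzs] := @sup_adherent _ S (sup S / 2) _ supS.
  by rewrite divr_gt0.
have {}wzs : sup S < 2 * w zs.
  by move: wzs; clear; lra.
have ws0 : 0 < w zs by move: wzs S0; clear; lra.
pose ds := d zs; have ds0 : 0 < ds.
  rewrite lt_neqAle Pd// andbT; apply: contraTneq ws0 => h.
  by rewrite /w -/ds -h mul0r ltxx.
have fs0 : 0 < cabs (f zs).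
  rewrite lt_neqAle cabs_ge0 andbT; apply: contraTneq ws0 => h.
  by rewrite /w -h powR0 ?gt_eqF// mulr0 ltxx.
have half z : sqr_nbhd zs (ds / 2) z -> ds / 2 <= d z.
  move=> [h1 h2]; rewrite /d.
  have tri (u v x : R) : `|u - v| <= `|u - x| + `|x - v| by exact: ler_distD.
  have := tri (complex.Re z) (complex.Re z0) (complex.Re zs).
  have := tri (complex.Im z) (complex.Im z0) (complex.Im zs).
  have : ds = d zs by []. rewrite /d.
  set m := Num.max `|_ zs - _| _.
  have m1 : `|complex.Re zs - complex.Re z0| <= m by rewrite le_max lexx.
  have m2 : `|complex.Im zs - complex.Im z0| <= m by rewrite le_max lexx orbT.
  move=> dsE t1 t2; rewrite lerBrDr -lerBrDl ge_max; apply/andP; split.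
    by move: h1 t2 m1 dsE; clear; lra.
  by move: h2 t1 m2 dsE; clear; lra.
have ds20 : 0 < ds / 2 by rewrite divr_gt0.
have fle z : sqr_nbhd zs (ds / 2) z -> cdiff f z /\ cabs (f z) <= k * cabs (f zs).
  move=> hz; have hd := half z hz; have hin := d0P z (le_trans (ltW ds20) hd).
  split; first exact: sqP.
  rewrite leNgt; apply/negP => hk.
  have : (k * cabs (f zs)) `^ p < cabs (f z) `^ p.
    by rewrite gt0_ltr_powR ?nnegrE ?cabs_ge0// mulr_ge0 ?cabs_ge0 ?ltW.
  rewrite powRM ?cabs_ge0 ?(ltW k0)// kp => h4.
  have : w z <= sup S by apply: sup_upper_bound => //; exists z.
  apply/negP; rewrite -ltNge; apply: lt_le_trans wzs _.
  apply: (@le_trans _ _ (ds / 2 * cabs (f z) `^ p)); last by rewrite ler_wpM2r ?powR_ge0.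
  rewrite /w -/ds; move: (ltW h4); rewrite -(ler_pM2l ds20) => h5.
  by apply: le_trans h5; rewrite le_eqVlt; apply/orP; left; apply/eqP; field.
have sch := schwarz ds20 fle.
(* The Schwarz bound [4 * k * |f zs| / ds] times [s] is half of |f zs|. *)
pose s := ds / (8 * k).
have s0 : 0 < s by rewrite divr_gt0// mulr_gt0.
have sds : s <= ds / 2.
  rewrite /s ler_pdivrMr ?mulr_gt0//.
  have := ler_wpM2l (ltW ds0) k1; move: ds0; clear; nra.
have lower z : cabs (z - zs) <= s -> cabs (f zs) / 2 <= cabs (f z).
  move=> hz; have hzin : sqr_nbhd zs (ds / 2) z.
    by apply: sqr_nbhd_cabs; exact: le_trans sds.
  have := sch z hzin => h1.
  have h2 : 2 * (k * cabs (f zs)) / (ds / 2) * cabs (z - zs) <= cabs (f zs) / 2.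
    have -> : cabs (f zs) / 2 = 2 * (k * cabs (f zs)) / (ds / 2) * s.
      by rewrite /s; field; rewrite !gt_eqF.
    by rewrite ler_wpM2l// !mulr_ge0 ?invr_ge0 ?cabs_ge0 ?ltW.
  have := cabsD (f zs - f z) (f z); rewrite subrK cabsB => h3.
  by move: h1 h2 h3; clear; lra.
have dszin := d0P zs (ltW ds0).
(* The integral bound is assumed only off the real axis, so for real [zs] the line is moved up by
   [s / 2]; it still has a segment of length [s] within distance [s] of [zs]. *)
have [y [yn0 ysm yin]] : exists y : R,
    [/\ y != 0, `|y - complex.Im zs| <= s / 2 & `|y - complex.Im z0| <= rho].
  have [h|h] := eqVneq (complex.Im zs) 0; last first.
    exists (complex.Im zs); have [_ hh] := dszin; split => //.
    by rewrite subrr normr0 divr_ge0// ltW.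
  have s20 : 0 < s / 2 by rewrite divr_gt0.
  exists (s / 2); split; [by rewrite gt_eqF|by rewrite h subr0 gtr0_norm|].
  have hin : sqr_nbhd zs (ds / 2) (complex.Re zs +i* (s / 2)).
    split => /=; first by rewrite subrr normr0 ltW.
    by rewrite h subr0 gtr0_norm//; move: sds s0; clear; lra.
  by have [_ /=] := d0P _ (le_trans (ltW ds20) (half _ hin)).
have I : (((cabs (f zs) / 2) `^ p * s)%:E <= M%:E)%E.
  apply: le_trans (Hint y yin yn0).
  have -> : (cabs (f zs) / 2) `^ p * s =
      itg (fun=> (cabs (f zs) / 2) `^ p) (complex.Re zs - s / 2) (complex.Re zs + s / 2).
    rewrite itg_cst; last by move: s0; clear; lra.
    by congr (_ * _); clear; lra.
  apply: itg_le_integral.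
  - apply: (measurableT_comp (@measurable_powR R p)).
    apply: econt_measurable => t; apply: econtc_cabs; apply: ccont_hline.
    by apply: cdiff_ccont; exact: df.
  - by move=> t; exact: powR_ge0.
  - by move=> t _; exact: econt_cst.
  - move=> t ht; rewrite powR_ge0/= ge0_ler_powR ?nnegrE ?cabs_ge0 ?divr_ge0 ?cabs_ge0 ?(ltW p0)//.
    apply: lower; rewrite (le_trans (cabs_le_ReIm _))// !ReImE /=.
    have : `|t - complex.Re zs| <= s / 2 by rewrite ler_distl.
    by move: ysm; clear; lra.
have E1 : w zs = 8 * k * 2 `^ p * ((cabs (f zs) / 2) `^ p * s).
  rewrite /w -/ds; have -> : cabs (f zs) `^ p = 2 `^ p * (cabs (f zs) / 2) `^ p.
    by rewrite -powRM ?divr_ge0 ?cabs_ge0// mulrC divfK.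
  by rewrite /s; field; rewrite gt_eqF.
rewrite lee_fin in I; rewrite -wz0.
have k8 : 0 < 8 * k * 2 `^ p by rewrite !mulr_gt0// powR_gt0.
move: I; rewrite -(ler_pM2l k8) -E1 => I.
have -> : C * M = 2 * (8 * k * 2 `^ p * M) by rewrite /C; ring.
by move: wzs wle I; clear; lra.
Qed.

Lemma sharpK f : sharp (sharp f) = f.
Proof. by apply/funext => z; rewrite /sharp !conjcK. Qed.

Lemma cabs_sharp f z : cabs (sharp f z) = cabs (f (z^*)%C).
Proof. by rewrite /sharp cabsJ. Qed.

Lemma HpE_sharp p E f : HpE p E f -> HpE p E (sharp f).
Proof.
move=> [h1 [h2 h3]]; split; last by rewrite sharpK.
by move=> z; apply: cdiff_sharp; exact: h1.
Qed.

Lemma measurable_econt_powR (K : realType) (g : K -> K) (p : K) :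
  (forall t, econt g t) -> measurable_fun setT (fun t => g t `^ p).
Proof.
move=> h; apply: (measurableT_comp (@measurable_powR K p)).
exact: econt_measurable.
Qed.

Lemma cdiff_hline_econt g (x y : R) : cdiff g (x +i* y) ->
  econt (fun t : R => cabs (g (t +i* y))) x.
Proof. by move=> h; apply: econtc_cabs; apply: ccont_hline; exact: cdiff_ccont. Qed.

Section Boundedness.
Variables (E : CC -> CC) (phi : R -> R) (tau : R).
Hypotheses (HE : hermite_biehler E) (E0 : forall x : R, E x%:C != 0).
Hypothesis (Hphi : phase_function E phi).
Hypothesis (Htau : Linf_norm (derive1 (phi : R^o -> R^o)) = tau%:E).
Local Notation Theta := (cdivf (sharp E) E).
Variables (p : R) (f : CC -> CC).
Hypotheses (p0 : 0 < p) (Hf : HpE p E f).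

(** The largest height at which [Theta_lower] still yields |Theta| >= 1/2. *)
Let delta := (2 * tau)^-1.

Lemma delta_gt0 : 0 < delta.
Proof. by rewrite invr_gt0 mulr_gt0// (tau_gt0 HE E0 Hphi Htau). Qed.

Lemma Theta_ge_half (x y : R) : 0 <= y -> y <= delta -> 2^-1 <= cabs (Theta (x +i* y)).
Proof.
move=> y0 yd; apply: le_trans (Theta_lower HE E0 Hphi Htau x y0).
have t0 := tau_gt0 HE E0 Hphi Htau.
have : tau * y <= tau * delta by rewrite ler_wpM2l// ltW.
have -> : tau * delta = 2^-1 by rewrite /delta; field; rewrite gt_eqF.
lra.
Qed.

(** A zero of [E] below the axis is a zero of Theta at the conjugate point, where |Theta| >= 1/2. *)
Lemma E_neq0_strip z : - delta <= complex.Im z -> E z != 0.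
Proof.
case: z => x y /= yd; have [y0|y0] := leP 0 y; first exact: (E_neq0 HE E0).
apply/negP => /eqP Ez.
have y1 : 0 <= - y by rewrite oppr_ge0 ltW.
have y2 : - y <= delta by rewrite lerNl.
have := Theta_ge_half x y1 y2.
rewrite /cdivf cabsM cabs_sharp /= opprK Ez cabs0 mul0r.
by rewrite leNgt invr_gt0 ltr0n.
Qed.

Lemma F_cdiff z : - delta <= complex.Im z -> cdiff (cdivf f E) z.
Proof. by move=> /E_neq0_strip h; exact: cdiff_div h (Hf.1 z) (HE.1 z). Qed.

(** With z' the conjugate of z, |f(z)| = |f^#(z')| and |Theta(z')| = |E(z)| / |E(z')| >= 1/2, so
    replacing the denominator E(z) by E(z') costs at most a factor 2. *)
Lemma F_reflect (x y : R) : y < 0 -> - delta <= y ->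
  cabs (cdivf f E (x +i* y)) <= 2 * cabs (cdivf (sharp f) E (x +i* - y)).
Proof.
move=> y0 yd; have y1 : 0 <= - y by rewrite oppr_ge0 ltW.
have y2 : - y <= delta by rewrite lerNl.
have := Theta_ge_half x y1 y2.
have En0 : E (x +i* - y) != 0 by apply: (E_neq0 HE E0).
have Em0 : E (x +i* y) != 0 by apply: E_neq0_strip.
rewrite /cdivf !cabsM !cabsV !cabs_sharp /= !opprK.
set a := cabs (f _); set b := cabs (E (x +i* y)); set c := cabs (E _).
have b0 : 0 < b by rewrite cabs_gt0.
have c0 : 0 < c by rewrite cabs_gt0.
rewrite ler_pdivlMr// => h; rewrite ler_pdivrMr// -mulrA.
have -> : 2 * (a / c * b) = a * (2 * b / c) by ring.
rewrite -[leLHS]mulr1 ler_wpM2l ?cabs_ge0// ler_pdivlMr// mul1r.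
by move: h; lra.
Qed.

(** Above the axis this is the Hardy condition on f/E; below it, the one on f^#/E, carried over by
    [F_reflect]. The axis itself is left out, as the Hardy condition speaks of [y > 0]. *)
Lemma F_line_integral : exists M : R, forall y : R, - delta <= y -> y != 0 ->
  (\int[@lebesgue_measure R]_x ((cabs (cdivf f E (x +i* y)%C)) `^ p)%:E <= M%:E)%E.
Proof.
have [_ [[_ [M1 H1]] [_ [M2 H2]]]] := Hf.
exists (Num.max M1 (2 `^ p * M2)) => y yd y0.
have [yp|yn] := ltP 0 y.
  by apply: le_trans (H1 y yp) _; rewrite lee_fin le_max lexx.
have {}yn : y < 0 by rewrite lt_neqAle y0.
apply: (@le_trans _ _ (2 `^ p * M2)%:E); last by rewrite lee_fin le_max lexx orbT.
have yy : 0 < - y by rewrite oppr_gt0.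
have dG (x : R) : cdiff (cdivf (sharp f) E) (x +i* - y).
  apply: cdiff_div; first by apply: (E_neq0 HE E0); exact: ltW.
    by apply: cdiff_sharp; exact: Hf.1.
  exact: HE.1.
apply: (@le_trans _ _ (\int[@lebesgue_measure R]_x
    ((2 `^ p)%:E * (cabs (cdivf (sharp f) E (x +i* - y)%C) `^ p)%:E)%E)%E).
  apply: ge0_le_integral => //.
  - by move=> x _; rewrite lee_fin powR_ge0.
  - apply/measurable_EFinP; apply: measurable_econt_powR => x.
    by apply: cdiff_hline_econt; exact: F_cdiff.
  - apply: emeasurable_funM; first exact: measurable_cst.
    apply/measurable_EFinP; apply: measurable_econt_powR => x; exact: cdiff_hline_econt.
  - move=> x _; rewrite -EFinM lee_fin -powRM ?cabs_ge0//.
    by apply: ge0_ler_powR; rewrite ?nnegrE ?mulr_ge0 ?cabs_ge0 ?(ltW p0)// F_reflect.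
rewrite ge0_integralZl//.
- by rewrite EFinM lee_wpmul2l ?lee_fin ?powR_ge0// H2.
- apply/measurable_EFinP; apply: measurable_econt_powR => x; exact: cdiff_hline_econt.
- by move=> x _; rewrite lee_fin powR_ge0.
Qed.

(** Radius [delta] around any point of the closed half-plane stays in the strip where f/E is
    holomorphic, and the constant of [local_bound] does not depend on the centre. *)
Lemma F_bounded : exists B : R, forall z, 0 <= complex.Im z -> cabs (cdivf f E z) <= B.
Proof.
have [M HM] := F_line_integral; have [C C0 HC] := local_bound p0.
exists ((C * M / delta) `^ p^-1) => z z0.
have d0 := delta_gt0.
have : delta * cabs (cdivf f E z) `^ p <= C * M.
  apply: HC => // [w|y]; rewrite ler_distl => /andP[h _].
    by apply: F_cdiff; lra.
  by apply: HM; lra.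
rewrite mulrC -ler_pdivlMr// => h.
have p1 : cabs (cdivf f E z) = (cabs (cdivf f E z) `^ p) `^ p^-1.
  by rewrite -powRrM mulfV ?gt_eqF// powRr1// cabs_ge0.
rewrite p1; apply: ge0_ler_powR; rewrite ?nnegrE ?powR_ge0 ?invr_ge0 ?(ltW p0)//.
exact: le_trans (powR_ge0 _ _) h.
Qed.

End Boundedness.

(** * Differentiation rules for real functions and complex curves *)

Section CurveCalculus.
Variable K : realType.
Implicit Types (g h : K -> K) (t : K).

Lemma rderD g h t l m : rder g t l -> rder h t m -> rder (fun s => g s + h s) t (l + m).
Proof. by move=> /rderP a /rderP b; apply/rderP; exact: is_deriveD. Qed.

Lemma rderB g h t l m : rder g t l -> rder h t m -> rder (fun s => g s - h s) t (l - m).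
Proof. by move=> /rderP a /rderP b; apply/rderP; exact: is_deriveB. Qed.

Lemma rderM g h t l m : rder g t l -> rder h t m ->
  rder (fun s => g s * h s) t (g t * m + h t * l).
Proof. by move=> /rderP a /rderP b; apply/rderP; exact: is_deriveM. Qed.

Lemma rder_cst (k : K) t : rder (fun=> k) t 0.
Proof. by apply/rderP; exact: is_derive_cst. Qed.

Lemma rder_id t : rder id t 1.
Proof. by apply/rderP; exact: is_derive_id. Qed.

End CurveCalculus.

Lemma curve_derM g h t l m : curve_der g t l -> curve_der h t m ->
  curve_der (fun s => g s * h s) t (g t * m + h t * l).
Proof.
move=> gl hm; have g1 := curve_der_Re gl; have g2 := curve_der_Im gl.
have h1 := curve_der_Re hm; have h2 := curve_der_Im hm.
have E1 := rderB (rderM g1 h1) (rderM g2 h2).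
have E2 := rderD (rderM g1 h2) (rderM g2 h1).
have := @curve_der_ReIm (fun s => g s * h s) t _ _ _ _.
have F1 : (fun s => complex.Re (g s * h s)) = (fun s => complex.Re (g s) * complex.Re (h s) -
  complex.Im (g s) * complex.Im (h s)) by apply/funext => s; rewrite Re_mul.
have F2 : (fun s => complex.Im (g s * h s)) = (fun s => complex.Re (g s) * complex.Im (h s) +
  complex.Im (g s) * complex.Re (h s)) by apply/funext => s; rewrite Im_mul.
rewrite F1 F2 => /(_ _ _ E1 E2).
by congr curve_der; apply: complexEP; rewrite !ReImE /=; ring.
Qed.

Lemma curve_derB g h t l m : curve_der g t l -> curve_der h t m ->
  curve_der (fun s => g s - h s) t (l - m).
Proof.
move=> gl hm e e0; have e20 : 0 < e / 2 by rewrite divr_gt0.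
have [d1 d10 H1] := gl _ e20; have [d2 d20 H2] := hm _ e20.
exists (Num.min d1 d2); first by rewrite lt_min d10.
move=> s; rewrite lt_min => /andP[/H1 k1 /H2 k2].
have -> : g s - h s - (g t - h t) - (l - m) * (s - t)%:C =
  (g s - g t - l * (s - t)%:C) - (h s - h t - m * (s - t)%:C) by ring.
rewrite (le_trans (cabsD _ _))// cabsN (le_trans (lerD k1 k2))// -mulrDl ler_wpM2r//.
by clear; lra.
Qed.

Lemma curve_derJ g t l : curve_der g t l ->
  curve_der (fun s => ((g s)^*)%C) t (l^*)%C.
Proof.
move=> H e /H[d d0 Hd]; exists d => // s /Hd.
have -> : ((g s)^*)%C - ((g t)^*)%C - (l^*)%C * (s - t)%:C =
    (g s - g t - l * (s - t)%:C)^*%C.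
  by rewrite !conjB conjM conjc_real.
by rewrite cabsJ.
Qed.

Lemma curve_der_real (u : R -> R) t l : rder u t l ->
  curve_der (fun s => (u s)%:C) t l%:C.
Proof.
move=> h; have := @curve_der_ReIm (fun s => (u s)%:C) t l 0 h.
by apply; exact: rder_cst.
Qed.

(** Divide by [e] and let it tend to 0: the first-order form of an inequality that is an equality at
    0. *)
Lemma curve_der_le A (N : R -> R) (a : CC) (n : R) : curve_der A 0 a -> rder N 0 n ->
  A 0 = 0 -> N 0 = 0 -> (forall e : R, 0 < e -> cabs (A e) <= N e) -> cabs a <= n.
Proof.
move=> dA dN A0 N0 H; apply/ler_addgt0Pr => e e0.
have e20 : 0 < e / 2 by rewrite divr_gt0.
have [d1 d10 H1] := dA _ e20; have [d2 d20 H2] := dN _ e20.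
pose t := Num.min d1 d2 / 2.
have m0 : 0 < Num.min d1 d2 by rewrite lt_min d10.
have t0 : 0 < t by rewrite divr_gt0.
have tn : `|t - 0| = t by rewrite subr0 gtr0_norm.
have : t < Num.min d1 d2 by rewrite /t ltr_pdivrMr// ltr_pMr// ltr1n.
rewrite lt_min => /andP[t1 t2].
have := H1 t; rewrite tn A0 !subr0 => /(_ t1) k1.
have := H2 t; rewrite tn N0 !subr0 => /(_ t2); rewrite ler_distl => /andP[_ k2].
have := cabsD (a * t%:C - A t) (A t); rewrite subrK cabsB cabsM cabs_real gtr0_norm// => k3.
have := H t t0 => k4.
have : cabs a * t <= (n + e) * t by move: k1 k2 k3 k4; clear; lra.
by rewrite ler_pM2r.
Qed.

(** * The Duffin-Schaeffer inequality *)

Section PowerSums.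
Variables (Th H : CC -> CC).

(* [psum n z] is v^n + w^n for the roots v, w of X^2 - 2 H(z) X + Th(z). *)
Fixpoint psum n z : CC := match n with
  | 0%N => 2
  | 1%N => 2 * H z
  | (m.+1 as k).+1 => 2 * H z * psum k z - Th z * psum m z
  end.

Lemma psumSS n z : psum n.+2 z = 2 * H z * psum n.+1 z - Th z * psum n z.
Proof. by []. Qed.

Lemma psum_roots n z v w : v + w = 2 * H z -> v * w = Th z ->
  psum n z = v ^+ n + w ^+ n.
Proof.
move=> Hs Hp; suff : psum n z = v ^+ n + w ^+ n /\ psum n.+1 z = v ^+ n.+1 + w ^+ n.+1.
  by case.
elim: n => [|n [IH1 IH2]]; first by split; rewrite /= ?expr0 ?expr1 -?Hs.
split => //; rewrite psumSS IH1 IH2 -Hs -Hp !exprS; ring.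
Qed.

Lemma psum_cdiff n z : cdiff H z -> cdiff Th z -> cdiff (psum n) z.
Proof.
move=> dH dT; suff : cdiff (psum n) z /\ cdiff (psum n.+1) z by case.
have d2 : cdiff (fun w => 2 * H w) z by exact: cdiffM (@cdiff_cst 2 z) dH.
elim: n => [|n [IH1 IH2]]; first by split; [exact: cdiff_cst|exact: d2].
split; first exact: IH2.
have -> : psum n.+2 = (fun w => 2 * H w * psum n.+1 w - Th w * psum n w).
  by apply/funext => w; rewrite psumSS.
exact: cdiffB (cdiffM d2 IH2) (cdiffM dT IH1).
Qed.

Lemma cabs2 : cabs 2 = 2.
Proof. by rewrite -(rmorph_nat (real_complex R) 2) cabs_real normr_nat. Qed.

Lemma psum_bounded n (D : CC -> Prop) (B : R) :
  (forall z, D z -> cabs (H z) <= B) -> (forall z, D z -> cabs (Th z) <= 1) ->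
  exists C : R, forall z, D z -> cabs (psum n z) <= C.
Proof.
move=> HB HT; suff : (exists C : R, forall z, D z -> cabs (psum n z) <= C) /\
  (exists C : R, forall z, D z -> cabs (psum n.+1 z) <= C) by case.
have b1 z : D z -> cabs (2 * H z) <= 2 * B.
  by move=> hz; rewrite cabsM cabs2 ler_wpM2l// HB.
elim: n => [|n [[C1 H1] [C2 H2]]].
  by split; [exists 2 => z _; rewrite /= cabs2|exists (2 * B) => z; exact: b1].
split; first by exists C2.
exists (2 * B * C2 + 1 * C1) => z hz; rewrite psumSS.
rewrite (le_trans (cabsD _ _))// cabsN !(cabsM (2 * H z)) !(cabsM (Th z)) lerD//.
  by rewrite ler_pM ?cabs_ge0 ?b1 ?H2.
by rewrite ler_pM ?cabs_ge0 ?HT ?H1.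
Qed.

(* Schur-Cohn: if all power sums are at most 2 and |Th z| < 1 then both roots lie in the
   closed unit disk, and v (1 - |w|^2) + w (1 - |v|^2) is at most 1 - |vw|^2. *)
Lemma schur_cohn z : cabs (Th z) < 1 -> (forall n, cabs (psum n z) <= 2) ->
  cabs (2 * (H z - (H z)^*%C * Th z)) <= 1 - cabs (Th z) ^+ 2.
Proof.
move=> T1 P2; pose q := sqrtc (H z ^+ 2 - Th z).
have q2 : q ^+ 2 = H z ^+ 2 - Th z by rewrite sqr_sqrtc.
pose v := H z + q; pose w := H z - q.
have Hs : v + w = 2 * H z by rewrite /v /w; ring.
have Hp : v * w = Th z.
  have -> : v * w = H z ^+ 2 - q ^+ 2 by rewrite /v /w; ring.
  by rewrite q2; ring.
(* As |Th z| < 1, one root outside the unit disk forces the other one inside; then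
   [|a| ^+ n <= 2 + 1] for all n, which [le_of_expr_le] turns into [|a| <= 1]. *)
have disk (a b : CC) : a + b = 2 * H z -> a * b = Th z -> cabs a <= 1.
  move=> hs hp; rewrite leNgt; apply/negP => a1.
  have b1 : cabs b <= 1.
    rewrite leNgt; apply/negP => b1; move: T1; rewrite -hp cabsM ltNge => /negP; apply.
    by rewrite -[leLHS]mulr1 ler_pM// ltW.
  have : cabs a <= 1; last by rewrite leNgt a1.
  apply: (@le_of_expr_le 1 3) => // n; rewrite mul1r expr1n mulr1 -cabsX.
  have -> : a ^+ n = psum n z - b ^+ n by rewrite (psum_roots n hs hp) addrK.
  rewrite (le_trans (cabsD _ _))// cabsN cabsX.
  have := P2 n; have : cabs b ^+ n <= 1 by rewrite exprn_ile1// cabs_ge0.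
  by move: (cabs b ^+ n) (cabs (psum n z)) => x y; clear; lra.
have v1 := disk v w Hs Hp.
have w1 : cabs w <= 1 by apply: (disk w v); [rewrite addrC|rewrite mulrC].
have normE (x : CC) : x^*%C * x = (cabs x ^+ 2)%:C.
  rewrite sqr_cabs; case: x => a b; apply: complexEP; rewrite !ReImE /=; ring.
have -> : 2 * (H z - (H z)^*%C * Th z) =
    v * (1 - cabs w ^+ 2)%:C + w * (1 - cabs v ^+ 2)%:C.
  have -> : 2 * (H z - (H z)^*%C * Th z) = (2 * H z) - (2 * H z)^*%C * Th z.
    by rewrite conjM conjc_nat; ring.
  have cE (x : CC) : (1 - cabs x ^+ 2)%:C = 1 - x^*%C * x.
    by rewrite normE rmorphB.
  by rewrite -Hs -Hp conjD !cE; ring.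
rewrite (le_trans (cabsD _ _))// !(cabsM _ (_ %:C)) !cabs_real -Hp cabsM.
have sq (x : CC) : cabs x <= 1 -> 0 <= 1 - cabs x ^+ 2.
  by move=> h; rewrite subr_ge0 exprn_ile1// cabs_ge0.
rewrite !ger0_norm ?sq//.
have := cabs_ge0 v; have := cabs_ge0 w; move: v1 w1.
move: (cabs v) (cabs w) => a b a1 b1 b0 a0.
have -> : a * (1 - b ^+ 2) + b * (1 - a ^+ 2) = (a + b) * (1 - a * b) by ring.
have -> : 1 - (a * b) ^+ 2 = (1 + a * b) * (1 - a * b) by ring.
rewrite ler_wpM2r//.
  by rewrite subr_ge0 -[leRHS]mulr1 ler_pM.
have : 0 <= (1 - a) * (1 - b) by rewrite mulr_ge0// subr_ge0.
by clear; lra.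
Qed.

End PowerSums.

Lemma expiD (a b : R) : expi (a + b) = expi a * expi b.
Proof.
apply: complexEP; first by rewrite Re_mul /= trigo.cosD.
by rewrite Im_mul /= trigo.sinD addrC.
Qed.

Lemma expiN (a : R) : expi (- a) = (expi a)^*%C.
Proof. by rewrite /expi trigo.cosN trigo.sinN. Qed.

Lemma expi_conjM (a : R) : (expi a)^*%C * expi a = 1.
Proof. by rewrite -expiN -expiD addNr /expi trigo.cos0 trigo.sin0. Qed.

Section DuffinSchaeffer.
Variables (E : CC -> CC) (phi : R -> R).
Hypotheses (HE : hermite_biehler E) (E0 : forall x : R, E x%:C != 0).
Hypothesis (Hphi : phase_function E phi).
Local Notation Theta := (cdivf (sharp E) E).
Local Notation dphi := (derive1 (phi : R^o -> R^o)).
Variables (H : CC -> CC) (u : R -> R) (B : R).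
Hypotheses (dH : forall z, 0 <= complex.Im z -> cdiff H z)
  (HB : forall z, 0 <= complex.Im z -> cabs (H z) <= B)
  (Hu : forall x : R, H x%:C = (u x)%:C * expi (phi x / 2))
  (u1 : forall x, -1 < u x < 1).

(** On the real line, with [u = cos om], the roots are [expi (phi / 2 + om)] and
    [expi (phi / 2 - om)], both unimodular. *)
Lemma psum_le2 n z : 0 <= complex.Im z -> cabs (psum Theta H n z) <= 2.
Proof.
move=> z0.
have [C HC] := psum_bounded n HB (fun z hz => Theta_le1 HE E0 Hphi hz).
have dP w : 0 <= complex.Im w -> cdiff (psum Theta H n) w.
  move=> w0; apply: psum_cdiff (dH w0) _.
  by apply: (Theta_cdiff HE); exact: (E_neq0 HE E0).
suff real (x : R) : cabs (psum Theta H n x%:C) <= 2.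
  exact: (phragmen_lindelof (ltr0n _ 2) dP HC real).
pose om := acos (u x).
have cu : cos om = u x by rewrite acosK// in_itv/=; have /andP[/ltW -> /ltW ->] := u1 x.
have hs : expi (phi x / 2 + om) + expi (phi x / 2 - om) = 2 * H x%:C.
  rewrite Hu -cu !expiD expiN; apply: complexEP; rewrite !ReImE /=; ring.
have hp : expi (phi x / 2 + om) * expi (phi x / 2 - om) = Theta x%:C.
  by rewrite (Theta_real Hphi) -expiD; congr expi; field.
rewrite (psum_roots n hs hp) (le_trans (cabsD _ _))// !cabsX !cabs_expi !expr1n.
by rewrite -[1]/(1%:R) -natrD.
Qed.

(** Multiplying [H] by the conjugate of [expi (phi / 2)] recovers [u] on the real line as a product
    of differentiable curves. *)
Lemma u_derivable x : exists du, rder u x du.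
Proof.
have x0 : 0 <= complex.Im x%:C by [].
have h1 := hasder_real_curve (cdiff_hasder (dH x0)).
have h2 : rder (fun s => phi s / 2) x (phi x * 0 + 2^-1 * dphi x).
  exact: rderM (rder_phi Hphi x) (rder_cst _ _).
have h3 := curve_derJ (curve_der_expi h2).
have := curve_der_Re (curve_derM h1 h3).
have -> : (fun s : R => complex.Re (H s%:C * (expi (phi s / 2))^*%C)) = u.
  apply/funext => s; rewrite Hu mulrAC -mulrA [_^*%C * _]mulrC.
  by rewrite [_ * _^*%C]mulrC expi_conjM mulr1.
by eexists; eassumption.
Qed.

(* First-order expansion of the Schur-Cohn inequality at x + i e, e -> 0+. *)
Lemma duffin_schaeffer x du : rder u x du ->
  4 * du ^+ 2 + u x ^+ 2 * dphi x ^+ 2 <= dphi x ^+ 2 /\ 0 <= dphi x.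
Proof.
move=> hu; have [ph phE] : exists ph : R, ph = dphi x by exists (dphi x).
rewrite -phE; have x0 : 0 <= complex.Im x%:C by [].
have /cdiffP[h' hH] := dH x0.
have /cdiffP[t' hT] := Theta_cdiff HE (E0 x).
have t'E : t' = 'i%C * ph%:C * expi (phi x).
  rewrite (Theta_derivative Hphi hT) -phE.
  by apply: complexEP; rewrite !ReImE /=; ring.
pose e := expi (phi x / 2).
have ee : expi (phi x) = e * e.
  by rewrite /e -expiD; congr expi; field.
have h'E : h' = (du%:C + 'i%C * (u x * ph / 2)%:C) * e.
  have k1 := hasder_real_curve hH.
  have h2 : rder (fun s => phi s / 2) x (phi x * 0 + 2^-1 * dphi x).
    exact: rderM (rder_phi Hphi x) (rder_cst _ _).
  have k2 := curve_derM (curve_der_real hu) (curve_der_expi h2).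
  have FE : (fun s : R => H s%:C) = (fun s : R => (u s)%:C * expi (phi s / 2)).
    by apply/funext => s; rewrite Hu.
  rewrite FE in k1; rewrite (curve_der_unique k1 k2) -phE /e /expi.
  by apply: complexEP; rewrite !ReImE /=; field.
have lineE (s : R) : x%:C + s%:C * 'i%C = (x +i* s) :> CC.
  by apply: complexEP; rewrite !ReImE /=; ring.
have z0E : x%:C + 0%:C * 'i%C = x%:C :> CC by rewrite lineE.
have vH : curve_der (fun s => H (x%:C + s%:C * 'i%C)) 0 (h' * 'i%C).
  by apply: hasder_curve; rewrite z0E.
have vT : curve_der (fun s => Theta (x%:C + s%:C * 'i%C)) 0 (t' * 'i%C).
  by apply: hasder_curve; rewrite z0E.
pose A (s : R) := 2 * (H (x%:C + s%:C * 'i%C) -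
  (H (x%:C + s%:C * 'i%C))^*%C * Theta (x%:C + s%:C * 'i%C)).
pose N (s : R) := 1 - complex.Re ((Theta (x%:C + s%:C * 'i%C))^*%C * Theta (x%:C + s%:C * 'i%C)).
have dA := curve_derZ 2 (curve_derB vH (curve_derM (curve_derJ vH) vT)).
(* |Theta|^2 enters as the real part of conj Theta * Theta, to which the rules for curves apply. *)
have dN := rderB (rder_cst 1 0) (curve_der_Re (curve_derM (curve_derJ vT) vT)).
rewrite z0E in dA dN.
have ec : e^*%C * e = 1 by exact: expi_conjM.
have := curve_der_le dA dN; rewrite z0E Hu (Theta_real Hphi) -/e ee.
have conjR (r : R) : (r%:C)^*%C = r%:C by exact: conjc_real.
(* At the real point both sides of the Schur-Cohn inequality vanish: there H = conj H * Theta and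
   |Theta| = 1. *)
have A0 : 2 * ((u x)%:C * e - ((u x)%:C * e)^*%C * (e * e)) = 0.
  have -> : ((u x)%:C * e)^*%C * (e * e) = (u x)%:C * (e^*%C * e) * e.
    by rewrite conjM conjR; ring.
  by rewrite ec mulr1 subrr mulr0.
have N0 : 1 - complex.Re ((e * e)^*%C * (e * e)) = 0.
  have -> : (e * e)^*%C * (e * e) = (e^*%C * e) * (e^*%C * e) by rewrite conjM; ring.
  by rewrite ec mul1r subrr.
have reg (s : R) : 0 < s -> cabs (2 * (H (x%:C + s%:C * 'i%C) -
    (H (x%:C + s%:C * 'i%C))^*%C * Theta (x%:C + s%:C * 'i%C))) <=
    1 - complex.Re ((Theta (x%:C + s%:C * 'i%C))^*%C * Theta (x%:C + s%:C * 'i%C)).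
  move=> s0; rewrite lineE.
  have -> : complex.Re ((Theta (x +i* s))^*%C * Theta (x +i* s)) = cabs (Theta (x +i* s)) ^+ 2.
    by rewrite sqr_cabs Re_mul; case: (Theta _) => a b /=; ring.
  apply: schur_cohn; first exact: (Theta_lt1 HE E0).
  by move=> n; apply: psum_le2; exact: ltW.
move=> /(_ A0 N0 reg).
set a := cabs _; set n := 0 - _.
have -> : n = 2 * ph.
  rewrite /n t'E ee !conjM.
  have -> : ('i%C)^*%C = - 'i%C :> CC by apply: complexEP; rewrite /= ?oppr0.
  rewrite conjR.
  have -> : e^*%C * e^*%C * ('i%C * ph%:C * (e * e) * 'i%C) + e * e * (- 'i%C * ph%:C * (e^*%C * e^*%C) * - 'i%C)
    = 2 * ('i%C * 'i%C) * ph%:C * (e^*%C * e) ^+ 2 :> CC by ring.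
  by rewrite ec expr1n mulr1 !ReImE /=; ring.
have -> : a = cabs (2 * (2 * 'i%C * du%:C + (u x * ph)%:C) * e).
  rewrite /a; congr cabs; rewrite h'E t'E ee !conjM !conjD !conjM !conjR.
  have -> : ('i%C)^*%C = - 'i%C :> CC by apply: complexEP; rewrite /= ?oppr0.
  have ii : 'i%C * 'i%C = -1 :> CC by rewrite -expr2 sqr_i.
  set w := (u x * ph / 2)%:C.
  have UP : (u x)%:C * ph%:C = 2 * w.
    rewrite -rmorphM /w -(rmorph_nat (real_complex R) 2) -rmorphM.
    by congr _%:C; field.
  have -> : (u x * ph)%:C = 2 * w by rewrite -UP rmorphM.
  set D := du%:C; set c := e^*%C in ec *.
  apply: (@eq_trans _ _ (2 * ((D * 'i%C + ('i%C * 'i%C) * w) * e -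
     (('i%C * 'i%C) * ((u x)%:C * ph%:C) * e * (c * e) +
     (c * e) * e * (- 'i%C * D + ('i%C * 'i%C) * w))))); first by ring.
  by rewrite ec ii UP; ring.
(* What remains is |u phi' + 2 i u'| <= phi': it gives the sign of phi' and, squared, the
   inequality. *)
rewrite !cabsM cabs2 cabs_expi mulr1 ler_pM2l// => h.
have ph0 : 0 <= ph by apply: le_trans (cabs_ge0 _) h.
split => //.
have := cabs_ge0 (2 * 'i%C * du%:C + (u x * ph)%:C) => h0.
have : cabs (2 * 'i%C * du%:C + (u x * ph)%:C) ^+ 2 <= ph ^+ 2.
  by rewrite lerXn2r ?nnegrE.
rewrite sqr_cabs !ReImE /=; lra.
Qed.
End DuffinSchaeffer.

(** * Wallis integrals *)

Section Wallis.
Variable K : realType.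
Implicit Types (t : K).

(* The antiderivative of cos ^+ n vanishing at 0. *)
Fixpoint cosn_prim (n : nat) (t : K) : K := match n with
  | 0%N => t
  | 1%N => sin t
  | (m.+1).+1 => (cos t ^+ m.+1 * sin t + m.+1%:R * cosn_prim m t) / m.+2%:R
  end.

Lemma rder_cosX n t : rder (fun s : K => cos s ^+ n) t (n%:R * cos t ^+ n.-1 * (- sin t)).
Proof.
have hc : rder (@cos K) t (- sin t) by apply/rderP; exact: is_derive_cos.
elim: n => [|n IH].
  by under eq_fun do rewrite expr0; rewrite !mul0r; exact: rder_cst.
under eq_fun do rewrite exprS.
have := rderM hc IH; congr rder; case: n {IH} => [|n]; first by rewrite expr0; ring.
rewrite /= -[n.+2%:R]natr1 exprS; ring.
Qed.

Lemma rder_cosn_prim n t : rder (cosn_prim n) t (cos t ^+ n).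
Proof.
suff : rder (cosn_prim n) t (cos t ^+ n) /\ rder (cosn_prim n.+1) t (cos t ^+ n.+1).
  by case.
elim: n => [|n [IH1 IH2]].
  by split; [exact: rder_id|rewrite expr1; apply/rderP; exact: is_derive_sin].
split => //.
have hs : rder (@sin K) t (cos t) by apply/rderP; exact: is_derive_sin.
have h1 := rderM (rderD (rderM (rder_cosX n.+1 t) hs) (rderM (rder_cst n.+1%:R t) IH1))
  (rder_cst (n.+2%:R)^-1 t).
have E : (cos t ^+ n.+1 * sin t + n.+1%:R * cosn_prim n t) * 0 +
  n.+2%:R^-1 * (cos t ^+ n.+1 * cos t + sin t * (n.+1%:R * cos t ^+ n * (- sin t)) +
    (n.+1%:R * cos t ^+ n + cosn_prim n t * 0)) = cos t ^+ n.+2.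
  have s2 : sin t * sin t = 1 - cos t ^+ 2 by rewrite -(cos2Dsin2 t); ring.
  rewrite !mulr0 add0r addr0.
  have -> : sin t * (n.+1%:R * cos t ^+ n * (- sin t)) =
    - (n.+1%:R * cos t ^+ n * (sin t * sin t)) by ring.
  rewrite s2 !exprS; field.
  by apply/lt0r_neq0; have := ler0n K n; lra.
by rewrite E in h1.
Qed.

Lemma cosn_prim0 n : cosn_prim n 0 = 0.
Proof.
suff : cosn_prim n 0 = 0 /\ cosn_prim n.+1 0 = 0 by case.
elim: n => [|n [IH1 IH2]]; first by split => //=; rewrite sin0.
by split => //=; rewrite sin0 IH1 !mulr0 addr0 mul0r.
Qed.

Local Notation W n := (cosn_prim n (pi / 2)).

Lemma wallis_rec n : W n.+2 = n.+1%:R / n.+2%:R * W n.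
Proof. by rewrite /= cos_pihalf expr0n /= mul0r add0r mulrAC. Qed.

Lemma wallis_gt0 n : 0 < W n.
Proof.
suff : 0 < W n /\ 0 < W n.+1 by case.
elim: n => [|n [IH1 IH2]].
  by split; rewrite /= ?sin_pihalf ?ltr01// divr_gt0 ?pi_gt0.
by split => //; rewrite wallis_rec mulr_gt0// divr_gt0 ?ltr0n.
Qed.

(** By [wallis_rec] the product does not depend on n. *)
Lemma wallis_prod n : n.+1%:R * (W n.+1 * W n) = pi / 2.
Proof.
elim: n => [|n IH]; first by rewrite /= sin_pihalf !mul1r.
rewrite wallis_rec; apply: etrans IH; field.
by apply/lt0r_neq0; have := ler0n K n; lra.
Qed.

Lemma cos_01 t : 0 <= t <= pi / 2 -> 0 <= cos t <= 1.
Proof.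
move=> /andP[t0 t1]; rewrite cos_le1 andbT cos_ge0_pihalf// t1 andbT.
by rewrite (le_trans _ t0)// oppr_le0 divr_ge0// pi_ge0.
Qed.

Lemma wallis_decr n : W n.+1 <= W n.
Proof.
have p0 : 0 <= pi / 2 :> K by rewrite divr_ge0// pi_ge0.
have [c hc] := rder_MVT p0 (fun t _ => rderB (rder_cosn_prim n t) (rder_cosn_prim n.+1 t)).
rewrite !cosn_prim0 !subr0 => E; rewrite -subr_ge0 E mulr_ge0//.
have /andP[c0 c1] := cos_01 hc.
rewrite exprS -[X in X - _]mul1r -mulrBl.
by rewrite mulr_ge0 ?exprn_ge0// subr_ge0.
Qed.

(** [wallis_prod] together with [W n.+1 <= W n]. The factor [1 / (2 * sqrt (2 * pi))] of the theorem
    originates here. *)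
Lemma wallis_lower n : pi / 2 <= n.+1%:R * W n ^+ 2.
Proof.
rewrite -[leLHS](wallis_prod n) ler_wpM2l ?ler0n// expr2.
by rewrite ler_wpM2r ?wallis_decr// ltW// wallis_gt0.
Qed.

(** Bounds the part of the Wallis integral that is lost when the cosine starts at the angle [t]
    instead of 0. *)
Lemma cosn_prim_le n t : 0 <= t <= pi / 2 -> cosn_prim n t <= t.
Proof.
move=> /andP[t0 t1]; have [c hc] := rder_MVT t0 (fun s _ => rder_cosn_prim n s).
rewrite cosn_prim0 !subr0 => ->.
have /andP[c0 c1] : 0 <= cos c <= 1.
  by apply: cos_01; move: hc => /andP[-> /le_trans ->].
by rewrite -[leRHS]mul1r ler_wpM2r// exprn_ile1.
Qed.

Lemma rder_affine (H : K -> K) (h : K) (a b t : K) : rder H (a + b * t) h ->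
  rder (fun s => H (a + b * s)) t (h * b).
Proof.
move=> dH; have := rderD (rder_cst a t) (rderM (rder_cst b t) (rder_id t)).
rewrite mulr0 addr0 mulr1 add0r => /rderP d1; move/rderP: dH => d2.
by apply/rderP; exact: is_derive1_comp.
Qed.

Lemma itg_ext (g h : K -> K) a b : (forall t, a <= t <= b -> g t = h t) ->
  itg g a b = itg h a b.
Proof.
move=> gh; apply: eq_Rintegral => t.
by rewrite inE/= in_itv/=; exact: gh.
Qed.

Lemma econtM (g h : K -> K) t : econt g t -> econt h t -> econt (fun s => g s * h s) t.
Proof. by move=> /econtP a /econtP b; apply/econtP; exact: cvgM. Qed.

Lemma econtX (g : K -> K) n t : econt g t -> econt (fun s => g s ^+ n) t.
Proof.
move=> h; elim: n => [|n IH]; first by under eq_fun do rewrite expr0; exact: econt_cst.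
by under eq_fun do rewrite exprS; exact: econtM.
Qed.

Lemma econt_cos_abs (a b c t : K) : econt (fun s => cos (a + b * `|s - c|)) t.
Proof.
have h : econt (fun s => a + b * `|s - c|) t.
  move=> e e0; have b0 : 0 < `|b| + 1 by rewrite ltr_wpDl.
  exists (e / (`|b| + 1)); first by rewrite divr_gt0.
  move=> s; rewrite ltr_pdivlMr// => hs.
  have -> : a + b * `|s - c| - (a + b * `|t - c|) = b * (`|s - c| - `|t - c|) by ring.
  rewrite normrM (le_trans _ (ltW hs))// mulrC.
  rewrite ler_pM ?normr_ge0// ?lerDl//.
  rewrite (le_trans (ler_dist_dist _ _))// opprB addrA subrK.
  by [].
move/econtP : h => h; apply/econtP.
apply: continuous_comp => //; exact: continuous_cos.
Qed.

(* Both halves of the symmetric integral have the same explicit antiderivative. *)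
Lemma itg_cosn_abs (n : nat) (w tau x0 : K) : 0 < tau -> w < pi / 2 ->
  let l := (pi / 2 - w) * 2 / tau in
  itg (fun x => cos (w + tau / 2 * `|x - x0|) ^+ n) (x0 - l) (x0 + l) =
    4 / tau * (cosn_prim n (pi / 2) - cosn_prim n w).
Proof.
move=> t0 w1 l; have l0 : 0 < l by rewrite divr_gt0// mulr_gt0// subr_gt0.
have C t : econt (fun x => cos (w + tau / 2 * `|x - x0|) ^+ n) t.
  by apply: econtX; exact: econt_cos_abs.
have xl : x0 - l < x0 by rewrite ltrBlDr ltrDl.
have xr : x0 < x0 + l by rewrite ltrDl.
rewrite (itg_split (ltW xl) (ltW xr))//.
have tl : tau / 2 * l = pi / 2 - w by rewrite /l; field; rewrite gt_eqF.
have R : itg (fun x => cos (w + tau / 2 * `|x - x0|) ^+ n) x0 (x0 + l) =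
    2 / tau * (cosn_prim n (pi / 2) - cosn_prim n w).
  rewrite (@itg_ext _ (fun x => cos ((w - tau / 2 * x0) + tau / 2 * x) ^+ n)); last first.
    move=> t /andP[h1 _]; rewrite ger0_norm ?subr_ge0//; congr (cos _ ^+ n); ring.
  have dF s : rder (fun s => 2 / tau * cosn_prim n ((w - tau / 2 * x0) + tau / 2 * s)) s
      (cos ((w - tau / 2 * x0) + tau / 2 * s) ^+ n).
    have := rderM (rder_cst (2 / tau) s)
      (rder_affine (rder_cosn_prim n ((w - tau / 2 * x0) + tau / 2 * s))).
    congr rder; field; by rewrite gt_eqF.
  rewrite (itg_FTC xr dF) => [|t _]; last first.
    apply: econtX; apply: rder_econt.
    exact: rder_affine (rder_cos (rder_id _)).
  rewrite -mulrBr; congr (_ * (cosn_prim _ _ - cosn_prim _ _)); last by ring.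
  by rewrite mulrDr tl; ring.
have L : itg (fun x => cos (w + tau / 2 * `|x - x0|) ^+ n) (x0 - l) x0 =
    2 / tau * (cosn_prim n (pi / 2) - cosn_prim n w).
  rewrite (@itg_ext _ (fun x => cos ((w + tau / 2 * x0) + - (tau / 2) * x) ^+ n)); last first.
    move=> t /andP[_ h1]; rewrite ler0_norm ?subr_le0//; congr (cos _ ^+ n); ring.
  have dF s : rder (fun s => - (2 / tau) * cosn_prim n ((w + tau / 2 * x0) + - (tau / 2) * s)) s
      (cos ((w + tau / 2 * x0) + - (tau / 2) * s) ^+ n).
    have := rderM (rder_cst (- (2 / tau)) s)
      (rder_affine (rder_cosn_prim n ((w + tau / 2 * x0) + - (tau / 2) * s))).
    congr rder; field; by rewrite gt_eqF.
  rewrite (itg_FTC xl dF) => [|t _]; last first.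
    apply: econtX; apply: rder_econt.
    exact: rder_affine (rder_cos (rder_id _)).
  have -> : w + tau / 2 * x0 + - (tau / 2) * x0 = w by ring.
  have -> : w + tau / 2 * x0 + - (tau / 2) * (x0 - l) = pi / 2.
    have -> : w + tau / 2 * x0 + - (tau / 2) * (x0 - l) = w + tau / 2 * l by ring.
    by rewrite tl; ring.
  ring.
rewrite R L; ring.
Qed.

End Wallis.

(** * The embedding constant *)

Section KeyEstimate.
Variables (E : CC -> CC) (phi : R -> R) (tau : R).
Hypotheses (HE : hermite_biehler E) (E0 : forall x : R, E x%:C != 0).
Hypothesis (Hphi : phase_function E phi).
Hypothesis (Htau : Linf_norm (derive1 (phi : R^o -> R^o)) = tau%:E).
Local Notation Theta := (cdivf (sharp E) E).
Local Notation dphi := (derive1 (phi : R^o -> R^o)).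
Variables (p : R) (f : CC -> CC).
Hypotheses (p0 : 0 < p) (Hf : HpE p E f).
Variables (T : R).
Hypotheses (T0 : 0 < T) (HT : forall x : R, cabs (cdivf f E x%:C) < T).
Let F := cdivf f E.
Let G := cdivf (sharp f) E.
Let e (x : R) := expi (phi x / 2).

(** G = conj F * Theta on the real line. This is what makes [H] in [F_lower] a real multiple of
    [expi (phi / 2)] there. *)
Lemma G_real (x : R) : G x%:C = (F x%:C)^*%C * (e x * e x).
Proof.
have -> : e x * e x = Theta x%:C.
  by rewrite (Theta_real Hphi) /e -expiD; congr expi; field.
have Ex : (E x%:C)^*%C != 0 by rewrite conjc_eq0 E0.
rewrite /G /F /cdivf /sharp conjc_real conjM conjc_inv.
by field; rewrite Ex E0.
Qed.

(* Since [acos u] is [tau / 2]-Lipschitz. *)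
Lemma F_lower (x0 : R) : 0 < cabs (F x0%:C) ->
  let w := acos (cabs (F x0%:C) / T) in
  forall x : R, w + tau / 2 * `|x - x0| <= pi / 2 ->
  T * cos (w + tau / 2 * `|x - x0|) <= cabs (F x%:C).
Proof.
move=> Fx0 w; have ce (x : R) : (e x)^*%C * e x = 1 by exact: expi_conjM.
pose c (x : R) := F x%:C * (e x)^*%C.
have cF (x : R) : cabs (c x) = cabs (F x%:C).
  by rewrite cabsM cabsJ cabs_expi mulr1.
have Fc (x : R) : F x%:C = c x * e x by rewrite /c -mulrA ce mulr1.
(* The rotation making [lam * c x0] equal to |F x0|, so that [u x0 = |F x0| / T]; at other points
   |u| is at most |F| / T. *)
pose lam : CC := (c x0)^*%C * ((cabs (c x0))^-1)%:C.
have lam1 : cabs lam = 1.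
  rewrite cabsM cabsJ cabs_real ger0_norm ?invr_ge0 ?cabs_ge0// mulfV//.
  by rewrite cF gt_eqF.
pose u (x : R) := complex.Re (lam * c x) / T.
pose H z := (lam * F z + lam^*%C * G z) * ((2 * T)^-1)%:C.
have ule x : `|u x| <= cabs (F x%:C) / T.
  rewrite /u normrM normfV (gtr0_norm T0) ler_wpM2r ?invr_ge0 ?(ltW T0)//.
  by rewrite (le_trans (cabs_ge_Re _))// cabsM lam1 mul1r cF.
have u1 x : -1 < u x < 1.
  by rewrite -ltr_norml (le_lt_trans (ule x))// ltr_pdivrMr// mul1r HT.
have ux0 : u x0 = cabs (F x0%:C) / T.
  rewrite /u /lam -cF; congr (_ / T).
  have := cF x0; set r := cabs (c x0) => rE.
  have r0 : r != 0 by rewrite rE gt_eqF.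
  have := sqr_cabs (c x0); rewrite -/r; case: (c x0) => a b /= r2.
  rewrite !mulr0 !subr0 add0r.
  have -> : a * r^-1 * a - - b * r^-1 * b = (a ^+ 2 + b ^+ 2) / r by ring.
  by rewrite -r2; field.
have Hu x : H x%:C = (u x)%:C * expi (phi x / 2).
  rewrite /H G_real Fc (conjM (c x)) -/(e x).
  have -> : (c x)^*%C * (e x)^*%C * (e x * e x) = (c x)^*%C * e x * ((e x)^*%C * e x) by ring.
  rewrite ce mulr1.
  have -> : lam * (c x * e x) + lam^*%C * ((c x)^*%C * e x) =
    (lam * c x + (lam * c x)^*%C) * e x by rewrite (conjM lam); ring.
  rewrite /u; case: (lam * c x) => a b; apply: complexEP; rewrite !ReImE /=; field;
    by rewrite gt_eqF.
have dF z : 0 <= complex.Im z -> cdiff F z.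
  by move=> z0; exact: cdiff_div (E_neq0 HE E0 z0) (Hf.1 z) (HE.1 z).
have dG z : 0 <= complex.Im z -> cdiff G z.
  move=> z0; apply: cdiff_div (E_neq0 HE E0 z0) _ (HE.1 z).
  by apply: cdiff_sharp; exact: Hf.1.
have dH z : 0 <= complex.Im z -> cdiff H z.
  move=> z0; exact: cdiffM (cdiffD (cdiffM (@cdiff_cst lam z) (dF z z0))
    (cdiffM (@cdiff_cst (lam^*)%C z) (dG z z0))) (@cdiff_cst _ z).
have [B1 HB1] := F_bounded HE E0 Hphi Htau p0 Hf.
have [B2 HB2] := F_bounded HE E0 Hphi Htau p0 (HpE_sharp Hf).
have HB z : 0 <= complex.Im z -> cabs (H z) <= (B1 + B2) * `|(2 * T)^-1|.
  move=> z0; rewrite /H cabsM cabs_real ler_wpM2r// (le_trans (cabsD _ _))//.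
  by rewrite (cabsM lam) (cabsM (lam^*)%C) (cabsJ lam) lam1 !mul1r lerD ?HB1 ?HB2.
have D x := u_derivable Hphi dH Hu x.
have DS x du := duffin_schaeffer HE E0 Hphi dH HB Hu u1 (x := x) (du := du).
(* The derivative of [acos u] is -u' / sqrt (1 - u^2), and the Duffin-Schaeffer inequality says 4
   u'^2 <= phi'^2 (1 - u^2). *)
have w_der x : exists2 dw, rder (fun s => acos (u s)) x dw & `|dw| <= tau / 2.
  have [du hdu] := D x; have [h1 h2] := DS x du hdu.
  exists (- (Num.sqrt (1 - u x ^+ 2))^-1 * du); first exact: rder_acos.
  have u2 : u x ^+ 2 < 1.
    by rewrite -real_normK ?num_real// expr_lt1// ltr_norml.
  have s0 : 0 < Num.sqrt (1 - u x ^+ 2) by rewrite sqrtr_gt0 subr_gt0.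
  rewrite mulNr normrN normrM normfV (gtr0_norm s0) mulrC ler_pdivrMr//.
  have dt := le_trans (ler_norm _) (dphi_le HE E0 Hphi Htau x).
  have t0 := tau_ge0 HE E0 Hphi Htau.
  rewrite -(@ler_pXn2r _ 2)// ?nnegrE ?mulr_ge0 ?(ltW s0)//.
  rewrite real_normK ?num_real// exprMn sqr_sqrtr; last by rewrite subr_ge0 ltW.
  have : dphi x ^+ 2 <= tau ^+ 2 by rewrite lerXn2r ?nnegrE.
  have u20 : 0 <= 1 - u x ^+ 2 by rewrite subr_ge0 ltW.
  move=> /(ler_wpM2r u20) h3; rewrite exprMn exprVn.
  move: h1 h3; set y := u x ^+ 2; set d := dphi x ^+ 2; set D2 := du ^+ 2.
  by move=> h1 h3; nra.
have lip a b : a <= b -> `|acos (u b) - acos (u a)| <= tau / 2 * (b - a).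
  move=> ab; have /boolp.choice[dw Hdw] : forall x, exists dw, rder (fun s => acos (u s)) x dw /\ `|dw| <= tau / 2.
    by move=> x; have [dw h1 h2] := w_der x; exists dw.
  have [t _ ->] := rder_MVT ab (fun t _ => (Hdw t).1).
  by rewrite normrM [`|b - a|]ger0_norm ?subr_ge0// ler_wpM2r ?subr_ge0// (Hdw t).2.
move=> x hx.
have wx : acos (u x) <= w + tau / 2 * `|x - x0|.
  have wE : w = acos (u x0) by rewrite ux0.
  rewrite wE addrC -lerBlDr.
  have [h|h] := leP x x0.
    rewrite distrC (ger0_norm (_ : 0 <= x0 - x)) ?subr_ge0//.
    by apply: le_trans (lip _ _ h); rewrite distrC ler_norm.
  rewrite ger0_norm ?subr_ge0 ?(ltW h)//.
  by apply: le_trans (lip _ _ (ltW h)); rewrite ler_norm.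
have ub : -1 <= u x <= 1 by have /andP[/ltW -> /ltW ->] := u1 x.
have pi0 : pi / 2 <= pi :> R by have := trigo.pi_ge0 R; lra.
have cosle : cos (w + tau / 2 * `|x - x0|) <= u x.
  rewrite -[leRHS](@trigo.acosK R (u x)); last by rewrite in_itv.
  have A0 := trigo.acos_ge0 ub.
  have := @trigo.ltr_cos R (w + tau / 2 * `|x - x0|) (acos (u x)).
  rewrite !in_itv/= A0 trigo.acos_lepi// (le_trans A0 wx) (le_trans hx pi0) => /(_ isT isT) h.
  by rewrite leNgt h -leNgt.
rewrite mulrC -ler_pdivlMr//; apply: le_trans cosle _.
exact: le_trans (ler_norm _) (ule x).
Qed.

(** The bound of [F_lower] is integrated up to the points where the angle reaches [pi / 2]. Raising
    the exponent from [p] to the integer [n] can only decrease powers of a cosine in [0, 1], and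
    makes the integral explicit. *)
Lemma integral_lower (n : nat) (x0 w : R) : p <= n%:R -> 0 < cabs (F x0%:C) ->
  w = acos (cabs (F x0%:C) / T) ->
  ((T `^ p * (4 / tau * (cosn_prim n (pi / 2) - cosn_prim n w)))%:E <=
    \int[@lebesgue_measure R]_x (cabs (F x%:C) `^ p)%:E)%E.
Proof.
move=> pn Fx0 wE; have t0 := tau_gt0 HE E0 Hphi Htau.
have n0 : (0 < n)%N by rewrite -(ltr0n R) (lt_le_trans p0).
pose q := cabs (F x0%:C) / T.
have q0 : 0 < q by rewrite divr_gt0.
have q1 : q < 1 by rewrite ltr_pdivrMr// mul1r HT.
have qi : -1 <= q <= 1 by rewrite (ltW q1) andbT; lra.
have w0 : 0 <= w by rewrite wE; exact: trigo.acos_ge0.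
have wpi : w <= pi by rewrite wE; exact: trigo.acos_lepi.
have cw : cos w = q by rewrite wE trigo.acosK// in_itv.
have w1 : w < pi / 2.
  have := trigo.pi_ge0 R => pi0.
  have := @trigo.ltr_cos R w (pi / 2).
  rewrite !in_itv/= w0 wpi trigo.cos_pihalf cw q0 => <- //.
  by rewrite divr_ge0//= ler_pdivrMr// ler_peMr// ler1n.
have key := F_lower Fx0; rewrite /= -wE in key.
rewrite -(itg_cosn_abs n x0 t0 w1).
set l := _ / tau.
set h := fun x => _.
have l0 : 0 < l by rewrite divr_gt0// mulr_gt0// subr_gt0.
have tl : tau / 2 * l = pi / 2 - w by rewrite /l; field; rewrite gt_eqF.
have hC t : econt h t by apply: econtX; exact: econt_cos_abs.
have -> : T `^ p * itg h (x0 - l) (x0 + l) = itg (fun x => T `^ p * h x) (x0 - l) (x0 + l).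
  rewrite /itg RintegralZl//; exact: econt_integrable.
apply: itg_le_integral.
- apply: measurable_econt_powR => x.
  have : cdiff F (x +i* 0).
    by exact: cdiff_div (E0 x) (Hf.1 _) (HE.1 _).
  exact: cdiff_hline_econt.
- by move=> x; exact: powR_ge0.
- by move=> x _; apply: econtM => //; exact: econt_cst.
- move=> x; rewrite -ler_distl => hx.
  have a1 : w + tau / 2 * `|x - x0| <= pi / 2.
    have : tau / 2 * `|x - x0| <= tau / 2 * l by rewrite ler_wpM2l// divr_ge0// ltW.
    by rewrite tl; lra.
  have a0 : 0 <= w + tau / 2 * `|x - x0|.
    by rewrite addr_ge0// mulr_ge0// divr_ge0// ltW.
  have /andP[c0 c1] : 0 <= cos (w + tau / 2 * `|x - x0|) <= 1.
    by apply: cos_01; rewrite a0.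
  have hx0 := key x a1; rewrite /h.
  set cc := cos _ in c0 c1 hx0 *.
  rewrite mulr_ge0 ?powR_ge0 ?exprn_ge0//=.
  apply: (@le_trans _ _ ((T * cc) `^ p)); last first.
    by apply: ge0_ler_powR; rewrite ?nnegrE ?mulr_ge0 ?cabs_ge0 ?(ltW p0) ?(ltW T0).
  rewrite powRM ?(ltW T0)// ler_wpM2l ?powR_ge0//.
  move: c0; rewrite le_eqVlt => /orP[/eqP <-|c0].
    by rewrite expr0n gtn_eqF//= powR_ge0.
  by rewrite -powR_mulrn ?(ltW c0)// ger_powR// c0.
Qed.

End KeyEstimate.

(** The constant of the theorem with remainder 1 / sqrt p. Its square (p + 2 + 1/p) / (8 pi)
    slightly exceeds the (p + 2) / (8 pi) that the Wallis bound asks for. *)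
Definition sharp_factor (p : R) : R :=
  (1 / (2 * Num.sqrt (2 * pi))) * (Num.sqrt p + (Num.sqrt p)^-1).

Lemma sharp_factor_gt0 p : 0 < p -> 0 < sharp_factor p.
Proof.
move=> p0; have s0 : 0 < Num.sqrt p by rewrite sqrtr_gt0.
rewrite mulr_gt0//; last by rewrite addr_gt0// invr_gt0.
by rewrite divr_gt0// mulr_gt0// sqrtr_gt0 mulr_gt0// trigo.pi_gt0.
Qed.

(** [wallis_lower] and n + 1 <= p + 2 give 16 W^2 (p + 2) >= 8 pi; the term 1/p in the square of
    [sharp_factor p] only increases the left side. *)
Lemma wallis_sharp_factor (p : R) (n : nat) : 0 < p -> n%:R <= p + 1 ->
  1 <= 4 * cosn_prim n (pi / 2) * sharp_factor p.
Proof.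
move=> p0 np; have W0 := @wallis_gt0 R n; have := @wallis_lower R n.
have pi0 := @trigo.pi_gt0 R.
have K0 := sharp_factor_gt0 p0.
set W := cosn_prim n (pi / 2) in W0 *; rewrite -natr1 => h1.
have s0 : 0 < Num.sqrt p by rewrite sqrtr_gt0.
have s2 : Num.sqrt p ^+ 2 = p by rewrite sqr_sqrtr// ltW.
have q2 : Num.sqrt (2 * pi) ^+ 2 = 2 * pi :> R by rewrite sqr_sqrtr// mulr_ge0// ltW.
have q0 : 0 < Num.sqrt (2 * pi) :> R by rewrite sqrtr_gt0 mulr_gt0.
rewrite -(@ler_pXn2r _ 2)// ?nnegrE ?mulr_ge0 ?(ltW W0) ?(ltW K0)// expr1n.
have kE : sharp_factor p ^+ 2 = (p + 2 + p^-1) / (8 * pi).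
  have -> : 8 * pi = 4 * Num.sqrt (2 * pi) ^+ 2 :> R by rewrite q2; ring.
  have -> : p + 2 + p^-1 = Num.sqrt p ^+ 2 + 2 + (Num.sqrt p ^+ 2)^-1 by rewrite s2.
  rewrite /sharp_factor; field.
  by rewrite !gt_eqF.
rewrite exprMn kE exprMn.
have W2 : pi / 2 <= (p + 2) * W ^+ 2.
  by apply: le_trans h1 _; rewrite ler_wpM2r ?sqr_ge0//; lra.
have pV : 0 < p^-1 by rewrite invr_gt0.
have E (P : R) : P != 0 -> 4 ^+ 2 * W ^+ 2 * ((p + 2 + p^-1) / (8 * P)) =
    2 * (((p + 2) * W ^+ 2) + p^-1 * W ^+ 2) / P.
  by move=> P0; field; rewrite P0 gt_eqF.
rewrite E ?gt_eqF//.
rewrite ler_pdivlMr// mul1r.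
have : 0 <= p^-1 * W ^+ 2 by rewrite mulr_ge0 ?sqr_ge0// ltW.
lra.
Qed.

Section Embedding.
Variables (E : CC -> CC) (phi : R -> R) (tau : R).
Hypotheses (HE : hermite_biehler E) (E0 : forall x : R, E x%:C != 0).
Hypothesis (Hphi : phase_function E phi).
Hypothesis (Htau : Linf_norm (derive1 (phi : R^o -> R^o)) = tau%:E).
Variables (p : R).
Hypothesis (p0 : 0 < p).

Lemma pointwise_bound (f : CC -> CC) (r : R) (x : R) : HpE p E f ->
  (\int[@lebesgue_measure R]_x (cabs (cdivf f E x%:C) `^ p)%:E <= r%:E)%E ->
  cabs (cdivf f E x%:C) `^ p <= tau * sharp_factor p * r.
Proof.
move=> Hf Hr; have t0 := tau_gt0 HE E0 Hphi Htau.
have k0 := sharp_factor_gt0 p0.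
pose A := [set cabs (cdivf f E t%:C) | t in [set: R]].
have [B HB] := F_bounded HE E0 Hphi Htau p0 Hf.
have supA : has_sup A.
  split; first by exists (cabs (cdivf f E 0%:C)); exists 0.
  by exists B => _ [t _ <-]; exact: HB.
pose S := sup A.
have leS t : cabs (cdivf f E t%:C) <= S.
  by apply: sup_upper_bound => //; exists t.
have S0 : 0 <= S by apply: le_trans (cabs_ge0 _) (leS 0).
apply: (@le_trans _ _ (S `^ p)).
  by apply: ge0_ler_powR; rewrite ?nnegrE ?cabs_ge0 ?(ltW p0).
have r0 : 0 <= r.
  rewrite -lee_fin; apply: le_trans Hr; apply: integral_ge0 => t _.
  by rewrite lee_fin powR_ge0.
move: S0; rewrite le_eqVlt => /orP[/eqP <-|S0].
  by rewrite powR0 ?gt_eqF// !mulr_ge0 ?(ltW t0) ?(ltW k0).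
(* The least integer strictly above [p]: [p <= n] serves the integral bound, [n <= p + 1] the
   constant. *)
pose n := (Num.truncn p).+1.
have pn : p <= n%:R by rewrite ltW// truncnS_gt.
have np : n%:R <= p + 1 by rewrite -natr1 lerD2r truncn_le// ltW.
have Wk := wallis_sharp_factor p0 np.
have W0 := @wallis_gt0 R n.
set W := cosn_prim n (pi / 2) in Wk W0 *.
pose X := S `^ p * (4 / tau).
have X0 : 0 < X by rewrite mulr_gt0 ?powR_gt0// divr_gt0.
have pi0 := @trigo.pi_gt0 R.
have main (eta : R) : 0 < eta -> eta < pi / 2 -> X * (W - eta) <= r.
  move=> e0 e1; have [h|h] := leP (W - eta) 0.
    by rewrite (le_trans _ r0)// mulr_ge0_le0// ltW.
  pose c : R := cos eta.
  have c0 : 0 < c by apply: trigo.cos_gt0_pihalf; rewrite e1 andbT; lra.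
  have e2 : eta <= pi by lra.
  have c1 : c < 1.
    have := @trigo.ltr_cos R 0 eta; rewrite !in_itv/= lexx (ltW e0) (ltW pi0) e2 trigo.cos0.
    by move=> ->.
  (* Chosen so that [c * T < S < T]: some |F x0| then exceeds [c * T], and the starting angle at
     [x0] is below [eta]. *)
  pose T := 2 * S / (1 + c).
  have c10 : 0 < 1 + c by lra.
  have ST : S < T by rewrite ltr_pdivlMr//; nra.
  have T0 : 0 < T by apply: lt_trans ST.
  have cT : c * T < S.
    by rewrite mulrA ltr_pdivrMr//; nra.
  have [|_ [x0 _ <-] hx0] := @sup_adherent _ A (S - c * T) _ supA.
    by rewrite subr_gt0.
  rewrite -/S opprB addrC subrK in hx0.
  have Fx0 : 0 < cabs (cdivf f E x0%:C) by apply: lt_trans hx0; rewrite mulr_gt0.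
  have HT t : cabs (cdivf f E t%:C) < T by exact: le_lt_trans (leS t) ST.
  pose q := cabs (cdivf f E x0%:C) / T.
  have cq : c < q by rewrite ltr_pdivlMr.
  have q1 : q < 1 by rewrite ltr_pdivrMr// mul1r.
  have qi : -1 <= q <= 1 by rewrite (ltW q1) andbT; lra.
  pose w := acos q.
  have w0 : 0 <= w by exact: trigo.acos_ge0.
  have wpi : w <= pi by exact: trigo.acos_lepi.
  have we : w < eta.
    have := @trigo.ltr_cos R w eta.
    rewrite !in_itv/= w0 wpi (ltW e0) e2 trigo.acosK ?in_itv//= -/c cq.
    by move=> <-.
  have := integral_lower HE E0 Hphi Htau p0 Hf T0 HT pn Fx0 (erefl w).
  move=> /le_trans /(_ Hr); rewrite lee_fin; apply: le_trans.
  have Wc : cosn_prim n w <= eta.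
    by apply: le_trans (cosn_prim_le n _) (ltW we); rewrite w0 (le_trans (ltW we) (ltW e1)).
  rewrite /X -mulrA.
  apply: ler_pM; rewrite ?powR_ge0//.
  - by rewrite mulr_ge0 ?(ltW h)// divr_ge0// ltW.
  - by apply: ge0_ler_powR; rewrite ?nnegrE ?(ltW p0) ?(ltW S0) ?(ltW T0) ?(ltW ST).
  - by rewrite ler_wpM2l ?divr_ge0 ?(ltW t0)// lerD2l lerN2.
have XW : X * W <= r.
  rewrite leNgt; apply/negP => h.
  (* The first entry gives [X * (W - eta) >= (X * W + r) / 2 > r], the second keeps [eta] below
     [pi / 2]. *)
  pose eta := Num.min ((X * W - r) / (2 * X)) 2^-1.
  have e0 : 0 < eta by rewrite lt_min invr_gt0 ltr0n andbT divr_gt0 ?subr_gt0// mulr_gt0.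
  have e1 : eta < pi / 2.
    have : eta <= 2^-1 by rewrite ge_min lexx orbT.
    have := @trigo.pi_ge2 R. lra.
  have := main eta e0 e1; rewrite mulrBr.
  have : eta <= (X * W - r) / (2 * X) by rewrite ge_min lexx.
  have X20 : 0 < 2 * X by exact: mulr_gt0.
  rewrite (ler_pdivlMr _ _ X20); have -> : eta * (2 * X) = 2 * (X * eta) by ring.
  by move: (X * W) (X * eta) h => a b; lra.
have SX : S `^ p = X * tau / 4 by rewrite /X; field; rewrite gt_eqF.
rewrite SX; apply: (@le_trans _ _ (X * tau / 4 * (4 * W * sharp_factor p))).
  rewrite ler_peMr//; apply: mulr_ge0; last by rewrite invr_ge0.
  exact: mulr_ge0 (ltW X0) (ltW t0).
have -> : X * tau / 4 * (4 * W * sharp_factor p) = tau * sharp_factor p * (X * W) by field.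
by rewrite ler_wpM2l// mulr_ge0 ?(ltW t0) ?(ltW k0).
Qed.

(** The p-th root of the right-hand side is an admissible constant, since [pointwise_bound] holds at
    every real point, and [Cpe] is the infimum of such constants. *)
Lemma embedding_norm_bound : (Cpe p E `^ p <= (tau * sharp_factor p)%:E)%E.
Proof.
have t0 := tau_gt0 HE E0 Hphi Htau.
have k0 : 0 < tau * sharp_factor p by rewrite mulr_gt0// sharp_factor_gt0.
pose k := (tau * sharp_factor p) `^ p^-1.
have kgt0 : 0 < k by rewrite powR_gt0.
have kp : k `^ p = tau * sharp_factor p.
  by rewrite -powRrM mulVf ?gt_eqF// powRr1// ltW.
have Ck : (Cpe p E <= k%:E)%E.
  apply: ereal_inf_lbound; split; first by rewrite lee_fin ltW.
  move=> f Hf; apply: ge_ereal_sup => _ [x _ <-].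
  rewrite /normp; set I := (\int[_]_x _)%E.
  have I0 : (0 <= I)%E by apply: integral_ge0 => t _; rewrite lee_fin powR_ge0.
  (* For an infinite norm the bound is trivial: [k > 0] rules out the convention 0 * oo = 0. *)
  have [Ify|] := eqVneq I +oo%E.
    by rewrite Ify poweRyr ?invr_neq0 ?gt_eqF// gt0_muley ?lte_fin// leey.
  rewrite -ltey -ge0_fin_numE// => /fineK If.
  have r0 : 0 <= fine I by exact: fine_ge0.
  rewrite -If poweR_EFin -EFinM lee_fin -powRM ?(ltW k0)//.
  have := @pointwise_bound f (fine I) x Hf; rewrite If => /(_ (lexx _)) h.
  have -> : cabs (f x%:C / E x%:C) = (cabs (cdivf f E x%:C) `^ p) `^ p^-1.
    by rewrite -powRrM mulfV ?gt_eqF// powRr1// cabs_ge0.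
  apply: ge0_ler_powR; rewrite ?nnegrE ?powR_ge0 ?invr_ge0 ?(ltW p0)//.
  by rewrite mulr_ge0 ?(ltW k0).
have C0 : (0 <= Cpe p E)%E by apply: le_ereal_inf_tmp => x [].
rewrite -kp -poweR_EFin; apply: gt0_ler_poweR; rewrite ?(ltW p0)//.
  by rewrite in_itv/= C0 leey.
by rewrite in_itv/= lee_fin (ltW kgt0) leey.
Qed.

End Embedding.

(** An essential supremum is nonnegative for a nonnegative function only if the space is not
    null. *)
Lemma lebesgue_measure_setT_gt0 (K : realType) : (0 < @lebesgue_measure K setT)%E.
Proof. by rewrite -set_itvNyy lebesgue_measure_itv/= addye. Qed.

Unset Implicit Arguments.

Theorem theorem3 :
  exists Rem : R -> R,
    (exists M : R, \forall p \near +oo, `|Rem p| <= M * p `^ (- 2^-1)) /\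
    forall (E : CC -> CC) (phi : R -> R),
      hermite_biehler E ->
      (forall x : R, E x%:C != 0) ->
      phase_function E phi ->
      (Linf_norm (derive1 (phi : R^o -> R^o)) < +oo)%E ->
      forall p : R, 0 < p ->
        (Cpe p E `^ p <=
           Linf_norm (derive1 (phi : R^o -> R^o)) *
             ((1 / (2 * Num.sqrt (2 * pi))) * (Num.sqrt p + Rem p))%:E)%E.
Proof.
exists (fun p => (Num.sqrt p)^-1); split.
  exists 1; near=> p; have p0 : 0 < p by near: p; exact: nbhs_pinfty_gt.
  rewrite mul1r ger0_norm ?invr_ge0 ?sqrtr_ge0//.
  by rewrite powRN powR12_sqrt// ltW.
move=> E phi HE E0 Hphi fin p p0.
have L0 : (0 <= Linf_norm (derive1 (phi : R^o -> R^o)))%E.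
  apply: ess_sup_gee; last by apply: nearW => x; rewrite lee_fin.
  exact: lebesgue_measure_setT_gt0.
have fin2 : Linf_norm (derive1 (phi : R^o -> R^o)) \is a fin_num.
  by rewrite ge0_fin_numE.
have Htau := esym (fineK fin2).
rewrite [X in (_ <= X * _)%E]Htau -EFinM.
exact: (embedding_norm_bound HE E0 Hphi Htau p0).
Unshelve. all: by end_near.
Qed.
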